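(* Let $c_s,c_o>0$ and let $\sigma_o\cap\sigma(S_d)=\emptyset$, where $\sigma_o=\{ij^2\pi^2-c_o: j=0,1,2,\dots\}$. Let $n\in C^2([0,1];\mathbb{C}^{n_d})$ be the solution of $$i\,n''(x)^\top+n(x)^\top S_d+c_o\,n(x)^\top=\mathcal{F}_o^{-1}[g](x)\,q_{d_1}^\top,\qquad n'(0)^\top=q_{d_2}^\top,\qquad n'(1)^\top=0,$$ and let the observer gains be $l(x)=\mathcal{F}_o[n(\cdot)^\top l_d](x)-i\,p_\xi(x,1)$ and $l_0=p(1,1)$. Let $l_r$ be chosen so that $S_r+l_rq_r^\top$ is Hurwitz, and suppose that $S_d+l_dn(1)^\top$ is also Hurwitz. Moreover, assume that $S_r+l_rq_r^\top$ has simple (stable) eigenvalues $\lambda_{rj}$, $j=1,\dots,n_r$, that $S_d+l_dn(1)^\top$ has simple (stable) eigenvalues $\lambda_{dj}$, $j=1,\dots,n_d$, and $\lambda_{rj_1}\ne\lambda_{dj_2}$ for $1\le j_1\le n_r$, $1\le j_2\le n_d$. Then the system $$\begin{cases}\dot{\widehat w}_r=S_r\widehat w_r+l_r(q_r^\top\widehat w_r-r),\\ \dot{\widehat w}_d=S_d\widehat w_d+l_d(\widehat z(1,t)-y_m(t)),\\ \widehat z_t=-i\widehat z_{xx}+h\widehat z+g\,q_{d_1}^\top\widehat w_d+l(x)[\widehat z(1,t)-y_m(t)],\\ \widehat z_x(0,t)=-iq\widehat z(0,t)+q_{d_2}^\top\widehat w_d(t),\\ \widehat z_x(1,t)=u(t)+l_0[\widehat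 z(1,t)-y_m(t)]\end{cases}$$ is an observer for the plant (together with its exosystem). Moreover, the dynamics of the observer errors $\widetilde w_r=\widehat w_r-w_r$, $\widetilde w_d=\widehat w_d-w_d$, $\widetilde z=\widehat z-z$, namely $$\begin{cases}\dot{\widetilde w}_r=(S_r+l_rq_r^\top)\widetilde w_r,\qquad\dot{\widetilde w}_d=S_d\widetilde w_d+l_d\widetilde z(1,t),\\ \widetilde z_t=-i\widetilde z_{xx}+h\widetilde z+g\,q_{d_1}^\top\widetilde w_d+l(x)\widetilde z(1,t),\\ \widetilde z_x(0,t)=-iq\widetilde z(0,t)+q_{d_2}^\top\widetilde w_d(t),\qquad\widetilde z_x(1,t)=l_0\widetilde z(1,t),\end{cases}$$ is exponentially stable in the sense that for some $M\ge1$, $\mu>0$, $$\|(\widetilde w_d(t),\widetilde w_r(t),\widetilde z(\cdot,t))\|\le Me^{-\mu t}\|(\widetilde w_d(0),\widetilde w_r(0),\widetilde z(\cdot,0))\|$$ for all $t\ge0$ and all initial errors in $\mathbb{C}^{n_d}\times\mathbb{C}^{n_r}\times L^2[0,1]$.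
   Context: Function spaces are over $\mathbb{C}$. Fixed data: $q>0$ and $h,g\in C[0,1]$. The plant is $$z_t=-iz_{xx}+h(x)z+g(x)d_1(t),\quad z_x(0,t)=-iqz(0,t)+d_2(t),\quad z_x(1,t)=u(t),\quad y_m(t)=z(1,t),$$ with state space $L^2[0,1]$, control $u$ and measurement $y_m$. The exosystem is $\dot w=Sw$, $S=\mathrm{diag}(S_d,S_r)$, $w=(w_d,w_r)\in\mathbb{C}^{n_d}\times\mathbb{C}^{n_r}$, with $d_1=q_{d_1}^\top w_d$, $d_2=q_{d_2}^\top w_d$, $r=q_r^\top w_r$. It is assumed that $S$ is diagonalizable with all eigenvalues on the imaginary axis, the eigenvalues of $S_d$ are distinct, and $(q_r^\top,S_r)$ is observable. The gains $l_r\in\mathbb{C}^{n_r}$ and $l_d\in\mathbb{C}^{n_d}$ are constant vectors. The kernel $p$, of class $C^2$ on $\{0\le x\le\xi\le1\}$, is the solution of $$p_{\xi\xi}(x,\xi)-p_{xx}(x,\xi)=i(h(x)+c_o)p(x,\xi),\quad p_x(0,\xi)+iq\,p(0,\xi)=0,\quad p(x,x)=-\tfrac i2\int_0^x(h(\xi)+c_o)\,d\xi-iq,$$ and $\mathcal{F}_o[f](x)=f(x)-\int_x^1p(x,\xi)f(\xi)\,d\xi$, a boundedly invertible operator on $L^2[0,1]$. $\sigma_o$ is the set of eigenvalues of the operator $f\mapsto-if''-c_of$ with boundary conditions $f'(0)=f'(1)=0$. ''Observer'' means that $\widehat w_r,\widehat w_d,\widehat z$ are estimates, computed from $y_m$,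 $r$ and $u$, of $w_r,w_d,z$, with errors that converge to zero as in the claim. Norms are the natural product norms; solutions are mild solutions. *)

(* Defs.v *)
From mathcomp Require Import all_boot all_order all_algebra.
From mathcomp Require Import complex.
From mathcomp Require Import all_classical all_reals all_analysis.

Set Implicit Arguments.
Unset Strict Implicit.
Unset Printing Implicit Defensive.

Import Order.TTheory GRing.Theory Num.Theory numFieldNormedType.Exports.

Local Open Scope classical_set_scope.
Local Open Scope complex_scope.
Local Open Scope ring_scope.

(* The complex numbers are [R[i]] with [R : realType].  The library gives [R[i]]
   neither a structure of normed [R]-module nor Lebesgue integrals, so derivatives
   and integrals of functions [R -> R[i]] are taken on real and imaginary parts.
   Functions on [0,1] (on the triangle, on [0,+oo[) are total functions whose
   values outside that domain are never used. *)

Section ComplexCalculus.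
Context {R : realType}.
Notation C := R[i].
Notation mu := (@lebesgue_measure R).
Implicit Types (f : R -> C) (x t : R).

Definition I01 : set R := `[0, 1]%classic.

Definition cabs (c : C) : R := ComplexField.Normc.normc c.

Definition ccontinuous (A : set R) f : Prop :=
  {within A, continuous (fun x => complex.Re (f x))} /\
  {within A, continuous (fun x => complex.Im (f x))}.

Definition ccontinuous2 (A : set (R * R)) (f : R -> R -> C) : Prop :=
  {within A, continuous (fun a : R * R => complex.Re (f a.1 a.2))} /\
  {within A, continuous (fun a : R * R => complex.Im (f a.1 a.2))}.

Definition is_cderive f x (d : C) : Prop :=
  is_derive x (1 : R) (fun y => complex.Re (f y)) (complex.Re d) /\
  is_derive x (1 : R) (fun y => complex.Im (f y)) (complex.Im d).

Definition cintegrable (a b : R) f : Prop :=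
  mu.-integrable `[a, b] (fun x => (complex.Re (f x))%:E) /\
  mu.-integrable `[a, b] (fun x => (complex.Im (f x))%:E).

Definition cint f (a b : R) : C :=
  (\int[mu]_(x in `[a, b]) complex.Re (f x)) +i*
  (\int[mu]_(x in `[a, b]) complex.Im (f x)).

Definition ae01 (P : R -> Prop) : Prop :=
  {ae mu, forall x, I01 x -> P x}.

(* [f1], [f2] are the first two derivatives of [f], which is of class C^2 up to
   the boundary of [0,1]; [f1 0] and [f1 1] are then the one-sided derivatives. *)
Definition C2_01 f f1 f2 : Prop :=
  [/\ ccontinuous I01 f,
      ccontinuous I01 f1,
      ccontinuous I01 f2 &
      forall x, 0 < x < 1 -> is_cderive f x (f1 x) /\ is_cderive f1 x (f2 x)].

Definition triangle : set (R * R) := [set a | 0 <= a.1 <= a.2 /\ a.2 <= 1].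

Definition C2_triangle (p px pxi pxx pxxi pxixi : R -> R -> C) : Prop :=
  [/\ [/\ ccontinuous2 triangle p, ccontinuous2 triangle px &
          ccontinuous2 triangle pxi],
      [/\ ccontinuous2 triangle pxx, ccontinuous2 triangle pxxi &
          ccontinuous2 triangle pxixi] &
      forall x xi, 0 < x < xi -> xi < 1 ->
      [/\ is_cderive (fun y => p y xi) x (px x xi),
          is_cderive (fun y => p x y) xi (pxi x xi),
          is_cderive (fun y => px y xi) x (pxx x xi),
          is_cderive (fun y => px x y) xi (pxxi x xi) /\
          is_cderive (fun y => pxi y xi) x (pxxi x xi) &
          is_cderive (fun y => pxi x y) xi (pxixi x xi)]].

(* L^2(0,1), and H^2(0,1) through its C^1 representatives: [f] is H^2 when [f] and
   [f1 = f'] are absolutely continuous on [0,1] and [f2 = f''] is in L^2. *)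
Definition L2 f : Prop :=
  [/\ measurable_fun I01 (fun x => complex.Re (f x)),
      measurable_fun I01 (fun x => complex.Im (f x)) &
      (\int[mu]_(x in I01) ((cabs (f x) ^+ 2)%:E) < +oo)%E].

Definition L2norm f : R :=
  Num.sqrt (\int[mu]_(x in I01) (cabs (f x) ^+ 2)).

Definition L2dot f (phi : R -> C) : C :=
  cint (fun x => f x * (phi x)^*) 0 1.

Definition is_H2 f f1 f2 : Prop :=
  [/\ L2 f2,
      forall x, 0 <= x <= 1 -> f1 x = f1 0 + cint f2 0 x &
      forall x, 0 <= x <= 1 -> f x = f 0 + cint f1 0 x].

Definition L2_continuous (z : R -> R -> C) : Prop :=
  (forall t, 0 <= t -> L2 (z t)) /\
  forall t, 0 <= t ->
    (fun s => L2norm (fun x => z s x - z t x))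
      @ within [set s | 0 <= s] (nbhs t) --> (0 : R).

(* [Z] is the L^2(0,1)-valued integral of the L^2-continuous [z] over [0,t],
   characterised (Pettis) by its inner products with the elements of L^2(0,1). *)
Definition is_L2_integral (z : R -> R -> C) t (Z : R -> C) : Prop :=
  L2 Z /\
  forall phi, L2 phi -> L2dot Z phi = cint (fun s => L2dot (z s) phi) 0 t.

End ComplexCalculus.

Section Matrices.
Context {R : realType}.
Notation C := R[i].

(* a^T b, without conjugation. *)
Definition dot n (a b : 'cV[C]_n) : C := (a^T *m b) 0 0.

Definition hurwitz n (A : 'M[C]_n) : Prop :=
  forall a, eigenvalue A a -> complex.Re a < 0.

Definition imaginary_spectrum n (A : 'M[C]_n) : Prop :=
  forall a, eigenvalue A a -> complex.Re a = 0.

Definition simple_spectrum n (A : 'M[C]_n) (lam : 'I_n -> C) : Prop :=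
  injective lam /\ char_poly A = \prod_(j < n) ('X - (lam j)%:P).

(* Kalman rank condition for the pair (c^T, A). *)
Definition observable n (c : 'cV[C]_n) (A : 'M[C]_n) : Prop :=
  \rank (\matrix_(k < n) (c^T *m (A ^+ k))) = n.

Definition vcontinuous n (A : set R) (w : R -> 'cV[C]_n) : Prop :=
  forall i, ccontinuous A (fun t => w t i 0).

Definition vint n (w : R -> 'cV[C]_n) (a b : R) : 'cV[C]_n :=
  \col_i cint (fun t => w t i 0) a b.

Definition vabs2 n (v : 'cV[C]_n) : R := \sum_i cabs (v i 0) ^+ 2.

End Matrices.

Section Kernel.
Context {R : realType}.
Notation C := R[i].

Definition is_kernel (q co : R) (h : R -> C)
    (p px pxi pxx pxxi pxixi : R -> R -> C) : Prop :=
  [/\ C2_triangle p px pxi pxx pxxi pxixi,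
      forall x xi, triangle (x, xi) ->
        pxixi x xi - pxx x xi = 'i%C * (h x + co%:C) * p x xi,
      forall xi, 0 <= xi <= 1 -> px 0 xi + 'i%C * q%:C * p 0 xi = 0 &
      forall x, 0 <= x <= 1 ->
        p x x = - ('i%C / 2%:R) * cint (fun y => h y + co%:C) 0 x - 'i%C * q%:C].

Definition Fo (p : R -> R -> C) (f : R -> C) (x : R) : C :=
  f x - cint (fun xi => p x xi * f xi) x 1.

(* [G] is the L^2 preimage of the continuous function [g] under [Fo p]; asking for
   [Fo p G = g] at every point selects its continuous representative. *)
Definition is_Fo_inv (p : R -> R -> C) (g G : R -> C) : Prop :=
  L2 G /\ forall x, 0 <= x <= 1 -> Fo p G x = g x.

(* Eigenvalues of f |-> -i f'' - co f on {f in H^2(0,1) | f'(0) = f'(1) = 0}. *)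
Definition sigma_o (co : R) : set C :=
  [set a | exists f f1 f2 : R -> C,
    [/\ is_H2 f f1 f2, f1 0 = 0 /\ f1 1 = 0,
        exists2 x, 0 <= x <= 1 & f x != 0 &
        ae01 (fun x => - 'i%C * f2 x - co%:C * f x = a * f x)]].

Definition is_regulator_sol nd (co : R) (Sd : 'M[C]_nd) (qd1 qd2 : 'cV[C]_nd)
    (G : R -> C) (n : R -> 'cV[C]_nd) : Prop :=
  exists n1 n2 : R -> 'cV[C]_nd,
    [/\ forall i, C2_01 (fun x => n x i 0) (fun x => n1 x i 0) (fun x => n2 x i 0),
        forall x, 0 <= x <= 1 ->
          'i%C *: (n2 x)^T + (n x)^T *m Sd + co%:C *: (n x)^T = G x *: qd1^T,
        (n1 0)^T = qd2^T &
        (n1 1)^T = 0].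

Definition gain_l nd (p pxi : R -> R -> C) (n : R -> 'cV[C]_nd) (ld : 'cV[C]_nd)
    (x : R) : C :=
  Fo p (fun y => dot (n y) ld) x - 'i%C * pxi x 1.

End Kernel.

(* Mild solutions of an abstract equation X' = A X + F in the usual sense: X is
   continuous with values in the state space, \int_0^t X lies in the domain of A and
   X(t) = X(0) + A \int_0^t X + \int_0^t F.  In the predicates below the forcing, the
   boundary data and the boundary output therefore occur through their time
   integrals, written with a capital letter. *)
Section Systems.
Context {R : realType}.
Notation C := R[i].

(* w' = A w + f, with F(t) = \int_0^t f. *)
Definition ode_mild n (A : 'M[C]_n) (F : R -> 'cV[C]_n) (w : R -> 'cV[C]_n) : Prop :=
  vcontinuous [set t | 0 <= t] w /\
  forall t, 0 <= t -> w t = w 0 + A *m vint w 0 t + F t.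

(* z_t = -i z_xx + h z + f,  z_x(0,t) = -iq z(0,t) + b0(t),  z_x(1,t) = b1(t),
   y(t) = z(1,t).  A state in L^2(0,1) has no trace, so the output of a mild solution
   is given by Y(t) = (\int_0^t z)(1), which stands for \int_0^t z(1,s) ds. *)
Definition schrodinger_mild (q : R) (h : R -> C) (F : R -> R -> C) (B0 B1 : R -> C)
    (z : R -> R -> C) (Y : R -> C) : Prop :=
  L2_continuous z /\
  forall t, 0 <= t -> exists Z Z1 Z2 : R -> C,
    [/\ is_H2 Z Z1 Z2 /\ is_L2_integral z t Z,
        Z1 0 = - 'i%C * q%:C * Z 0 + B0 t,
        Z1 1 = B1 t,
        Y t = Z 1 &
        ae01 (fun x => z t x = z 0 x + (- 'i%C * Z2 x + h x * Z x + F t x))].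

Record state (nd nr : nat) : Type := State {
  st_d : 'cV[C]_nd;
  st_r : 'cV[C]_nr;
  st_z : R -> C }.

Section States.
Context {nd nr : nat}.
Local Notation state := (state nd nr).

Definition state_norm (X : state) : R :=
  Num.sqrt (vabs2 (st_d X) + vabs2 (st_r X) + L2norm (st_z X) ^+ 2).

Definition state_sub (X X' : state) : state :=
  State (st_d X - st_d X') (st_r X - st_r X') (fun x => st_z X x - st_z X' x).

(* Equality in C^nd x C^nr x L^2(0,1). *)
Definition state_eq (X X' : state) : Prop :=
  [/\ st_d X = st_d X', st_r X = st_r X' &
      ae01 (fun x => st_z X x = st_z X' x)].

Definition well_posed (sol : (R -> state) -> Prop) : Prop :=
  forall X0 : state, L2 (st_z X0) ->
    (exists2 X, sol X & state_eq (X 0) X0) /\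
    forall X X', sol X -> sol X' -> state_eq (X 0) X0 -> state_eq (X' 0) X0 ->
      forall t, 0 <= t -> state_eq (X t) (X' t).

Variables (q : R) (h g : R -> C) (Sd : 'M[C]_nd) (Sr : 'M[C]_nr).
Variables (qd1 qd2 : 'cV[C]_nd) (qr : 'cV[C]_nr).

(* The plant driven by the exosystem and by the control [u]; [Ym] is the time
   integral of the measurement. *)
Definition plant_system (u : R -> C) (X : R -> state) (Ym : R -> C) : Prop :=
  ode_mild (block_mx Sd 0 0 Sr) (fun=> 0)
    (fun t => col_mx (st_d (X t)) (st_r (X t))) /\
  schrodinger_mild q h
    (fun t x => g x * cint (fun s => dot qd1 (st_d (X s))) 0 t)
    (fun t => cint (fun s => dot qd2 (st_d (X s))) 0 t)
    (fun t => cint u 0 t)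
    (fun t => st_z (X t)) Ym.

Definition reference (X : R -> state) : R -> C := fun t => dot qr (st_r (X t)).

Variables (ld : 'cV[C]_nd) (lr : 'cV[C]_nr) (l : R -> C) (l0 : C).

Definition observer_system (r u Ym : R -> C) (X : R -> state) : Prop :=
  exists Y : R -> C,
  [/\ ode_mild Sr (fun t => cint (fun s => dot qr (st_r (X s)) - r s) 0 t *: lr)
        (fun t => st_r (X t)),
      ode_mild Sd (fun t => (Y t - Ym t) *: ld) (fun t => st_d (X t)) &
      schrodinger_mild q h
        (fun t x => g x * cint (fun s => dot qd1 (st_d (X s))) 0 t
                    + l x * (Y t - Ym t))
        (fun t => cint (fun s => dot qd2 (st_d (X s))) 0 t)
        (fun t => cint u 0 t + l0 * (Y t - Ym t))
        (fun t => st_z (X t)) Y].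

Definition error_system (X : R -> state) : Prop :=
  exists Y : R -> C,
  [/\ ode_mild (Sr + lr *m qr^T) (fun=> 0) (fun t => st_r (X t)),
      ode_mild Sd (fun t => Y t *: ld) (fun t => st_d (X t)) &
      schrodinger_mild q h
        (fun t x => g x * cint (fun s => dot qd1 (st_d (X s))) 0 t + l x * Y t)
        (fun t => cint (fun s => dot qd2 (st_d (X s))) 0 t)
        (fun t => l0 * Y t)
        (fun t => st_z (X t)) Y].

Definition locally_integrable_control (u : R -> C) : Prop :=
  forall T, 0 <= T -> cintegrable 0 T u.

(* Along every trajectory of plant and exosystem, the observer, fed only with the
   reference, the control and the measurement, has a unique solution from every
   initial state, and its error converges to zero. *)
Definition is_observer : Prop :=
  forall (u : R -> C) (X : R -> state) (Ym : R -> C),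
    locally_integrable_control u -> plant_system u X Ym ->
    well_posed (observer_system (reference X) u Ym) /\
    forall Xhat, observer_system (reference X) u Ym Xhat ->
      (fun t => state_norm (state_sub (Xhat t) (X t))) @ +oo --> (0 : R).

Definition has_error_dynamics : Prop :=
  forall (u : R -> C) (X : R -> state) (Ym : R -> C) (Xhat : R -> state),
    locally_integrable_control u -> plant_system u X Ym ->
    observer_system (reference X) u Ym Xhat ->
    error_system (fun t => state_sub (Xhat t) (X t)).

End States.

Definition exponentially_stable nd nr (sol : (R -> state nd nr) -> Prop) : Prop :=
  well_posed sol /\
  exists M m : R, [/\ 1 <= M, 0 < m &
    forall X, sol X -> forall t, 0 <= t ->
      state_norm (X t) <= M * expR (- m * t) * state_norm (X 0)].

End Systems.

(* Main.v *)
(* The Volterra transformation [z = F_o v] removes the potential and the boundary terms: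
   the kernel equations turn -i z'' + h z into F_o applied to -i v'' - c_o v, and l, l_0 are
   the gains that cancel the remaining boundary values.  With n solving the regulator
   equation, e = v - n^T w_d obeys the Neumann problem e_t = -i e'' - c_o e, which decays
   like exp (- c_o t) on each cosine coefficient, while w_d' = (S_d + l_d n(1)^T) w_d
   + l_d e(1).  The trace e(1) is not a bounded functional of e; but since
   i x^2 / 2 has derivatives 0 and i at the two ends, adding l_d times the integral of
   (i x^2 / 2) e to w_d replaces e(1) by bounded functionals of e, and the resulting
   equation is diagonalized.  In the same way solutions are built from those of the
   Neumann problem, which are synthesized from their cosine coefficients. *)

Require Import Defs.
From mathcomp Require Import all_boot all_order all_algebra.
From mathcomp Require Import complex.
From mathcomp Require Import all_classical all_reals all_analysis.
From mathcomp Require Import measurable_realfun.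
From mathcomp Require Import ring lra.

Set Implicit Arguments.
Unset Strict Implicit.
Unset Printing Implicit Defensive.

Import Order.TTheory GRing.Theory Num.Theory numFieldNormedType.Exports.
Local Open Scope classical_set_scope.
Local Open Scope complex_scope.
Local Open Scope ring_scope.

(** The obstacle is that a state in L^2(0,1) has no trace and a mild solution satisfies its equation
    only after integration in time. All identities are therefore proved for the time integrals [Z],
    [V], [E], which lie in H^2 and do have traces, and they pass through F_o by testing: the adjoint
    of F_o is again an invertible Volterra operator, so weak time integrals of z and of F_o^{-1} z
    correspond to each other. The correction of w_d has the same origin: only the primitive of e(1)
    is at hand, and it enters the integrated equation of the corrected quantity with coefficient -1.
    Each Neumann mode has exponent i j^2 pi^2 - c_o: the real part gives one common decay rate, and
    the modulus grows like j^2, so integration in time gains the two space derivatives that H^2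
    requires. The rate for w_d is kept strictly below c_o, so that convolving two exponentials
    yields no polynomial factor. Uniqueness is the decay estimate applied to a difference of two
    error trajectories, and the observer is well posed because its solutions are the translates of
    error trajectories by the given plant trajectory. *)

Notation Re := complex.Re.
Notation Im := complex.Im.

(** * Real and imaginary parts, modulus and phase *)

Section ComplexNumbers.
Context {R : realType}.
Notation C := R[i].
Implicit Types (x y c : C) (a : R).

Lemma ReD x y : Re (x + y) = Re x + Re y. Proof. by case: x y => ? ? []. Qed.
Lemma ImD x y : Im (x + y) = Im x + Im y. Proof. by case: x y => ? ? []. Qed.
Lemma ReN x : Re (- x) = - Re x. Proof. by case: x. Qed.
Lemma ImN x : Im (- x) = - Im x. Proof. by case: x. Qed.
Lemma ReM x y : Re (x * y) = Re x * Re y - Im x * Im y.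
Proof. by case: x y => ? ? []. Qed.
Lemma ImM x y : Im (x * y) = Re x * Im y + Im x * Re y.
Proof. by case: x y => ? ? []. Qed.
Lemma ReJ x : Re (x^*) = Re x. Proof. by case: x. Qed.
Lemma ImJ x : Im (x^*) = - Im x. Proof. by case: x. Qed.
Lemma Re_real a : Re a%:C = a. Proof. by []. Qed.
Lemma Im_real a : Im a%:C = 0. Proof. by []. Qed.
Lemma Re_i : Re ('i%C : C) = 0. Proof. by []. Qed.
Lemma Im_i : Im ('i%C : C) = 1. Proof. by []. Qed.
Lemma Re_sum I (r : seq I) (P : pred I) (F : I -> C) :
  Re (\sum_(i <- r | P i) F i) = \sum_(i <- r | P i) Re (F i).
Proof. by apply: (big_morph _ ReD). Qed.
Lemma complexP x y : Re x = Re y -> Im x = Im y -> x = y.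
Proof. by case: x y => ? ? [? ?] /= -> ->. Qed.

Definition cE := (ReD, ImD, ReN, ImN, ReM, ImM, ReJ, ImJ, Re_i, Im_i,
  Re_real, Im_real).

Lemma sqr_cabs c : cabs c ^+ 2 = Re c ^+ 2 + Im c ^+ 2.
Proof. by case: c => a b; rewrite /cabs /= sqr_sqrtr // addr_ge0 ?sqr_ge0. Qed.
Lemma cabs_ge0 c : 0 <= cabs c.
Proof. by case: c => a b; rewrite /cabs /= sqrtr_ge0. Qed.
Lemma cabs0 : cabs (0 : C) = 0. Proof. exact: ComplexField.Normc.normc0. Qed.
Lemma cabs1 : cabs (1 : C) = 1. Proof. exact: ComplexField.Normc.normc1. Qed.
Lemma cabs_eq0 c : cabs c = 0 -> c = 0.
Proof. exact: ComplexField.Normc.eq0_normc. Qed.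
Lemma cabsM x y : cabs (x * y) = cabs x * cabs y.
Proof. exact: ComplexField.Normc.normcM. Qed.
Lemma cabsD x y : cabs (x + y) <= cabs x + cabs y.
Proof. exact: le_normcD. Qed.
Lemma cabsN x : cabs (- x) = cabs x. Proof. exact: normcN. Qed.
Lemma cabsB x y : cabs (x - y) <= cabs x + cabs y.
Proof. by rewrite -(cabsN y) cabsD. Qed.
Lemma cabsJ x : cabs (x^*) = cabs x.
Proof. by case: x => a b; rewrite /cabs /= sqrrN. Qed.
Lemma cabs_real a : cabs a%:C = `|a|.
Proof. by rewrite /cabs /= expr0n addr0 sqrtr_sqr. Qed.
Lemma normr_Re c : `|Re c| <= cabs c.
Proof.
rewrite -(ler_pXn2r (ltn0Sn 1)) ?nnegrE ?cabs_ge0// sqr_cabs real_normK ?num_real//.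
by rewrite lerDl sqr_ge0.
Qed.

Lemma normr_Im c : `|Im c| <= cabs c.
Proof.
rewrite -(ler_pXn2r (ltn0Sn 1)) ?nnegrE ?cabs_ge0// sqr_cabs real_normK ?num_real//.
by rewrite lerDr sqr_ge0.
Qed.

Lemma cabs_le c : cabs c <= `|Re c| + `|Im c|.
Proof.
rewrite -(ler_pXn2r (ltn0Sn 1)) ?nnegrE ?cabs_ge0 ?addr_ge0// sqr_cabs.
rewrite sqrrD !real_normK ?num_real// -addrA [X in _ <= _ + X]addrC lerD2l.
by rewrite lerDl mulrn_wge0// mulr_ge0.
Qed.

Lemma Re_le_cabs c : Re c <= cabs c.
Proof. exact: le_trans (ler_norm _) (normr_Re _). Qed.
Lemma cabs_sum I (r : seq I) (P : pred I) (F : I -> C) :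
  cabs (\sum_(i <- r | P i) F i) <= \sum_(i <- r | P i) cabs (F i).
Proof.
elim/big_ind2 : _ => [||//]; first by rewrite cabs0.
by move=> a b c d h1 h2; apply: le_trans (cabsD _ _) (lerD h1 h2).
Qed.

(** Rotation by a phase reduces bounds on a complex integral or inner product to bounds on a real
    part; [cint_norm] and [Cauchy_Schwarz] rest on it. *)
Lemma cabs_phase c : exists2 u, cabs u = 1 & (cabs c)%:C = u * c.
Proof.
have [->|c0] := eqVneq c 0; first by exists 1; rewrite ?cabs1 ?cabs0 ?mulr0.
have cc : cabs c != 0 by apply: contra_neq c0 => /cabs_eq0.
exists ((cabs c)^-1%:C * c^*).
  by rewrite cabsM cabsJ cabs_real ger0_norm ?invr_ge0 ?cabs_ge0// mulVf.
have h : (cabs c ^+ 2)%:C = c^* * c.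
  by rewrite sqr_cabs; apply: complexP; rewrite !cE; ring.
by rewrite -mulrA -h expr2 -rmorphM/= mulrA mulVf// mul1r.
Qed.

End ComplexNumbers.

(** * Integrals of complex-valued functions *)

Section Cint.
Context {R : realType}.
Notation C := R[i].
Notation mu := (@lebesgue_measure R).
Implicit Types (f g : R -> C) (x t a b c d M : R) (k : C).

Lemma mu_itv_lty a b : (mu `[a, b] < +oo)%E.
Proof.
by rewrite lebesgue_measure_itv/=; case: ifP => _; rewrite ?ltry// -EFinB ltry.
Qed.

Lemma fine_mu_itv a b : a <= b -> fine (mu `[a, b]) = b - a.
Proof.
rewrite lebesgue_measure_itv/= lte_fin.
by case: ltgtP => // -> _; rewrite subrr.
Qed.

Lemma aeS (P Q : R -> Prop) : (forall x, P x -> Q x) ->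
  {ae mu, forall x, P x} -> {ae mu, forall x, Q x}.
Proof. by move=> PQ; apply: filterS => //; exact: (ae_filter_ringOfSetsType mu). Qed.

Lemma ae_and (P Q : R -> Prop) : {ae mu, forall x, P x} ->
  {ae mu, forall x, Q x} -> {ae mu, forall x, P x /\ Q x}.
Proof.
by move=> aP aQ; apply: filterS2 aP aQ => //; exact: (ae_filter_ringOfSetsType mu).
Qed.

Lemma ae_all (P : R -> Prop) : (forall x, P x) -> {ae mu, forall x, P x}.
Proof. by move=> aP; apply: filterE => //; exact: (ae_filter_ringOfSetsType mu). Qed.

Definition rintegrable a b (u : R -> R) := mu.-integrable `[a, b] (EFin \o u).

Lemma rintegrable_ext a b (u v : R -> R) : (forall x, a <= x <= b -> u x = v x) ->
  rintegrable a b u -> rintegrable a b v.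
Proof.
move=> uv; apply: eq_integrable => // x; rewrite inE/= in_itv/= => xab.
by rewrite uv.
Qed.

Lemma rintegrableD a b (u v : R -> R) : rintegrable a b u -> rintegrable a b v ->
  rintegrable a b (fun x => u x + v x).
Proof.
move=> iu iv; rewrite /rintegrable (_ : _ \o _ = (EFin \o u) \+ (EFin \o v))%E//.
exact: integrableD.
Qed.

Lemma rintegrableZ a b c (u : R -> R) : rintegrable a b u ->
  rintegrable a b (fun x => c * u x).
Proof.
move=> iu; rewrite /rintegrable (_ : _ \o _ = fun x => (c%:E * (EFin \o u) x))%E//.
exact: integrableZl.
Qed.

Lemma rintegrableN a b (u : R -> R) : rintegrable a b u ->
  rintegrable a b (fun x => - u x).
Proof.
move=> iu; apply: (@rintegrable_ext _ _ (fun x => -1 * u x)); last exact: rintegrableZ.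
by move=> x _; rewrite mulN1r.
Qed.

Lemma rintegrableB a b (u v : R -> R) : rintegrable a b u -> rintegrable a b v ->
  rintegrable a b (fun x => u x - v x).
Proof. by move=> iu iv; apply: rintegrableD => //; apply: rintegrableN. Qed.

Lemma rintegrable_meas a b (u : R -> R) : rintegrable a b u -> measurable_fun `[a, b] u.
Proof. by move=> iu; apply/measurable_EFinP; apply: measurable_int iu. Qed.

Lemma rintegrable_norm a b (u : R -> R) : rintegrable a b u ->
  rintegrable a b (fun x => `|u x|).
Proof. by move=> iu; apply: integrable_norm. Qed.

Lemma rintegrable_dom a b (u v : R -> R) : measurable_fun `[a, b] u ->
  rintegrable a b v -> (forall x, a <= x <= b -> `|u x| <= v x) -> rintegrable a b u.
Proof.
move=> mu_ iv uv; apply: le_integrable iv => //; first exact/measurable_EFinP.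
move=> x; rewrite /= in_itv/= => xab; rewrite lee_fin (le_trans (uv _ xab))//.
exact: ler_norm.
Qed.

Lemma rintegrable_bounded a b M (u : R -> R) : measurable_fun `[a, b] u ->
  (forall x, a <= x <= b -> `|u x| <= M) -> rintegrable a b u.
Proof.
move=> mu_ uM; apply: (@measurable_bounded_integrable _ _ _ mu) => //.
  exact: mu_itv_lty.
exists M; split; rewrite ?num_real// => y My x /=; rewrite in_itv/= => xab.
exact: le_trans (uM _ xab) (ltW My).
Qed.

Lemma rintegrable_cst a b c : rintegrable a b (fun=> c).
Proof. by apply: (@rintegrable_bounded _ _ `|c|). Qed.

Lemma rintegrable_bM a b M (u v : R -> R) : measurable_fun `[a, b] u ->
  (forall x, a <= x <= b -> `|u x| <= M) -> rintegrable a b v ->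
  rintegrable a b (fun x => u x * v x).
Proof.
move=> mu_ uM iv.
apply: (@rintegrable_dom _ _ _ (fun x => M * `|v x|)).
- by apply: measurable_funM => //; apply: rintegrable_meas.
- by apply: rintegrableZ; apply: rintegrable_norm.
- by move=> x xab; rewrite normrM ler_wpM2r// uM.
Qed.

Lemma rintegrableS a b c d (u : R -> R) : a <= c -> d <= b ->
  rintegrable a b u -> rintegrable c d u.
Proof.
move=> ac db; apply: integrableS => // x /=; rewrite !in_itv/= => /andP[cx xd].
by rewrite (le_trans ac)// (le_trans xd).
Qed.

Lemma rintegrable_cont a b (u : R -> R) : {within `[a, b], continuous u} ->
  rintegrable a b u.
Proof. by move=> cu; apply: continuous_compact_integrable => //; apply: segment_compact. Qed.

Lemma eq_rint a b (u v : R -> R) : (forall x, a <= x <= b -> u x = v x) ->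
  \int[mu]_(x in `[a, b]) u x = \int[mu]_(x in `[a, b]) v x.
Proof. by move=> uv; apply: eq_Rintegral => x; rewrite inE/= in_itv/=; apply: uv. Qed.

Lemma rint_chasles a c b (u : R -> R) : a <= c -> c <= b -> rintegrable a b u ->
  \int[mu]_(x in `[a, b]) u x =
  \int[mu]_(x in `[a, c]) u x + \int[mu]_(x in `[c, b]) u x.
Proof.
move=> ac cb iu; have := @Rintegral_itvB R u (BLeft a) (BRight b) c iu.
rewrite !bnd_simp => /(_ ac cb) h.
rewrite Rintegral_itv_obnd_cbnd in h; last first.
  apply: integrableS iu => //; apply: subset_itvr; rewrite bnd_simp; exact: ac.
by rewrite -h addrC subrK.
Qed.

Lemma rint_cst a b c : a <= b -> \int[mu]_(x in `[a, b]) c = c * (b - a).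
Proof.
move=> ab; rewrite Rintegral_cst//; congr (_ * _).
exact: fine_mu_itv.
Qed.

Lemma rint_le a b (u v : R -> R) : rintegrable a b u -> rintegrable a b v ->
  (forall x, a <= x <= b -> u x <= v x) ->
  \int[mu]_(x in `[a, b]) u x <= \int[mu]_(x in `[a, b]) v x.
Proof.
by move=> iu iv uv; apply: le_Rintegral => // x /=; rewrite in_itv/=; apply: uv.
Qed.

Lemma rint_ae a b (u v : R -> R) : rintegrable a b u -> rintegrable a b v ->
  {ae mu, forall x, a <= x <= b -> u x = v x} ->
  \int[mu]_(x in `[a, b]) u x = \int[mu]_(x in `[a, b]) v x.
Proof.
move=> iu iv uv; rewrite /Rintegral; congr fine.
apply: ae_eq_integral => //.
- exact: measurable_int iu.
- exact: measurable_int iv.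
- by apply: aeS uv => x /= h; rewrite in_itv/= => xab; rewrite h.
Qed.
End Cint.

Section ComplexIntegral.
Context {R : realType}.
Notation C := R[i].
Notation mu := (@lebesgue_measure R).
Implicit Types (f g : R -> C) (x t a b c d M : R) (k : C).

Definition cmeas a b f :=
  measurable_fun `[a, b] (fun x => Re (f x)) /\
  measurable_fun `[a, b] (fun x => Im (f x)).

Lemma cintegrable_meas a b f : cintegrable a b f -> cmeas a b f.
Proof. by case=> /rintegrable_meas ? /rintegrable_meas ?. Qed.

Lemma cmeas_ext a b f g : (forall x, a <= x <= b -> f x = g x) ->
  cmeas a b f -> cmeas a b g.
Proof.
move=> fg [mf1 mf2]; split.
- apply: (eq_measurable_fun (fun x => Re (f x))) => //.
  by move=> x; rewrite inE/= in_itv/= => xab; rewrite fg.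
- apply: (eq_measurable_fun (fun x => Im (f x))) => //.
  by move=> x; rewrite inE/= in_itv/= => xab; rewrite fg.
Qed.

Lemma mext (D : set R) (u v : R -> R) : u =1 v -> measurable_fun D u ->
  measurable_fun D v.
Proof. by move=> /funext ->. Qed.
Lemma cmeasD a b f g : cmeas a b f -> cmeas a b g -> cmeas a b (fun x => f x + g x).
Proof.
move=> [f1 f2] [g1 g2]; split.
- by apply: mext (measurable_funD f1 g1) => x; rewrite cE.
- by apply: mext (measurable_funD f2 g2) => x; rewrite cE.
Qed.

Lemma cmeasM a b f g : cmeas a b f -> cmeas a b g -> cmeas a b (fun x => f x * g x).
Proof.
move=> [f1 f2] [g1 g2]; split.
- apply: mext (measurable_funB (measurable_funM f1 g1) (measurable_funM f2 g2)).
  by move=> x; rewrite cE.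
- apply: mext (measurable_funD (measurable_funM f1 g2) (measurable_funM f2 g1)).
  by move=> x; rewrite cE.
Qed.

Lemma cmeas_cst a b k : cmeas a b (fun=> k).
Proof. by []. Qed.
Lemma cintegrable_ext a b f g : (forall x, a <= x <= b -> f x = g x) ->
  cintegrable a b f -> cintegrable a b g.
Proof.
move=> fg [if1 if2]; split.
- by apply: rintegrable_ext if1 => x xab; rewrite fg.
- by apply: rintegrable_ext if2 => x xab; rewrite fg.
Qed.

Lemma cintegrableD a b f g : cintegrable a b f -> cintegrable a b g ->
  cintegrable a b (fun x => f x + g x).
Proof.
move=> [f1 f2] [g1 g2]; split.
- by apply: (rintegrable_ext _ (rintegrableD f1 g1)) => x _; rewrite cE.
- by apply: (rintegrable_ext _ (rintegrableD f2 g2)) => x _; rewrite cE.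
Qed.

Lemma cintegrableZ a b k f : cintegrable a b f ->
  cintegrable a b (fun x => k * f x).
Proof.
move=> [f1 f2]; split.
- apply: (rintegrable_ext _ (rintegrableB (rintegrableZ (Re k) f1) (rintegrableZ (Im k) f2))).
  by move=> x _; rewrite cE.
- apply: (rintegrable_ext _ (rintegrableD (rintegrableZ (Re k) f2) (rintegrableZ (Im k) f1))).
  by move=> x _; rewrite cE.
Qed.

Lemma cintegrableN a b f : cintegrable a b f -> cintegrable a b (fun x => - f x).
Proof.
move=> /(cintegrableZ (-1)); apply: cintegrable_ext => x _; by rewrite mulN1r.
Qed.

Lemma cintegrableB a b f g : cintegrable a b f -> cintegrable a b g ->
  cintegrable a b (fun x => f x - g x).
Proof. by move=> fi gi; apply: cintegrableD => //; apply: cintegrableN. Qed.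
Lemma cintegrable_cst a b k : cintegrable a b (fun=> k).
Proof. by split; apply: rintegrable_cst. Qed.
Lemma cintegrable_sum a b I (r : seq I) (F : I -> R -> C) :
  (forall i, cintegrable a b (F i)) ->
  cintegrable a b (fun x => \sum_(i <- r) F i x).
Proof.
move=> iF; elim: r => [|i r ih].
  by apply: (cintegrable_ext _ (cintegrable_cst _ _ 0)) => x _; rewrite big_nil.
by apply: (cintegrable_ext _ (cintegrableD (iF i) ih)) => x _; rewrite big_cons.
Qed.

Lemma cintegrableS a b c d f : a <= c -> d <= b ->
  cintegrable a b f -> cintegrable c d f.
Proof. by move=> ac db [f1 f2]; split; [apply: rintegrableS f1|apply: rintegrableS f2]. Qed.

Lemma cintegrable_bM a b M f g : cmeas a b f ->
  (forall x, a <= x <= b -> cabs (f x) <= M) -> cintegrable a b g ->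
  cintegrable a b (fun x => f x * g x).
Proof.
move=> [mf1 mf2] fM [g1 g2].
have h1 x : a <= x <= b -> `|Re (f x)| <= M.
  by move=> /fM; apply: le_trans; apply: normr_Re.
have h2 x : a <= x <= b -> `|Im (f x)| <= M.
  by move=> /fM; apply: le_trans; apply: normr_Im.
split.
- apply: (rintegrable_ext _ (rintegrableB (rintegrable_bM mf1 h1 g1) (rintegrable_bM mf2 h2 g2))).
  by move=> x _; rewrite cE.
- apply: (rintegrable_ext _ (rintegrableD (rintegrable_bM mf1 h1 g2) (rintegrable_bM mf2 h2 g1))).
  by move=> x _; rewrite cE.
Qed.

Lemma cintegrable_bounded a b M f : cmeas a b f ->
  (forall x, a <= x <= b -> cabs (f x) <= M) -> cintegrable a b f.
Proof.
move=> mf fM; apply: (cintegrable_ext _ (cintegrable_bM mf fM (cintegrable_cst _ _ 1))).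
by move=> x _; rewrite mulr1.
Qed.

Lemma ccontinuous_integrable a b f : ccontinuous `[a, b] f -> cintegrable a b f.
Proof. by move=> [f1 f2]; split; apply: rintegrable_cont. Qed.

Lemma meas_cabs a b f : cmeas a b f -> measurable_fun `[a, b] (fun x => cabs (f x)).
Proof.
move=> [f1 f2].
have -> : (fun x => cabs (f x)) = Num.sqrt \o (fun x => Re (f x) ^+ 2 + Im (f x) ^+ 2).
  by apply/funext => x /=; rewrite -sqr_cabs sqrtr_sqr ger0_norm ?cabs_ge0.
apply: measurableT_comp => //.
  by apply: continuous_measurable_fun; apply: sqrt_continuous.
by apply: measurable_funD; apply: measurable_funX.
Qed.

Lemma rintegrable_cabs a b f : cintegrable a b f -> rintegrable a b (fun x => cabs (f x)).
Proof.
move=> fi; have mf := meas_cabs (cintegrable_meas fi); case: fi => f1 f2.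
apply: rintegrable_dom (rintegrableD (rintegrable_norm f1) (rintegrable_norm f2)) _ => //.
by move=> x _; rewrite ger0_norm ?cabs_ge0 ?cabs_le.
Qed.

Lemma Re_cint a b f : Re (cint f a b) = \int[mu]_(x in `[a, b]) Re (f x).
Proof. by []. Qed.
Lemma Im_cint a b f : Im (cint f a b) = \int[mu]_(x in `[a, b]) Im (f x).
Proof. by []. Qed.

Lemma eq_cint a b f g : (forall x, a <= x <= b -> f x = g x) ->
  cint f a b = cint g a b.
Proof.
by move=> fg; congr (_ +i* _); apply: eq_rint => x xab; rewrite fg.
Qed.

Lemma cintD a b f g : cintegrable a b f -> cintegrable a b g ->
  cint (fun x => f x + g x) a b = cint f a b + cint g a b.
Proof.
move=> [f1 f2] [g1 g2]; apply: complexP; rewrite ?(cE, Re_cint, Im_cint).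
- by rewrite -RintegralD//; apply: eq_rint => x _; rewrite cE.
- by rewrite -RintegralD//; apply: eq_rint => x _; rewrite cE.
Qed.

Lemma cintZ a b k f : cintegrable a b f ->
  cint (fun x => k * f x) a b = k * cint f a b.
Proof.
move=> [f1 f2]; apply: complexP; rewrite ?(cE, Re_cint, Im_cint).
- rewrite -RintegralZl// -RintegralZl// -RintegralB//;
    [|exact: rintegrableZ|exact: rintegrableZ].
  by apply: eq_rint => x _; rewrite cE.
- rewrite -RintegralZl// -RintegralZl// -RintegralD//;
    [|exact: rintegrableZ|exact: rintegrableZ].
  by apply: eq_rint => x _; rewrite cE.
Qed.

Lemma cintN a b f : cintegrable a b f -> cint (fun x => - f x) a b = - cint f a b.
Proof.
by move=> fi; rewrite -mulN1r -cintZ//; apply: eq_cint => x _; rewrite mulN1r.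
Qed.

Lemma cintB a b f g : cintegrable a b f -> cintegrable a b g ->
  cint (fun x => f x - g x) a b = cint f a b - cint g a b.
Proof. by move=> fi gi; rewrite cintD ?cintN//; apply: cintegrableN. Qed.
Lemma cintJ a b f : cintegrable a b f -> cint (fun x => (f x)^*) a b = (cint f a b)^*.
Proof.
move=> [f1 f2]; apply: complexP; rewrite ?(cE, Re_cint, Im_cint).
- by apply: eq_rint => x _; rewrite cE.
- rewrite -mulN1r -RintegralZl//; apply: eq_rint => x _; by rewrite cE mulN1r.
Qed.

Lemma cint0 a b : cint (fun=> 0 : C) a b = 0.
Proof. by apply: complexP; rewrite /cint/= /Rintegral integral0. Qed.
Lemma cint_sum a b I (r : seq I) (F : I -> R -> C) :
  (forall i, cintegrable a b (F i)) ->
  cint (fun x => \sum_(i <- r) F i x) a b = \sum_(i <- r) cint (F i) a b.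
Proof.
move=> iF; elim: r => [|i r ih].
  by rewrite big_nil -[RHS](cint0 a b); apply: eq_cint => x _; rewrite big_nil.
rewrite big_cons -ih -cintD//; first by apply: eq_cint => x _; rewrite big_cons.
exact: cintegrable_sum.
Qed.

Lemma cint_cst a b k : a <= b -> cint (fun=> k) a b = k * (b - a)%:C.
Proof.
move=> ab; apply: complexP; rewrite ?(cE, Re_cint, Im_cint) !(rint_cst _ ab); ring.
Qed.

Lemma cint_pt a f : cint f a a = 0.
Proof. by apply: complexP; rewrite ?(Re_cint, Im_cint) set_itv1 Rintegral_set1. Qed.

Lemma cint_chasles a c b f : a <= c -> c <= b -> cintegrable a b f ->
  cint f a b = cint f a c + cint f c b.
Proof.
by move=> ac cb [f1 f2]; apply: complexP; rewrite ?(cE, Re_cint, Im_cint); apply: rint_chasles.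
Qed.

(** After rotation by the phase of the integral, its modulus is the integral of a real part, which
    is at most the modulus of the integrand. *)
Lemma cint_norm a b f : cintegrable a b f ->
  cabs (cint f a b) <= \int[mu]_(x in `[a, b]) cabs (f x).
Proof.
move=> fi; have [u u1 uE] := cabs_phase (cint f a b).
rewrite -[leLHS]Re_real uE -cintZ//= ; apply: rint_le.
- by case: (cintegrableZ u fi).
- exact: rintegrable_cabs.
- by move=> x _; rewrite (le_trans (Re_le_cabs _))// cabsM u1 mul1r.
Qed.

Lemma cint_le a b f (u : R -> R) : cintegrable a b f -> rintegrable a b u ->
  (forall x, a <= x <= b -> cabs (f x) <= u x) ->
  cabs (cint f a b) <= \int[mu]_(x in `[a, b]) u x.
Proof.
move=> fi ui fu; apply: le_trans (cint_norm fi) _; apply: rint_le => //.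
exact: rintegrable_cabs.
Qed.

Lemma cint_bound a b M f : a <= b -> cintegrable a b f ->
  (forall x, a <= x <= b -> cabs (f x) <= M) -> cabs (cint f a b) <= M * (b - a).
Proof.
by move=> ab fi fM; rewrite -rint_cst//; apply: cint_le => //; apply: rintegrable_cst.
Qed.

Lemma cint_ae a b f g : cintegrable a b f -> cintegrable a b g ->
  {ae mu, forall x, a <= x <= b -> f x = g x} ->
  cint f a b = cint g a b.
Proof.
move=> [f1 f2] [g1 g2] fg; apply: complexP; rewrite ?(Re_cint, Im_cint); apply: rint_ae => //.
- by apply: aeS fg => x fg /fg ->.
- by apply: aeS fg => x fg /fg ->.
Qed.

End ComplexIntegral.

(** * Fubini's theorem for bounded kernels *)

Section PlaneMeasurability.
Context {R : realType}.

(** Each point of [U] lies in an open box with rational corners inside [U], and there are countably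
    many such boxes. This connects the topology of the plane with the product sigma-algebra used by
    Fubini. *)
Lemma open_measurable_plane (U : set (R * R)) : open U -> measurable U.
Proof.
move=> oU.
pose box (r : (rat * rat) * (rat * rat)) : set (R * R) :=
  (`]ratr r.1.1, ratr r.1.2[ `*` `]ratr r.2.1, ratr r.2.2[)%classic.
(* A rational box not contained in [U] is replaced by the empty set, so that the union runs over a
   fixed countable type. *)
pose F r := if `[< box r `<=` U >] then box r else set0.
have -> : U = \bigcup_r F r.
  apply/seteqP; split=> [[x y] Uxy|[x y] [r _]]; last first.
    by rewrite /F; case: asboolP => // rU /rU.
  have /nbhs_ballP[e /= e0 eU] : nbhs (x, y) U by exact: open_nbhs_nbhs.
  have ltm z : z - e < z by rewrite ltrBlDr ltrDl.
  have ltp z : z < z + e by rewrite ltrDl.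
  have [a] := rat_in_itvoo (ltm x); rewrite in_itv/= => /andP[a1 a2].
  have [b] := rat_in_itvoo (ltp x); rewrite in_itv/= => /andP[b1 b2].
  have [c] := rat_in_itvoo (ltm y); rewrite in_itv/= => /andP[c1 c2].
  have [d] := rat_in_itvoo (ltp y); rewrite in_itv/= => /andP[d1 d2].
  exists ((a, b), (c, d)) => //; rewrite /F asboolT.
    by split; rewrite /= in_itv/= ?a2 ?b1 ?c2 ?d1.
  move=> [u v] [/=]; rewrite !in_itv/= => /andP[au ub] /andP[cv vd].
  apply: eU; split; rewrite /ball/= ltr_distl.
  - by apply/andP; split; lra.
  - by apply/andP; split; lra.
apply: countable_bigcupT_measurable => // r.
by rewrite /F; case: asboolP => // _; apply: measurableX.
Qed.

Lemma continuous_measurable_plane (k : R * R -> R) : continuous k ->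
  measurable_fun setT k.
Proof.
move=> /continuousP ck; apply: (measurability _ (RGenOpens.measurableE R)).
move=> _ [_ [a [b ->] <-]]; rewrite setTI; apply: open_measurable_plane.
exact/ck/interval_open.
Qed.

End PlaneMeasurability.

Section FubiniReal.
Context {R : realType}.
Notation mu := (@lebesgue_measure R).
Implicit Types (a b c d M : R) (u v : R -> R) (k : R -> R -> R).

Definition rintegrable_on (A : set R) u := mu.-integrable A (EFin \o u).

(** The bound is global: u(x) k(x,y) v(y) is then dominated by M |u(x)| |v(y)|, integrable on the
    product for merely integrable u and v. *)
Definition bounded_kernel k M :=
  measurable_fun setT (fun z : R * R => k z.1 z.2) /\ forall x y, `|k x y| <= M.

Lemma bounded_kernel_row k M x : bounded_kernel k M -> measurable_fun setT (k x).
Proof. by case=> mk _; have := measurable_fun_pair2 x mk. Qed.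
Lemma bounded_kernel_col k M y : bounded_kernel k M -> measurable_fun setT (k ^~ y).
Proof. by case=> mk _; have := measurable_fun_pair1 y mk. Qed.

Lemma bounded_kernel_intr k M x a b v : bounded_kernel k M -> rintegrable a b v ->
  rintegrable a b (fun y => k x y * v y).
Proof.
move=> bk; apply: (@rintegrable_bM _ _ _ M).
  by apply: measurable_funTS; apply: bounded_kernel_row bk.
by move=> y _; case: bk.
Qed.

Lemma bounded_kernel_intl k M y a b u : bounded_kernel k M -> rintegrable a b u ->
  rintegrable a b (fun x => k x y * u x).
Proof.
move=> bk; apply: (@rintegrable_bM _ _ _ M).
  by apply: measurable_funTS; apply: bounded_kernel_col bk.
by move=> x _; case: bk.
Qed.

Section fubini.
Variables (k : R -> R -> R) (M a b c d : R) (u v : R -> R).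
Hypotheses (bk : bounded_kernel k M) (iu : rintegrable a b u) (iv : rintegrable c d v).

(** Extension by zero turns the integrals over the two intervals into integrals over the line, to
    which the product measure applies. *)
Let U := u \_ `[a, b].
Let V := v \_ `[c, d].
Let F (z : R * R) : \bar R := (U z.1 * (k z.1 z.2 * V z.2))%:E.

Let iU : mu.-integrable setT (EFin \o U).
Proof. by rewrite -restrict_EFin; apply/integrable_restrict => //; rewrite setTI. Qed.
Let iV : mu.-integrable setT (EFin \o V).
Proof. by rewrite -restrict_EFin; apply/integrable_restrict => //; rewrite setTI. Qed.
Let mU : measurable_fun setT U.
Proof. by apply/measurable_EFinP; apply: measurable_int iU. Qed.
Let mV : measurable_fun setT V.
Proof. by apply/measurable_EFinP; apply: measurable_int iV. Qed.

Let mF : measurable_fun setT F.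
Proof.
apply/measurable_EFinP; apply: measurable_funM.
  by apply: (measurableT_comp mU); apply: measurable_fst.
apply: measurable_funM; first by case: bk.
by apply: (measurableT_comp mV); apply: measurable_snd.
Qed.

Let M0 : 0 <= M. Proof. by case: bk => _ /(_ 0 0); apply: le_trans. Qed.

(** Tonelli's criterion: the inner integral of |F| is at most |U(x)| times [M] times the integral of
    |V|, and this is integrable in x. *)
Let iF : (mu \x mu)%E.-integrable setT F.
Proof.
apply/integrable12ltyP => //.
have iaV : rintegrable_on setT (fun y => `|V y|) by exact: integrable_norm.
pose w := \int[mu]_y `|V y|.
apply: (@le_lt_trans _ _ (\int[mu]_x ((M * w)%:E * `|(U x)%:E|))%E); last first.
  have /integrableP[_] : mu.-integrable setT (fun x => (M * w)%:E * (`|U x|)%:E)%E.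
    by apply: integrableZl => //; apply: integrable_norm.
  apply: le_lt_trans; rewrite le_eqVlt; apply/orP; left; apply/eqP.
  apply: eq_integral => x _; rewrite /= normrM normr_id (@ger0_norm _ (M * w)) ?EFinM// mulr_ge0//.
  exact: Rintegral_ge0.
apply: ge0_le_integral => //.
- by move=> x _; apply: integral_ge0.
- by apply: (@measurable_fun_fubini_tonelli_F _ _ _ _ _ mu (fun z => `|F z|%E)) => //; apply: measurableT_comp.
- by apply: measurable_funeM; apply: measurableT_comp => //; apply/measurable_EFinP.
move=> x _; rewrite /F /=.
have -> : ((M * w)%:E * (`|U x|)%:E = \int[mu]_y ((`|U x| * M)%:E * (`|V y|)%:E))%E.
  rewrite integralZl// /w /Rintegral [(M * _)%:E]EFinM fineK; last exact: integrable_fin_num.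
  by rewrite muleC muleA EFinM.
apply: ge0_le_integral => //.
- apply/measurable_EFinP; apply: measurableT_comp => //; apply: measurable_funM => //.
  by apply: measurable_funM => //; apply: bounded_kernel_row bk.
- by apply: measurable_funeM; apply/measurable_EFinP; apply: measurableT_comp.
- move=> y _; rewrite lee_fin !normrM mulrA ler_wpM2r// ler_wpM2l//.
  by case: bk.
Qed.

Let FE1 x : (\int[mu]_y F (x, y) = (U x * \int[mu]_(y in `[c, d]) (k x y * v y))%:E)%E.
Proof.
have ikv := bounded_kernel_intr x bk iv.
rewrite EFinM /Rintegral fineK; last exact: integrable_fin_num.
rewrite [in RHS]integral_mkcond -integralZl//.
  apply: eq_integral => y _; rewrite /F /= /V !patchE.
  by case: ifP; rewrite ?mulr0 ?mule0// EFinM.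
rewrite [X in integrable _ _ X](_ : _ = (EFin \o (fun y => k x y * v y)) \_ `[c, d])//.
by apply/integrable_restrict => //; rewrite setTI.
Qed.

Let FE2 y : (\int[mu]_x F (x, y) = (V y * \int[mu]_(x in `[a, b]) (k x y * u x))%:E)%E.
Proof.
have iku := bounded_kernel_intl y bk iu.
rewrite EFinM /Rintegral fineK; last exact: integrable_fin_num.
rewrite [in RHS]integral_mkcond -integralZl//.
  apply: eq_integral => x _; rewrite /F /= /U !patchE.
  case: ifP; rewrite ?mul0r ?mule0// EFinM => _.
  rewrite -!EFinM; congr EFin; ring.
rewrite [X in integrable _ _ X](_ : _ = (EFin \o (fun x => k x y * u x)) \_ `[a, b])//.
by apply/integrable_restrict => //; rewrite setTI.
Qed.

Lemma fubini_kernel_real :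
  \int[mu]_(x in `[a, b]) (u x * \int[mu]_(y in `[c, d]) (k x y * v y)) =
  \int[mu]_(y in `[c, d]) (v y * \int[mu]_(x in `[a, b]) (k x y * u x)).
Proof.
rewrite Rintegral_mkcond [RHS]Rintegral_mkcond /Rintegral; congr fine.
transitivity (\int[mu]_x \int[mu]_y F (x, y))%E.
  apply: eq_integral => x _; rewrite FE1 /U !patchE.
  by case: ifP; rewrite ?mul0r.
rewrite (Fubini iF); apply: eq_integral => y _; rewrite FE2 /V !patchE.
by case: ifP; rewrite ?mul0r.
Qed.

Lemma measurable_kernel_mul :
  measurable_fun `[a, b] (fun x => u x * \int[mu]_(y in `[c, d]) (k x y * v y)).
Proof.
apply/measurable_EFinP.
have h : measurable_fun `[a, b] (fubini_F mu F).
  by apply: measurable_funTS; apply: measurable_fubini_F iF.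
apply: (eq_measurable_fun (fubini_F mu F)) => // x; rewrite inE /= => xab.
by rewrite /fubini_F FE1 /U patchE mem_set.
Qed.

End fubini.

Lemma kernel_bound k M c d x v : bounded_kernel k M -> rintegrable c d v ->
  `|\int[mu]_(y in `[c, d]) (k x y * v y)| <= M * \int[mu]_(y in `[c, d]) `|v y|.
Proof.
move=> bk iv; apply: le_trans (le_normr_Rintegral _ _) _ => //.
  exact: bounded_kernel_intr bk iv.
rewrite -RintegralZl//; last exact: rintegrable_norm.
apply: rint_le.
- by apply: rintegrable_norm; apply: bounded_kernel_intr bk iv.
- by apply: rintegrableZ; apply: rintegrable_norm.
- by move=> y _; rewrite normrM ler_wpM2r//; case: bk.
Qed.

Lemma measurable_kernel k M a b c d v : bounded_kernel k M -> rintegrable c d v ->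
  measurable_fun `[a, b] (fun x => \int[mu]_(y in `[c, d]) (k x y * v y)).
Proof.
move=> bk iv; have := measurable_kernel_mul bk (rintegrable_cst a b 1) iv.
by apply: mext => x; rewrite mul1r.
Qed.

End FubiniReal.
Arguments measurable_kernel {R k M} a b {c d v}.

Section FubiniComplex.
Context {R : realType}.
Notation C := R[i].
Notation mu := (@lebesgue_measure R).
Implicit Types (a b c d M : R) (u v : R -> C) (k : R -> R -> C).

Definition ckernel k M :=
  [/\ measurable_fun setT (fun z : R * R => Re (k z.1 z.2)),
      measurable_fun setT (fun z : R * R => Im (k z.1 z.2)) &
      forall x y, cabs (k x y) <= M].

Lemma ckernel_Re k M : ckernel k M -> bounded_kernel (fun x y => Re (k x y)) M.
Proof. by case=> m1 m2 b; split => // x y; apply: le_trans (normr_Re _) (b x y). Qed.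
Lemma ckernel_Im k M : ckernel k M -> bounded_kernel (fun x y => Im (k x y)) M.
Proof. by case=> m1 m2 b; split => // x y; apply: le_trans (normr_Im _) (b x y). Qed.

Lemma ckernel_ge0 k M : ckernel k M -> 0 <= M.
Proof. by case=> _ _ /(_ 0 0); apply: le_trans; apply: cabs_ge0. Qed.

Lemma ckernel_tr k M : ckernel k M -> ckernel (fun x y => k y x) M.
Proof.
have ms : measurable_fun setT (fun z : R * R => (z.2, z.1)).
  by apply: measurable_fun_pair.
case=> m1 m2 b; split => //.
- by have := measurableT_comp m1 ms.
- by have := measurableT_comp m2 ms.
Qed.

Lemma ckernelJ k M : ckernel k M -> ckernel (fun x y => (k x y)^*) M.
Proof.
case=> m1 m2 b; split => [||x y]; last by rewrite cabsJ.
- by under eq_fun do rewrite ReJ.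
- by under eq_fun do rewrite ImJ; apply: measurableT_comp.
Qed.

Lemma ckernel_ind (P : R -> R -> bool) k M :
  measurable_fun setT (fun z : R * R => P z.1 z.2) -> ckernel k M ->
  ckernel (fun x y => if P x y then k x y else 0) M.
Proof.
move=> mP kM; have M0 := ckernel_ge0 kM; case: kM => m1 m2 b; split => [||x y].
- rewrite (_ : (fun z => _) = fun z : R * R => if P z.1 z.2 then Re (k z.1 z.2) else 0).
    exact: measurable_fun_ifT.
  by apply/funext => z; case: ifP.
- rewrite (_ : (fun z => _) = fun z : R * R => if P z.1 z.2 then Im (k z.1 z.2) else 0).
    exact: measurable_fun_ifT.
  by apply/funext => z; case: ifP.
- by case: ifP => // _; rewrite cabs0.
Qed.

Lemma ckernel_intr k M x a b v : ckernel k M -> cintegrable a b v ->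
  cintegrable a b (fun y => k x y * v y).
Proof.
move=> kM; apply: (@cintegrable_bM _ _ _ M); last by case: kM.
split; apply: measurable_funTS.
- exact: bounded_kernel_row (ckernel_Re kM).
- exact: bounded_kernel_row (ckernel_Im kM).
Qed.

Lemma ckernel_intl k M y a b u : ckernel k M -> cintegrable a b u ->
  cintegrable a b (fun x => k x y * u x).
Proof. by move=> /ckernel_tr kM; apply: (ckernel_intr _ kM). Qed.

Lemma ckernel_bound k M x a b v : ckernel k M -> cintegrable a b v ->
  cabs (cint (fun y => k x y * v y) a b) <= M * \int[mu]_(y in `[a, b]) cabs (v y).
Proof.
move=> kM iv; rewrite -RintegralZl//; last exact: rintegrable_cabs.
apply: cint_le.
- exact: ckernel_intr kM iv.
- by apply: rintegrableZ; apply: rintegrable_cabs.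
- by move=> y _; rewrite cabsM ler_wpM2r ?cabs_ge0//; case: kM.
Qed.

Section expand.
Variables (k : R -> R -> C) (M a b : R) (v : R -> C).
Hypotheses (kM : ckernel k M) (iv : cintegrable a b v).
Let iv1 : rintegrable a b (fun y => Re (v y)). Proof. by case: iv. Qed.
Let iv2 : rintegrable a b (fun y => Im (v y)). Proof. by case: iv. Qed.

Lemma Re_kernel x : Re (cint (fun y => k x y * v y) a b) =
  \int[mu]_(y in `[a, b]) (Re (k x y) * Re (v y)) -
  \int[mu]_(y in `[a, b]) (Im (k x y) * Im (v y)).
Proof.
rewrite Re_cint -RintegralB//.
- by apply: eq_rint => y _; rewrite cE.
- exact: bounded_kernel_intr (ckernel_Re kM) iv1.
- exact: bounded_kernel_intr (ckernel_Im kM) iv2.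
Qed.

Lemma Im_kernel x : Im (cint (fun y => k x y * v y) a b) =
  \int[mu]_(y in `[a, b]) (Re (k x y) * Im (v y)) +
  \int[mu]_(y in `[a, b]) (Im (k x y) * Re (v y)).
Proof.
rewrite Im_cint -RintegralD//.
- by apply: eq_rint => y _; rewrite cE.
- exact: bounded_kernel_intr (ckernel_Re kM) iv2.
- exact: bounded_kernel_intr (ckernel_Im kM) iv1.
Qed.

Lemma cmeas_kernel c d : cmeas c d (fun x => cint (fun y => k x y * v y) a b).
Proof.
have := measurable_kernel c d (ckernel_Re kM) iv1.
have := measurable_kernel c d (ckernel_Im kM) iv1.
have := measurable_kernel c d (ckernel_Re kM) iv2.
have := measurable_kernel c d (ckernel_Im kM) iv2.
move=> h1 h2 h3 h4; split.
- by apply: mext (measurable_funB h4 h1) => x; rewrite Re_kernel.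
- by apply: mext (measurable_funD h2 h3) => x; rewrite Im_kernel.
Qed.

Lemma cintegrable_kernel c d :
  cintegrable c d (fun x => cint (fun y => k x y * v y) a b).
Proof.
apply: cintegrable_bounded; first exact: cmeas_kernel.
by move=> x _; exact: ckernel_bound kM iv.
Qed.
End expand.

(** Four terms are what the real or the imaginary part of a product of three complex factors expands
    to. *)
Lemma rint_lin4 a b s1 s2 s3 s4 (f1 f2 f3 f4 : R -> R) :
  rintegrable a b f1 -> rintegrable a b f2 -> rintegrable a b f3 -> rintegrable a b f4 ->
  \int[mu]_(x in `[a, b]) (s1 * f1 x + s2 * f2 x + s3 * f3 x + s4 * f4 x) =
  s1 * \int[mu]_(x in `[a, b]) f1 x + s2 * \int[mu]_(x in `[a, b]) f2 x +
  s3 * \int[mu]_(x in `[a, b]) f3 x + s4 * \int[mu]_(x in `[a, b]) f4 x.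
Proof.
move=> i1 i2 i3 i4.
rewrite !RintegralD ?RintegralZl//;
  do ?[apply: rintegrableZ => //|apply: rintegrableD => //].
Qed.

Section cfubini.
Variables (k : R -> R -> C) (M a b c d : R) (u v : R -> C).
Hypotheses (kM : ckernel k M) (iu : cintegrable a b u) (iv : cintegrable c d v).

Let intJ (k0 : R -> R -> R) (u0 v0 : R -> R) : bounded_kernel k0 M -> rintegrable a b u0 ->
  rintegrable c d v0 ->
  rintegrable a b (fun x => u0 x * \int[mu]_(y in `[c, d]) (k0 x y * v0 y)).
Proof.
move=> bk iu0 iv0.
apply: (rintegrable_ext _ (@rintegrable_bM _ _ _ _ _ _ (measurable_kernel a b bk iv0) _ iu0)).
  by move=> x _; rewrite mulrC.
by move=> x _; apply: kernel_bound bk iv0.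
Qed.

(** The real and the imaginary part of u k v are signed sums of four real products each; the order
    of integration is exchanged in every one of them. *)
Lemma fubini_kernel :
  cint (fun x => u x * cint (fun y => k x y * v y) c d) a b =
  cint (fun y => v y * cint (fun x => k x y * u x) a b) c d.
Proof.
have kr := ckernel_Re kM; have ki := ckernel_Im kM.
have kM' := ckernel_tr kM; have kr' := ckernel_Re kM'; have ki' := ckernel_Im kM'.
case: (iu) => ur ui; case: (iv) => vr vi.
have intJ' (k0 : R -> R -> R) (u0 v0 : R -> R) : bounded_kernel (fun y x => k0 x y) M ->
    rintegrable a b u0 -> rintegrable c d v0 ->
    rintegrable c d (fun y => v0 y * \int[mu]_(x in `[a, b]) (k0 x y * u0 x)).
  move=> bk iu0 iv0.
  apply: (rintegrable_ext _ (@rintegrable_bM _ _ _ _ _ _ (measurable_kernel c d bk iu0) _ iv0)).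
    by move=> x _; rewrite mulrC.
  by move=> x _; apply: kernel_bound bk iu0.
apply: complexP.
- transitivity (\int[mu]_(x in `[a, b])
    (1 * (Re (u x) * \int[mu]_(y in `[c, d]) (Re (k x y) * Re (v y))) +
     -1 * (Re (u x) * \int[mu]_(y in `[c, d]) (Im (k x y) * Im (v y))) +
     -1 * (Im (u x) * \int[mu]_(y in `[c, d]) (Re (k x y) * Im (v y))) +
     -1 * (Im (u x) * \int[mu]_(y in `[c, d]) (Im (k x y) * Re (v y))))).
    rewrite Re_cint; apply: eq_rint => x _.
    by rewrite ReM (Re_kernel kM iv) (Im_kernel kM iv); ring.
  transitivity (\int[mu]_(y in `[c, d])
    (1 * (Re (v y) * \int[mu]_(x in `[a, b]) (Re (k x y) * Re (u x))) +
     -1 * (Im (v y) * \int[mu]_(x in `[a, b]) (Im (k x y) * Re (u x))) +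
     -1 * (Im (v y) * \int[mu]_(x in `[a, b]) (Re (k x y) * Im (u x))) +
     -1 * (Re (v y) * \int[mu]_(x in `[a, b]) (Im (k x y) * Im (u x))))); last first.
    rewrite Re_cint; apply: eq_rint => y _.
    by rewrite ReM (Re_kernel kM' iu) (Im_kernel kM' iu); ring.
  rewrite (rint_lin4 _ _ _ _ (intJ kr ur vr) (intJ ki ur vi) (intJ kr ui vi) (intJ ki ui vr)).
  rewrite (rint_lin4 _ _ _ _ (intJ' _ _ _ kr' ur vr) (intJ' _ _ _ ki' ur vi) (intJ' _ _ _ kr' ui vi) (intJ' _ _ _ ki' ui vr)).
  rewrite (fubini_kernel_real kr ur vr) (fubini_kernel_real ki ur vi).
  by rewrite (fubini_kernel_real kr ui vi) (fubini_kernel_real ki ui vr).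
- transitivity (\int[mu]_(x in `[a, b])
    (1 * (Re (u x) * \int[mu]_(y in `[c, d]) (Re (k x y) * Im (v y))) +
     1 * (Re (u x) * \int[mu]_(y in `[c, d]) (Im (k x y) * Re (v y))) +
     1 * (Im (u x) * \int[mu]_(y in `[c, d]) (Re (k x y) * Re (v y))) +
     -1 * (Im (u x) * \int[mu]_(y in `[c, d]) (Im (k x y) * Im (v y))))).
    rewrite Im_cint; apply: eq_rint => x _.
    by rewrite ImM (Re_kernel kM iv) (Im_kernel kM iv); ring.
  transitivity (\int[mu]_(y in `[c, d])
    (1 * (Im (v y) * \int[mu]_(x in `[a, b]) (Re (k x y) * Re (u x))) +
     1 * (Re (v y) * \int[mu]_(x in `[a, b]) (Im (k x y) * Re (u x))) +
     1 * (Re (v y) * \int[mu]_(x in `[a, b]) (Re (k x y) * Im (u x))) +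
     -1 * (Im (v y) * \int[mu]_(x in `[a, b]) (Im (k x y) * Im (u x))))); last first.
    rewrite Im_cint; apply: eq_rint => y _.
    by rewrite ImM (Re_kernel kM' iu) (Im_kernel kM' iu); ring.
  rewrite (rint_lin4 _ _ _ _ (intJ kr ur vi) (intJ ki ur vr) (intJ kr ui vr) (intJ ki ui vi)).
  rewrite (rint_lin4 _ _ _ _ (intJ' _ _ _ kr' ur vi) (intJ' _ _ _ ki' ur vr) (intJ' _ _ _ kr' ui vr) (intJ' _ _ _ ki' ui vi)).
  rewrite (fubini_kernel_real kr ur vi) (fubini_kernel_real ki ur vr).
  by rewrite (fubini_kernel_real kr ui vr) (fubini_kernel_real ki ui vi).
Qed.
End cfubini.

End FubiniComplex.

(** * Absolutely continuous functions *)

Section AbsolutelyContinuous.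
Context {R : realType}.
Notation C := R[i].
Notation mu := (@lebesgue_measure R).
Implicit Types (a b c d M x y : R) (f g F G : R -> C).

Lemma ae_neq c : {ae mu, forall x, x != c}.
Proof.
exists [set c]; split => //; first exact: lebesgue_measure_set1.
by move=> x /= /negP; rewrite negbK => /eqP.
Qed.

Let mle : measurable_fun setT (fun z : R * R => z.2 <= z.1).
Proof. exact: measurable_fun_ler. Qed.
Let mge : measurable_fun setT (fun z : R * R => z.1 <= z.2).
Proof. exact: measurable_fun_ler. Qed.

Lemma ckernel_lower k M : ckernel k M ->
  ckernel (fun x y : R => if y <= x then k x y else 0 : C) M.
Proof. exact: (@ckernel_ind _ (fun x y => y <= x)). Qed.
Lemma ckernel_upper k M : ckernel k M ->
  ckernel (fun x y : R => if x <= y then k x y else 0 : C) M.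
Proof. exact: (@ckernel_ind _ (fun x y => x <= y)). Qed.

Lemma ckernel_cst (c0 : C) : ckernel (fun _ _ : R => c0) (cabs c0).
Proof. by split. Qed.

Lemma cintegrable_if a b f (P : pred R) : measurable_fun setT P ->
  cintegrable a b f -> cintegrable a b (fun y => if P y then f y else 0).
Proof.
move=> mP fi.
apply: (@cintegrable_ext _ _ _ (fun y => (if P y then 1 else 0) * f y)).
  by move=> y _; case: ifP; rewrite ?mul1r ?mul0r.
apply: (@cintegrable_bM _ _ _ 1) => //; last first.
  by move=> y _; case: ifP; rewrite ?cabs1 ?cabs0.
split.
- rewrite (_ : (fun _ => _) = fun y => if P y then 1 else 0).
    by apply: measurable_funTS; apply: measurable_fun_ifT.
  by apply/funext => z; case: ifP.
- by rewrite (_ : (fun _ => _) = cst 0)//; apply/funext => z; case: ifP.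
Qed.

(** A variable limit becomes an indicator in the integrand over a fixed interval, so that primitives
    are kernel integrals. Beyond [x] the integrand vanishes except possibly at the null point [x]
    itself. *)
Lemma cint_lower a b x f : a <= x <= b -> cintegrable a b f ->
  cint f a x = cint (fun y => if y <= x then f y else 0) a b.
Proof.
move=> /andP[ax xb] fi.
have gi : cintegrable a b (fun y => if y <= x then f y else 0).
  by apply: cintegrable_if => //; apply: measurable_fun_ler.
rewrite (cint_chasles ax xb gi) -[LHS]addr0; congr (_ + _).
  by apply: eq_cint => y /andP[_ ->].
rewrite -[LHS](cint0 x b); apply: cint_ae; first exact: cintegrable_cst.
  exact: cintegrableS gi.
apply: aeS (ae_neq x) => y yx /andP[xy _].
by rewrite leNgt lt_neqAle eq_sym yx xy.
Qed.

Lemma cint_upper a b x f : a <= x <= b -> cintegrable a b f ->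
  cint f x b = cint (fun y => if x <= y then f y else 0) a b.
Proof.
move=> /andP[ax xb] fi.
have gi : cintegrable a b (fun y => if x <= y then f y else 0).
  by apply: cintegrable_if => //; apply: measurable_fun_ler.
rewrite (cint_chasles ax xb gi) -[LHS]add0r; congr (_ + _); last first.
  by apply: eq_cint => y /andP[-> _].
rewrite -[LHS](cint0 a x); apply: cint_ae; first exact: cintegrable_cst.
  exact: cintegrableS gi.
apply: aeS (ae_neq x) => y yx /andP[_ yx'].
by rewrite leNgt lt_neqAle yx yx'.
Qed.

(** Absolute continuity in integral form, with an integrable derivative [f] carried along as data;
    [f] matters only up to null sets, while [F] is determined at every point. *)
Definition AC a b F f :=
  cintegrable a b f /\ forall x, a <= x <= b -> F x = F a + cint f a x.

Lemma cmeas_primitive a b f : cintegrable a b f ->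
  cmeas a b (fun x => cint f a x).
Proof.
move=> fi.
have := cmeas_kernel (ckernel_lower (ckernel_cst 1)) fi a b.
apply: cmeas_ext => x xab; rewrite (cint_lower xab)//; apply: eq_cint => y _.
by case: ifP; rewrite ?mul1r ?mul0r.
Qed.

Lemma rint_cabs_ge0 a b f : 0 <= \int[mu]_(x in `[a, b]) cabs (f x).
Proof. by apply: Rintegral_ge0 => x _; apply: cabs_ge0. Qed.

Lemma cint_sub_bound a b c d f : a <= c -> d <= b -> cintegrable a b f ->
  cabs (cint f c d) <= \int[mu]_(x in `[a, b]) cabs (f x).
Proof.
move=> ac db fi; have [cd|dc] := leP c d; last first.
  rewrite [cint _ _ _](_ : _ = 0) ?cabs0 ?rint_cabs_ge0//.
  by apply: complexP; rewrite /cint/= set_itv_ge ?Rintegral_set0// -leNgt bnd_simp.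
apply: le_trans (cint_norm (cintegrableS ac db fi)) _.
have ia := rintegrable_cabs fi.
have cb := le_trans cd db; have ad := le_trans ac cd.
rewrite (rint_chasles ac cb ia) (rint_chasles cd db (rintegrableS ac (lexx b) ia)).
rewrite addrCA lerDl addr_ge0 //; exact: rint_cabs_ge0.
Qed.

Lemma AC_bounded a b F f : AC a b F f -> exists M, forall x, a <= x <= b -> cabs (F x) <= M.
Proof.
move=> [fi Ff]; exists (cabs (F a) + \int[mu]_(x in `[a, b]) cabs (f x)) => x xab.
rewrite Ff// (le_trans (cabsD _ _))// lerD2l cint_sub_bound//.
by case/andP: xab.
Qed.

Lemma AC_meas a b F f : AC a b F f -> cmeas a b F.
Proof.
move=> [fi Ff]; apply: (cmeas_ext _ (cmeasD (cmeas_cst a b (F a)) (cmeas_primitive fi))).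
by move=> x /Ff ->.
Qed.

Lemma AC_integrableM a b F f g : AC a b F f -> cintegrable a b g ->
  cintegrable a b (fun x => F x * g x).
Proof.
move=> FA gi; have [M FM] := AC_bounded FA.
exact: cintegrable_bM (AC_meas FA) FM gi.
Qed.

Lemma AC_integrable a b F f : AC a b F f -> cintegrable a b F.
Proof.
move=> FA; apply: (cintegrable_ext _ (AC_integrableM FA (cintegrable_cst a b 1))).
by move=> x _; rewrite mulr1.
Qed.

Lemma ACS a b c d F f : a <= c -> d <= b -> AC a b F f -> AC c d F f.
Proof.
move=> ac db [fi Ff]; split; first exact: cintegrableS fi.
move=> x /andP[cx xd]; have xb := le_trans xd db.
rewrite (Ff x) ?(le_trans ac cx)// (Ff c) ?ac ?(le_trans cx)//.
by rewrite (cint_chasles ac cx (cintegrableS (lexx a) xb fi)) addrA.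
Qed.

Lemma AC_ext a b F G f g : (forall x, a <= x <= b -> F x = G x) ->
  (forall x, a <= x <= b -> f x = g x) -> AC a b F f -> AC a b G g.
Proof.
move=> FG fg [fi Ff]; split; first exact: cintegrable_ext fi.
move=> x xab; have [ax xb] := andP xab.
rewrite -FG// -FG ?lexx ?(le_trans ax)// Ff//; congr (_ + _).
by apply: eq_cint => y /andP[ay yx]; rewrite fg// ay (le_trans yx).
Qed.

Lemma AC_primitive a b (w : C) f : cintegrable a b f -> AC a b (fun x => w + cint f a x) f.
Proof. by move=> fi; split => // x xab; rewrite cint_pt addr0. Qed.

Lemma AC_cst a b (w : C) : AC a b (fun=> w) (fun=> 0).
Proof. by split; [exact: cintegrable_cst|move=> x _; rewrite cint0 addr0]. Qed.

Lemma ACD a b F f G g : AC a b F f -> AC a b G g ->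
  AC a b (fun x => F x + G x) (fun x => f x + g x).
Proof.
move=> [fi Ff] [gi Gg]; split; first exact: cintegrableD.
move=> x xab; have [_ xb] := andP xab; rewrite Ff// Gg// cintD; first by ring.
- exact: cintegrableS fi.
- exact: cintegrableS gi.
Qed.

Lemma ACZ a b (w : C) F f : AC a b F f -> AC a b (fun x => w * F x) (fun x => w * f x).
Proof.
move=> [fi Ff]; split; first exact: cintegrableZ.
move=> x xab; have [_ xb] := andP xab; rewrite Ff// cintZ; first by ring.
exact: cintegrableS fi.
Qed.

Lemma ACN a b F f : AC a b F f -> AC a b (fun x => - F x) (fun x => - f x).
Proof. by move/(ACZ (-1)); apply: AC_ext => x _; rewrite mulN1r. Qed.

Lemma ACB a b F f G g : AC a b F f -> AC a b G g ->
  AC a b (fun x => F x - G x) (fun x => f x - g x).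
Proof. by move=> FA /ACN; apply: ACD. Qed.

Lemma AC_bnd a b F f : a <= b -> AC a b F f -> cint f a b = F b - F a.
Proof. by move=> ab [_ /(_ b)]; rewrite ab lexx => /(_ isT) ->; ring. Qed.

(** Writing [F] and [G] as primitives turns both integrals into integrals of f(x) g(y) over the
    triangles y <= x and x <= y of the square. Fubini brings them into the same order, and together
    they fill the square. *)
Lemma AC_by_parts a b F f G g : a <= b -> AC a b F f -> AC a b G g ->
  F b * G b = F a * G a + cint (fun x => f x * G x + F x * g x) a b.
Proof.
move=> ab FA GA; have [fi Ff] := FA; have [gi Gg] := GA.
have fGi : cintegrable a b (fun x => f x * G x).
  by apply: (cintegrable_ext _ (AC_integrableM GA fi)) => x _; rewrite mulrC.
have Fgi := AC_integrableM FA gi.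
rewrite cintD//.
pose K (x y : R) : C := if y <= x then 1 else 0.
have KM : ckernel K (cabs 1) := ckernel_lower (ckernel_cst 1).
have H1 : cint (fun x => f x * G x) a b =
    G a * cint f a b + cint (fun x => f x * cint (fun y => K x y * g y) a b) a b.
  have i1 : cintegrable a b (fun x => f x * cint (fun y => K x y * g y) a b).
    have i2 := AC_primitive 0 (fi); have i3 := AC_primitive 0 gi.
    apply: (cintegrable_ext _ (AC_integrableM i3 fi)) => x xab.
    rewrite add0r mulrC (cint_lower xab gi); congr (_ * _); apply: eq_cint => y _.
    by rewrite /K; case: ifP; rewrite ?mul1r ?mul0r.
  rewrite -(cintZ (G a) fi) -(cintD (cintegrableZ (G a) fi) i1).
  apply: eq_cint => x xab; rewrite Gg//.
  have -> : cint (fun y => K x y * g y) a b = cint g a x.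
    rewrite (cint_lower xab gi); apply: eq_cint => y _.
    by rewrite /K; case: ifP; rewrite ?mul1r ?mul0r.
  ring.
pose L (x y : R) : C := if x <= y then 1 else 0.
have LM : ckernel L (cabs 1) := ckernel_upper (ckernel_cst 1).
have H2 : cint (fun x => F x * g x) a b =
    F a * cint g a b + cint (fun y => g y * cint (fun x => L x y * f x) a b) a b.
  have i1 : cintegrable a b (fun y => g y * cint (fun x => L x y * f x) a b).
    have i3 := AC_primitive 0 fi.
    apply: (cintegrable_ext _ (AC_integrableM i3 gi)) => x xab.
    rewrite add0r mulrC (cint_lower xab fi); congr (_ * _); apply: eq_cint => y _.
    by rewrite /L; case: ifP; rewrite ?mul1r ?mul0r.
  rewrite -(cintZ (F a) gi) -(cintD (cintegrableZ (F a) gi) i1).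
  apply: eq_cint => x xab; rewrite Ff//.
  have -> : cint (fun y => L y x * f y) a b = cint f a x.
    rewrite (cint_lower xab fi); apply: eq_cint => y _.
    by rewrite /L; case: ifP; rewrite ?mul1r ?mul0r.
  ring.
rewrite H1 H2 -(fubini_kernel LM fi gi).
(* The two triangles overlap only on the diagonal, so their integrals add up to the product of the
   integrals of [f] and [g]. *)
have -> : cint (fun x => f x * cint (fun y => L x y * g y) a b) a b =
    cint g a b * cint f a b - cint (fun x => f x * cint (fun y => K x y * g y) a b) a b.
  have i1 : cintegrable a b (fun x => f x * cint (fun y => K x y * g y) a b).
    have i3 := AC_primitive 0 gi.
    apply: (cintegrable_ext _ (AC_integrableM i3 fi)) => x xab.
    rewrite add0r mulrC (cint_lower xab gi); congr (_ * _); apply: eq_cint => y _.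
    by rewrite /K; case: ifP; rewrite ?mul1r ?mul0r.
  rewrite -(cintZ _ fi) -(cintB (cintegrableZ _ fi) i1).
  apply: eq_cint => x xab; have [ax xb] := andP xab.
  have -> : cint (fun y => K x y * g y) a b = cint g a x.
    rewrite (cint_lower xab gi); apply: eq_cint => y _.
    by rewrite /K; case: ifP; rewrite ?mul1r ?mul0r.
  have -> : cint (fun y => L x y * g y) a b = cint g x b.
    rewrite (cint_upper xab gi); apply: eq_cint => y _.
    by rewrite /L; case: ifP; rewrite ?mul1r ?mul0r.
  rewrite (cint_chasles ax xb gi); ring.
rewrite (AC_bnd ab FA) (AC_bnd ab GA); ring.
Qed.

Lemma ACM a b F f G g : AC a b F f -> AC a b G g ->
  AC a b (fun x => F x * G x) (fun x => f x * G x + F x * g x).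
Proof.
move=> FA GA; have [fi _] := FA; have [gi _] := GA; split.
  apply: cintegrableD; last exact: AC_integrableM FA gi.
  by apply: (cintegrable_ext _ (AC_integrableM GA fi)) => x _; rewrite mulrC.
move=> x /andP[ax xb].
by rewrite -(AC_by_parts ax (ACS (lexx _) xb FA) (ACS (lexx _) xb GA)).
Qed.

Lemma AC_continuous a b F f : a <= b -> AC a b F f -> ccontinuous `[a, b] F.
Proof.
move=> ab [[f1 f2] Ff]; split.
- have h := parameterized_integral_continuous ab f1.
  have h' : {within `[a, b], continuous (fun x => Re (F a) + parameterized_integral mu a x (fun x => Re (f x)))}.
    by move=> x; apply: cvgD; [exact: cvg_cst|exact: h].
  apply: (subspace_eq_continuous _ h') => x; rewrite inE/= in_itv/= => xab.
  by rewrite /from_subspace /= (Ff x xab) ReD.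
- have h := parameterized_integral_continuous ab f2.
  have h' : {within `[a, b], continuous (fun x => Im (F a) + parameterized_integral mu a x (fun x => Im (f x)))}.
    by move=> x; apply: cvgD; [exact: cvg_cst|exact: h].
  apply: (subspace_eq_continuous _ h') => x; rewrite inE/= in_itv/= => xab.
  by rewrite /from_subspace /= (Ff x xab) ImD.
Qed.

(** The passage from classical to integral form: the derivative is needed only inside the interval,
    provided that [F] and [f] are continuous up to the ends. *)
Lemma FTC_AC a b F f : a <= b -> ccontinuous `[a, b] f -> ccontinuous `[a, b] F ->
  (forall x, a < x < b -> is_cderive F x (f x)) -> AC a b F f.
Proof.
move=> ab cf cF dF; split; first exact: ccontinuous_integrable.
move=> x; rewrite le_eqVlt => /andP[/predU1P[<-|ax] xb]; first by rewrite cint_pt addr0.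
have key (u U : R -> R) : {within `[a, b], continuous u} -> {within `[a, b], continuous U} ->
    (forall z, a < z < b -> is_derive z 1 U (u z)) ->
    \int[mu]_(z in `[a, x]) u z = U x - U a.
  move=> cu cU dU; rewrite /Rintegral.
  have sub : `[a, x] `<=` `[a, b].
    by move=> z /=; rewrite !in_itv/= => /andP[-> zx]; rewrite (le_trans zx).
  rewrite (@continuous_FTC2 _ u U a x)//.
  - exact: continuous_subspaceW cu.
  - have := continuous_subspaceW sub cU.
    move=> /(continuous_within_itvP _ ax)[_ c1 c2]; split => // z.
    rewrite in_itv/= => /andP[az zx]; have [] := dU z; last by [].
    by rewrite az (lt_le_trans zx).
  - move=> z; rewrite in_itv/= => /andP[az zx]; rewrite derive1E.
    have dz : is_derive z 1 U (u z) by apply: dU; rewrite az (lt_le_trans zx).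
    exact: derive_val.
case: cf => cf1 cf2; case: cF => cF1 cF2.
apply: complexP; rewrite ?(ReD, ImD, Re_cint, Im_cint).
- rewrite (key _ _ cf1 cF1 (fun z zab => proj1 (dF z zab))); ring.
- rewrite (key _ _ cf2 cF2 (fun z zab => proj2 (dF z zab))); ring.
Qed.

End AbsolutelyContinuous.

(** * The space L^2(0,1) *)

Section SquareIntegrable.
Context {R : realType}.
Notation C := R[i].
Notation mu := (@lebesgue_measure R).
Implicit Types (u v : R -> R) (f g phi : R -> C) (k : C).

Lemma EFin_rint (a b : R) u : rintegrable a b u ->
  (\int[mu]_(x in `[a, b]) (u x)%:E)%E = (\int[mu]_(x in `[a, b]) u x)%:E.
Proof. by move=> ui; rewrite /Rintegral fineK//; apply: integrable_fin_num. Qed.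

Definition rL2 u := measurable_fun `[(0 : R), 1] u /\ rintegrable 0 1 (fun x => u x ^+ 2).

Lemma rL2_dom u v : measurable_fun `[(0 : R), 1] u -> rL2 v ->
  (forall x, 0 <= x <= 1 -> u x ^+ 2 <= v x ^+ 2) -> rL2 u.
Proof.
move=> mu_ [_ iv] uv; split => //; apply: rintegrable_dom iv _.
  exact: measurable_funX.
by move=> x x01; rewrite ger0_norm ?sqr_ge0 ?uv.
Qed.

Lemma rL2Mi u v : rL2 u -> rL2 v -> rintegrable 0 1 (fun x => u x * v x).
Proof.
move=> [mu_ iu] [mv iv]; apply: rintegrable_dom (rintegrableD iu iv) _.
  exact: measurable_funM.
move=> x _; rewrite ler_norml; have := sqr_ge0 (u x + v x); have := sqr_ge0 (u x - v x).
rewrite sqrrB sqrrD; set p := u x * v x; rewrite -mulr_natl => h1 h2.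
have := sqr_ge0 (u x); have := sqr_ge0 (v x) => h3 h4.
by apply/andP; split; lra.
Qed.

Lemma rL2_i u : rL2 u -> rintegrable 0 1 u.
Proof.
move=> hu; have h1 : rL2 (fun=> 1) by split => //; apply: rintegrable_cst.
by apply: (rintegrable_ext _ (rL2Mi hu h1)) => x _; rewrite mulr1.
Qed.

Lemma rL2D u v : rL2 u -> rL2 v -> rL2 (fun x => u x + v x).
Proof.
move=> hu hv; have [mu_ iu] := hu; have [mv iv] := hv; split.
  exact: measurable_funD.
apply: (rintegrable_ext _ (rintegrableD (rintegrableD iu iv)
  (rintegrableZ 2 (rL2Mi hu hv)))) => x _; ring.
Qed.

Lemma rL2Z c u : rL2 u -> rL2 (fun x => c * u x).
Proof.
move=> [mu_ iu]; split; first exact: measurable_funM.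
by apply: (rintegrable_ext _ (rintegrableZ (c ^+ 2) iu)) => x _; rewrite exprMn.
Qed.

Lemma L2P f : L2 f <-> rL2 (fun x => Re (f x)) /\ rL2 (fun x => Im (f x)).
Proof.
split=> [[m1 m2 oo]|[[m1 i1] [m2 i2]]].
  have mc : measurable_fun `[(0 : R), 1] (fun x => cabs (f x) ^+ 2).
    by apply: measurable_funX; apply: meas_cabs; split.
  have ic : rintegrable 0 1 (fun x => cabs (f x) ^+ 2).
    apply/integrableP; split; first exact/measurable_EFinP.
    apply: le_lt_trans oo; rewrite le_eqVlt; apply/orP; left; apply/eqP.
    by apply: eq_integral => x _; rewrite /= ger0_norm// sqr_ge0.
  split; split => //; apply: rintegrable_dom ic _; do ?exact: measurable_funX.
  - by move=> x _; rewrite ger0_norm ?sqr_ge0// sqr_cabs lerDl sqr_ge0.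
  - by move=> x _; rewrite ger0_norm ?sqr_ge0// sqr_cabs lerDr sqr_ge0.
split => //.
have ic : rintegrable 0 1 (fun x => cabs (f x) ^+ 2).
  by apply: (rintegrable_ext _ (rintegrableD i1 i2)) => x _; rewrite sqr_cabs.
have /integrableP[_] := ic.
apply: le_lt_trans; rewrite le_eqVlt; apply/orP; left; apply/eqP.
by apply: eq_integral => x _; rewrite /= ger0_norm// sqr_ge0.
Qed.

Lemma L2_meas f : L2 f -> cmeas 0 1 f. Proof. by case. Qed.

Lemma L2_sqr f : L2 f -> rintegrable 0 1 (fun x => cabs (f x) ^+ 2).
Proof.
move=> /L2P[[_ i1] [_ i2]].
by apply: (rintegrable_ext _ (rintegrableD i1 i2)) => x _; rewrite sqr_cabs.
Qed.

Lemma L2_i f : L2 f -> cintegrable 0 1 f.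
Proof. by move=> /L2P[/rL2_i ? /rL2_i ?]. Qed.

Lemma L2D f g : L2 f -> L2 g -> L2 (fun x => f x + g x).
Proof.
move=> /L2P[f1 f2] /L2P[g1 g2]; apply/L2P; split.
- by rewrite (_ : (fun x => _) = (fun x => Re (f x) + Re (g x))); [apply: rL2D|apply/funext => x; rewrite cE].
- by rewrite (_ : (fun x => _) = (fun x => Im (f x) + Im (g x))); [apply: rL2D|apply/funext => x; rewrite cE].
Qed.

Lemma L2Z k f : L2 f -> L2 (fun x => k * f x).
Proof.
move=> /L2P[f1 f2]; apply/L2P; split.
- rewrite (_ : (fun x => _) = (fun x => Re k * Re (f x) + (- Im k) * Im (f x))).
    by apply: rL2D; apply: rL2Z.
  by apply/funext => x; rewrite cE mulNr.
- rewrite (_ : (fun x => _) = (fun x => Re k * Im (f x) + Im k * Re (f x))).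
    by apply: rL2D; apply: rL2Z.
  by apply/funext => x; rewrite cE.
Qed.

Lemma L2N f : L2 f -> L2 (fun x => - f x).
Proof. by move=> /(L2Z (-1)); under eq_fun do rewrite mulN1r. Qed.

Lemma L2B f g : L2 f -> L2 g -> L2 (fun x => f x - g x).
Proof. by move=> hf /L2N; apply: L2D. Qed.

Lemma L2J f : L2 f -> L2 (fun x => (f x)^*).
Proof.
move=> /L2P[f1 f2]; apply/L2P; split; first by under eq_fun do rewrite ReJ.
have := rL2Z (-1) f2; under eq_fun do rewrite mulN1r.
by under [X in rL2 X -> _]eq_fun do rewrite -ImJ.
Qed.

Lemma L2_bounded M f : cmeas 0 1 f -> (forall x, 0 <= x <= 1 -> cabs (f x) <= M) -> L2 f.
Proof.
move=> mf fM; have [m1 m2] := mf.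
have M1 : rL2 (fun=> M) by split => //; apply: rintegrable_cst.
have sq y x : 0 <= x <= 1 -> `|y| <= cabs (f x) -> y ^+ 2 <= M ^+ 2.
  move=> x01 h; have := le_trans h (fM x x01).
  by rewrite -[y ^+ 2]real_normK ?num_real// => h'; rewrite lerXn2r ?nnegrE// (le_trans _ h').
apply/L2P; split; apply: (rL2_dom _ M1) => // x x01; apply: (sq _ x x01).
- exact: normr_Re.
- exact: normr_Im.
Qed.

Lemma L2_cst k : L2 (fun=> k).
Proof. exact: (@L2_bounded (cabs k)). Qed.

Lemma L2_AC F f : AC 0 1 F f -> L2 F.
Proof. by move=> FA; have [M FM] := AC_bounded FA; apply: L2_bounded FM; apply: AC_meas FA. Qed.

Lemma L2_ccontinuous f : ccontinuous I01 f -> L2 f.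
Proof.
move=> cf; have fi := ccontinuous_integrable cf; case: (cf) => c1 c2.
have [M1 [_ h1]] := compact_bounded (continuous_compact c1 (@segment_compact R 0 1)).
have [M2 [_ h2]] := compact_bounded (continuous_compact c2 (@segment_compact R 0 1)).
apply: (@L2_bounded (M1 + 1 + (M2 + 1))); first exact: cintegrable_meas.
move=> x x01; apply: le_trans (cabs_le _) (lerD _ _).
- by apply: (h1 (M1 + 1)); [rewrite ltrDl|exists x => //=; rewrite in_itv].
- by apply: (h2 (M2 + 1)); [rewrite ltrDl|exists x => //=; rewrite in_itv].
Qed.

Lemma L2Mi f g : L2 f -> L2 g -> cintegrable 0 1 (fun x => f x * g x).
Proof.
move=> /L2P[f1 f2] /L2P[g1 g2]; split.
- by apply: (rintegrable_ext _ (rintegrableB (rL2Mi f1 g1) (rL2Mi f2 g2))) => x _; rewrite cE.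
- by apply: (rintegrable_ext _ (rintegrableD (rL2Mi f1 g2) (rL2Mi f2 g1))) => x _; rewrite cE.
Qed.

Lemma L2_bM M f g : cmeas 0 1 f -> (forall x, 0 <= x <= 1 -> cabs (f x) <= M) ->
  L2 g -> L2 (fun x => f x * g x).
Proof.
move=> mf fM hg; have [m1 m2] := cmeasM mf (L2_meas hg).
have hM := L2_sqr hg.
split => //.
have i : rintegrable 0 1 (fun x => cabs (f x * g x) ^+ 2).
  apply: (rintegrable_dom _ (rintegrableZ (M ^+ 2) hM)).
    by apply: measurable_funX; apply: meas_cabs; split.
  move=> x x01; rewrite ger0_norm ?sqr_ge0// cabsM exprMn ler_wpM2r ?sqr_ge0//.
  by rewrite lerXn2r ?nnegrE ?cabs_ge0 ?fM// (le_trans (cabs_ge0 (f x)))// fM.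
have /integrableP[_] := i; apply: le_lt_trans.
rewrite le_eqVlt; apply/orP; left; apply/eqP.
by apply: eq_integral => x _; rewrite /= ger0_norm// sqr_ge0.
Qed.

Lemma L2_contM f g : ccontinuous I01 f -> L2 g -> L2 (fun x => f x * g x).
Proof.
move=> cf; have fi := ccontinuous_integrable cf; case: (cf) => c1 c2.
have [M1 [_ h1]] := compact_bounded (continuous_compact c1 (@segment_compact R 0 1)).
have [M2 [_ h2]] := compact_bounded (continuous_compact c2 (@segment_compact R 0 1)).
apply: (@L2_bM (M1 + 1 + (M2 + 1))); first exact: cintegrable_meas.
move=> x x01; apply: le_trans (cabs_le _) (lerD _ _).
- by apply: (h1 (M1 + 1)); [rewrite ltrDl|exists x => //=; rewrite in_itv].
- by apply: (h2 (M2 + 1)); [rewrite ltrDl|exists x => //=; rewrite in_itv].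
Qed.

Lemma L2_sum I (r : seq I) (F : I -> R -> C) : (forall i, L2 (F i)) ->
  L2 (fun x => \sum_(i <- r) F i x).
Proof.
move=> hF; elim: r => [|i r ih].
  by under eq_fun do rewrite big_nil; apply: L2_cst.
by under eq_fun do rewrite big_cons; apply: L2D.
Qed.

Lemma L2dotDl f g phi : L2 f -> L2 g -> L2 phi ->
  L2dot (fun x => f x + g x) phi = L2dot f phi + L2dot g phi.
Proof.
move=> hf hg hp; have hp' := L2J hp; rewrite /L2dot -cintD; first last.
- exact: L2Mi.
- exact: L2Mi.
by apply: eq_cint => x _; rewrite mulrDl.
Qed.

Lemma L2dotZl k f phi : L2 f -> L2 phi ->
  L2dot (fun x => k * f x) phi = k * L2dot f phi.
Proof.
move=> hf hp; have hp' := L2J hp; rewrite /L2dot -cintZ; last exact: L2Mi.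
by apply: eq_cint => x _; rewrite mulrA.
Qed.

Lemma L2dotJ f g : L2 f -> L2 g -> L2dot g f = (L2dot f g)^*.
Proof.
move=> hf hg; rewrite /L2dot -cintJ; last by apply: L2Mi => //; exact: L2J.
apply: eq_cint => x _; apply: complexP; rewrite !cE; ring.
Qed.

Lemma L2dotBl f g phi : L2 f -> L2 g -> L2 phi ->
  L2dot (fun x => f x - g x) phi = L2dot f phi - L2dot g phi.
Proof.
move=> hf hg hp; rewrite L2dotDl//; last exact: L2N.
congr (_ + _); rewrite -[RHS]mulN1r -(L2dotZl (-1) hg hp).
by apply: eq_cint => x _; rewrite mulN1r.
Qed.

Lemma L2dot_suml I (r : seq I) (F : I -> R -> C) phi : (forall i, L2 (F i)) -> L2 phi ->
  L2dot (fun x => \sum_(i <- r) F i x) phi = \sum_(i <- r) L2dot (F i) phi.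
Proof.
move=> hF hp; rewrite /L2dot -cint_sum; last by move=> i; apply: L2Mi => //; exact: L2J.
by apply: eq_cint => x _; rewrite big_distrl.
Qed.

Lemma L2norm_sqr f : L2norm f ^+ 2 = \int[mu]_(x in `[0, 1]) (cabs (f x) ^+ 2).
Proof. by rewrite /L2norm sqr_sqrtr//; apply: Rintegral_ge0 => x _; apply: sqr_ge0. Qed.
Lemma L2norm_ge0 f : 0 <= L2norm f. Proof. exact: sqrtr_ge0. Qed.
Lemma L2norm_dot f : L2 f -> L2dot f f = (L2norm f ^+ 2)%:C.
Proof.
move=> hf; rewrite L2norm_sqr; apply: complexP.
- by rewrite /L2dot Re_cint; apply: eq_rint => x _; rewrite sqr_cabs !cE; ring.
- rewrite /L2dot Im_cint Im_real (@eq_rint _ _ _ _ (fun=> 0)).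
    by rewrite (rint_cst 0 (@ler01 R)) mul0r.
  by move=> x _; rewrite !cE; ring.
Qed.

(** A quadratic polynomial in the real parameter [t]: its sign yields Cauchy-Schwarz, its value at 1
    the triangle inequality and its value at -1 Bessel's identity. *)
Lemma L2dotD_norm f g (t : R) : L2 f -> L2 g ->
  L2norm (fun x => f x + t%:C * g x) ^+ 2 =
  L2norm f ^+ 2 + t * (2 * Re (L2dot f g)) + t ^+ 2 * L2norm g ^+ 2.
Proof.
move=> hf hg; rewrite !L2norm_sqr.
have [i1 _] : cintegrable 0 1 (fun x => f x * (g x)^*) by apply: L2Mi => //; exact: L2J.
have i0 := L2_sqr hf; have i2 := L2_sqr hg.
have := rint_lin4 1 (t * 2) (t ^+ 2) 0 i0 i1 i2 i0.
rewrite Re_cint mul1r mul0r addr0 -mulrA => <-.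
by apply: eq_rint => x _; rewrite !sqr_cabs !cE; ring.
Qed.

Lemma discriminant_le (a b d : R) : 0 <= a -> 0 <= d ->
  (forall t, 0 <= a ^+ 2 + t * (2 * b) + t ^+ 2 * d ^+ 2) -> b <= a * d.
Proof.
move=> a0 d0 h; have [b0|b0] := leP b 0; first exact: le_trans b0 (mulr_ge0 a0 d0).
have [dE|dN] := eqVneq d 0.
  (* For [d] equal to 0 the polynomial is affine in t, and this t gives it the value -1. *)
  have := h (- (a ^+ 2 + 1) / (2 * b)).
  rewrite mulrAC mulfK ?mulf_neq0 ?pnatr_eq0 ?gt_eqF// dE expr0n/= !mulr0 addr0; lra.
have dp : 0 < d by rewrite lt_neqAle eq_sym dN.
(* The minimum of the polynomial. *)
have := h (- b / d ^+ 2).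
have -> : a ^+ 2 + - b / d ^+ 2 * (2 * b) + (- b / d ^+ 2) ^+ 2 * d ^+ 2 =
    a ^+ 2 - b ^+ 2 / d ^+ 2 by field.
rewrite subr_ge0 ler_pdivrMr ?exprn_gt0// -exprMn => h'.
by rewrite -(ler_pXn2r (ltn0Sn 1)) ?nnegrE ?mulr_ge0// ltW.
Qed.

Lemma L2norm_phase f k : cabs k = 1 -> L2 f -> L2norm (fun x => k * f x) = L2norm f.
Proof.
move=> k1 hf; rewrite /L2norm; congr Num.sqrt; apply: eq_rint => x _.
by rewrite cabsM k1 mul1r.
Qed.

Lemma Cauchy_Schwarz f g : L2 f -> L2 g -> cabs (L2dot f g) <= L2norm f * L2norm g.
Proof.
move=> hf hg; have [u u1 uE] := cabs_phase (L2dot f g).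
rewrite -[leLHS]Re_real uE -L2dotZl// -(L2norm_phase u1 hf).
apply: discriminant_le; do ?exact: L2norm_ge0.
by move=> t; rewrite -L2dotD_norm//; [exact: sqr_ge0|exact: L2Z].
Qed.

Lemma L2normZ k f : L2 f -> L2norm (fun x => k * f x) = cabs k * L2norm f.
Proof.
move=> hf; apply/eqP; rewrite -(eqrXn2 (n := 2)) ?mulr_ge0 ?L2norm_ge0 ?cabs_ge0//.
rewrite exprMn !L2norm_sqr -RintegralZl//; last exact: L2_sqr.
by apply/eqP/eq_rint => x _; rewrite cabsM exprMn.
Qed.

Lemma L2normN f : L2norm (fun x => - f x) = L2norm f.
Proof. by congr Num.sqrt; apply: eq_rint => x _; rewrite cabsN. Qed.

Lemma eq_L2norm f g : (forall x, 0 <= x <= 1 -> f x = g x) -> L2norm f = L2norm g.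
Proof. by move=> fg; congr Num.sqrt; apply: eq_rint => x x01; rewrite fg. Qed.

Lemma L2norm_triangle f g : L2 f -> L2 g ->
  L2norm (fun x => f x + g x) <= L2norm f + L2norm g.
Proof.
move=> hf hg; rewrite -(ler_pXn2r (ltn0Sn 1)) ?nnegrE ?addr_ge0 ?L2norm_ge0//.
have := @L2dotD_norm f g 1 hf hg.
rewrite (_ : (fun x => f x + 1%:C * g x) = fun x => f x + g x); last first.
  by apply/funext => x; rewrite mul1r.
move=> ->; have := le_trans (Re_le_cabs _) (Cauchy_Schwarz hf hg).
have -> : (L2norm f + L2norm g) ^+ 2 = L2norm f ^+ 2 + 2 * (L2norm f * L2norm g) + L2norm g ^+ 2.
  by ring.
rewrite expr1n !mul1r; lra.
Qed.

Lemma L2norm_triangleB f g : L2 f -> L2 g ->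
  L2norm (fun x => f x - g x) <= L2norm f + L2norm g.
Proof. by move=> hf hg; rewrite -(L2normN g); apply: L2norm_triangle => //; exact: L2N. Qed.

Lemma L2norm_dist f g : L2 f -> L2 g ->
  L2norm f <= L2norm g + L2norm (fun x => f x - g x).
Proof.
move=> hf hg; apply: le_trans (L2norm_triangle hg (L2B hf hg)).
by rewrite (@eq_L2norm f (fun x => g x + (f x - g x)))// => x _; rewrite subrKC.
Qed.

Lemma L2norm_distC f g : L2norm (fun x => f x - g x) = L2norm (fun x => g x - f x).
Proof. by congr Num.sqrt; apply: eq_rint => x _; rewrite -opprB cabsN. Qed.

Lemma L2norm_ae f g : L2 f -> L2 g -> ae01 (fun x => f x = g x) -> L2norm f = L2norm g.
Proof.
move=> hf hg fg; congr Num.sqrt; apply: rint_ae; do ?exact: L2_sqr.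
by apply: aeS fg => x; rewrite /I01 /= in_itv/= => h x01; rewrite h.
Qed.

Lemma L2norm_eq0 f : L2 f -> L2norm f = 0 -> ae01 (fun x => f x = 0).
Proof.
move=> hf h0; have : L2norm f ^+ 2 = 0 by rewrite h0 expr0n.
rewrite L2norm_sqr => hi.
have mf : measurable_fun (@I01 R) (fun x => (cabs (f x) ^+ 2)%:E).
  by apply/measurable_EFinP; apply: rintegrable_meas (L2_sqr hf).
have [+ _] := @ae_eq_integral_abs _ _ _ mu _ (measurable_itv _) _ mf.
have <- : (\int[mu]_(x in @I01 R) (cabs (f x) ^+ 2)%:E = 0)%E.
  by rewrite [LHS](EFin_rint (L2_sqr hf)) hi.
move=> /(_ (eq_integral _ _ _)) h.
have /h : {in @I01 R, (fun x => `|(cabs (f x) ^+ 2)%:E|%E) =1 (fun x => (cabs (f x) ^+ 2)%:E)}.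
  by move=> x _; rewrite /= ger0_norm ?sqr_ge0.
apply: aeS => x hx x01; have := hx x01; rewrite /= [RHS](EFin_rint (L2_sqr hf)) hi.
by move=> [] /eqP; rewrite expf_eq0/= => /eqP/cabs_eq0.
Qed.

Lemma L2norm_bound M f : 0 <= M -> L2 f ->
  (forall x, 0 <= x <= 1 -> cabs (f x) <= M) -> L2norm f <= M.
Proof.
move=> M0 hf fM; rewrite -(ler_pXn2r (ltn0Sn 1)) ?nnegrE ?L2norm_ge0// L2norm_sqr.
rewrite -[leRHS]mulr1 -[1 in leRHS](subr0 1) -rint_cst ?ler01//; apply: rint_le.
- exact: L2_sqr.
- exact: rintegrable_cst.
- by move=> x x01; rewrite lerXn2r ?nnegrE ?cabs_ge0 ?fM.
Qed.

(** Cauchy-Schwarz against the constant 1, whose norm on the unit interval is at most 1. *)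
Lemma L1_le_L2 f : L2 f -> \int[mu]_(x in `[0, 1]) cabs (f x) <= L2norm f.
Proof.
move=> hf.
have ha : L2 (fun x => (cabs (f x))%:C).
  apply/L2P; split => /=; last by split => //; apply: rintegrable_cst.
  by split; [exact: (meas_cabs (L2_meas hf))|exact: L2_sqr].
have := le_trans (Re_le_cabs _) (Cauchy_Schwarz ha (L2_cst 1)).
have -> : L2norm (fun x => (cabs (f x))%:C) = L2norm f.
  by congr Num.sqrt; apply: eq_rint => x _; rewrite cabs_real ger0_norm ?cabs_ge0.
have h1 : L2norm (fun _ : R => (1 : C)) <= 1.
  by apply: L2norm_bound => //; [exact: L2_cst|move=> x _; rewrite cabs1].
move=> h; apply: le_trans (le_trans _ h) _.
  rewrite /L2dot Re_cint le_eqVlt; apply/orP; left; apply/eqP/eq_rint => x _.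
  by rewrite !cE /= mulr1 mul0r subr0.
by rewrite -[leRHS]mulr1 ler_wpM2l ?L2norm_ge0.
Qed.

End SquareIntegrable.

(** * Completeness of L^2(0,1) *)

Section Completeness.
Context {R : realType}.
Notation C := R[i].
Notation mu := (@lebesgue_measure R).

Section real_completeness.
Variables (u : nat -> R -> R) (c : R).
Hypotheses (c0 : 0 < c) (hu : forall n, rL2 (u n)).
(** The exponent n + 1 makes the bounds sum up to [c]. *)
Let s n : R := c / (2 ^ n.+1)%:R.
Hypothesis cauchy : forall n m, (n <= m)%N ->
  \int[mu]_(x in `[0, 1]) ((u m x - u n x) ^+ 2) <= s n ^+ 2.

Let s_gt0 n : 0 < s n. Proof. by rewrite divr_gt0// ltr0n expn_gt0. Qed.

Let hd n m : rL2 (fun x => u m x - u n x).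
Proof.
have h1 := rL2D (hu m) (rL2Z (-1) (hu n)).
by rewrite (_ : (fun x => _) = fun x => u m x + -1 * u n x)//; apply/funext => x; rewrite mulN1r.
Qed.

Let g n x : R := `|u n.+1 x - u n x|.

Let gi n : rintegrable 0 1 (g n).
Proof. exact/rintegrable_norm/rL2_i/hd. Qed.

(** Young's inequality |d| <= d^2 / (2 s) + s / 2 with s = [s n]: integrated over the unit interval,
    both terms contribute at most s / 2. *)
Let g_le n : \int[mu]_(x in `[0, 1]) g n x <= s n.
Proof.
have i1 := (hd n n.+1).2; have i0 := @rintegrable_cst R 0 1 (s n).
apply: (@le_trans _ _ (\int[mu]_(x in `[0, 1])
    ((2 * s n)^-1 * (u n.+1 x - u n x) ^+ 2 + 2^-1 * s n))).
  apply: rint_le => //.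
    by apply: rintegrableD; apply: rintegrableZ.
  move=> x _; have := sqr_ge0 (`|u n.+1 x - u n x| - s n).
  rewrite -(ler_pM2l (_ : 0 < (2 * s n)^-1)) ?mulr0; last by rewrite invr_gt0 mulr_gt0.
  rewrite -[(u n.+1 x - u n x) ^+ 2]real_normK ?num_real// -/(g n x) => h.
  have sn : s n != 0 by rewrite gt_eqF.
  rewrite -subr_ge0 (_ : _ - _ = (2 * s n)^-1 * (g n x - s n) ^+ 2)//.
  by field.
rewrite RintegralD//; [|exact: rintegrableZ|exact: rintegrableZ].
rewrite [X in _ + X](rint_cst _ (@ler01 R)) RintegralZl// subr0 mulr1.
have h : (2 * s n)^-1 * \int[mu]_(x in `[0, 1]) ((u n.+1 x - u n x) ^+ 2) <= 2^-1 * s n.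
  apply: le_trans (_ : (2 * s n)^-1 * s n ^+ 2 <= _).
    by apply: ler_wpM2l; [rewrite invr_ge0 mulr_ge0// ltW|exact: cauchy].
  have sn : s n != 0 by rewrite gt_eqF.
  by rewrite le_eqVlt; apply/orP; left; apply/eqP; field.
apply: le_trans (lerD h (lexx _)) _; lra.
Qed.

Let mI01 : measurable (@I01 R). Proof. exact: measurable_itv. Qed.

Let S x : \bar R := (\sum_(n <oo) (g n x)%:E)%E.

(** Monotone convergence: the integral of [S] is at most the sum of the [s n], hence finite. *)
Let S_ae : {ae mu, forall x, 0 <= x <= 1 -> (S x < +oo)%E}.
Proof.
have mg n : measurable_fun (@I01 R) (fun x => (g n x)%:E).
  by apply/measurable_EFinP; apply: rintegrable_meas.
have iS : mu.-integrable (@I01 R) S.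
  apply/integrableP; split.
    rewrite /S; apply: (@ge0_emeasurable_sum _ _ R (@I01 R) _ xpredT) => //.
    by move=> n x _ _; rewrite lee_fin normr_ge0.
  under eq_integral.
    move=> x _; rewrite gee0_abs; last by apply: nneseries_ge0 => n _ _; exact: normr_ge0.
    over.
  rewrite integral_nneseries//; last by move=> n x _; rewrite lee_fin normr_ge0.
  apply: (@le_lt_trans _ _ c%:E); last exact: ltry.
  apply: le_trans (epsilon_trick0 xpredT (ltW c0)); apply: lee_nneseries => n _.
    by move=> _; apply: integral_ge0 => x _; rewrite lee_fin normr_ge0.
  by rewrite (EFin_rint (gi n)) lee_fin g_le.
have : {ae mu, forall x, @I01 R x -> S x \is a fin_num} by apply: integrable_ae iS.
apply: aeS => x h x01; have := h; rewrite /I01 /= in_itv/= => /(_ x01).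
by move/fin_numPlt/andP => [].
Qed.

(** [S x] is the sum of the absolute increments, so the telescoping series converges absolutely. *)
Let cvg_u x : (S x < +oo)%E -> cvgn (u ^~ x).
Proof.
move=> Soo.
have gc : cvgn [normed series (telescope (u ^~ x))].
  apply: nondecreasing_is_cvgn.
    by apply: nondecreasing_series => n _ _; exact: normr_ge0.
  exists (fine (S x)) => _ [n _ <-].
  rewrite -lee_fin fineK; last first.
    rewrite ge0_fin_numE//; apply: nneseries_ge0 => k _ _; exact: normr_ge0.
  rewrite /series/= -sumEFin.
  by apply: nneseries_lim_ge => k _ _; exact: normr_ge0.
have /cvg_ex[l hl] := normed_cvg gc.
apply/cvg_ex; exists (u 0%N x + l).
have uE : u ^~ x = (fun n => u 0%N x + series (telescope (u ^~ x)) n).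
  by apply/funext => n; rewrite (eq_sum_telescope (u ^~ x) n).
by rewrite uE; apply: cvgD; [exact: cvg_cst|exact: hl].
Qed.

(** Riesz-Fischer: the sequence converges where [S] is finite, and Fatou's lemma hands the Cauchy
    bound over to the limit with the same constant. *)
Lemma rL2_complete : exists2 w, rL2 w &
  forall n, \int[mu]_(x in `[0, 1]) ((w x - u n x) ^+ 2) <= s n ^+ 2.
Proof.
(* The upper limit is measurable on the whole interval, also at the points where the sequence
   diverges. *)
pose w x := fine (limn_esup (fun n => (u n x)%:E)).
have mw : measurable_fun (@I01 R) w.
  apply: measurableT_comp => //; apply: measurable_fun_limn_esup => n.
  by apply/measurable_EFinP; case: (hu n).
have uw : {ae mu, forall x, 0 <= x <= 1 -> u n x @[n --> \oo] --> w x}.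
  apply: aeS S_ae => x h x01; have /cvg_ex[l ul] := cvg_u (h x01).
  have -> : w x = l => //.
  have ulE : (fun n => (u n x)%:E) @ \oo --> l%:E by exact: (cvg_comp _ _ ul).
  by rewrite /w (cvg_limn_einf_sup ulE).
have key n : (\int[mu]_(x in @I01 R) ((w x - u n x) ^+ 2)%:E <= (s n ^+ 2)%:E)%E.
  pose F k x : \bar R := ((u k x - u n x) ^+ 2)%:E.
  have mF k : measurable_fun (@I01 R) (F k).
    by apply/measurable_EFinP; apply: rintegrable_meas (hd n k).2.
  have F0 k x : @I01 R x -> (0 <= F k x)%E.
    by move=> _; rewrite lee_fin sqr_ge0.
  have mw2 : measurable_fun (@I01 R) (fun x => ((w x - u n x) ^+ 2)%:E).
    apply/measurable_EFinP; apply: measurable_funX; apply: measurable_funB => //.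
    by case: (hu n).
  have mlim : measurable_fun (@I01 R) (fun x => limn_einf (F ^~ x)).
    by rewrite /limn_einf; apply: measurableT_comp => //; apply: measurable_fun_limn_esup => k; apply: measurableT_comp.
  rewrite (@ae_eq_integral _ _ _ mu _ (fun x => limn_einf (F ^~ x)))//; last first.
    apply: aeS uw => x h; rewrite /I01/= in_itv/= => /h ux.
    have h2 : (fun k => (u k x - u n x) ^+ 2) @ \oo --> (w x - u n x) ^+ 2.
      by apply: cvgM; apply: cvgB => //; exact: cvg_cst.
    have h3 : F ^~ x @ \oo --> ((w x - u n x) ^+ 2)%:E by exact: (cvg_comp _ _ h2).
    by rewrite (cvg_limn_einf_sup h3).
  apply: le_trans (fatou mu _ mF F0) _ => //.
  rewrite limn_einf_lim; apply: lime_le; first exact: is_cvg_einfs.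
  apply: nearW => m; apply: ereal_inf_le.
  (* An index beyond both [m] and [n]: it belongs to the tail over which the infimum is taken, and
     the Cauchy bound at [n] covers it. *)
  exists (\int[mu]_(x in @I01 R) F (maxn n m) x)%E.
    by exists (maxn n m) => //=; exact: leq_maxr.
  by rewrite [X in (X <= _)%E](EFin_rint (hd n (maxn n m)).2) lee_fin cauchy// leq_maxl.
have i2 n : rintegrable 0 1 (fun x => (w x - u n x) ^+ 2).
  apply/integrableP; split.
    apply/measurable_EFinP; apply: measurable_funX; apply: measurable_funB => //.
    by case: (hu n).
  apply: (@le_lt_trans _ _ (s n ^+ 2)%:E); last exact: ltry.
  apply: le_trans (key n); rewrite le_eqVlt; apply/orP; left; apply/eqP.
  by apply: eq_integral => x _; rewrite /= ger0_norm ?sqr_ge0.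
exists w; last by move=> n; rewrite -lee_fin -(EFin_rint (i2 n)); exact: key.
have h1 : rL2 (fun x => w x - u 0%N x).
  split => //; apply: measurable_funB => //; by case: (hu 0%N).
have := rL2D h1 (hu 0%N).
by rewrite (_ : (fun x => _) = w)//; apply/funext => x; rewrite subrK.
Qed.
End real_completeness.

(** Real and imaginary parts are completed separately; their squared errors add up to at most 2 s^2,
    which the factor 2 in front of the bound absorbs. *)
Lemma L2_geometric_limit (f : nat -> R -> C) (c : R) : 0 < c -> (forall n, L2 (f n)) ->
  (forall n m, (n <= m)%N -> L2norm (fun x => f m x - f n x) <= c / (2 ^ n.+1)%:R) ->
  exists2 g, L2 g & forall n, L2norm (fun x => g x - f n x) <= 2 * (c / (2 ^ n.+1)%:R).
Proof.
move=> c0 hf cau.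
have s0 n : 0 <= c / (2 ^ n.+1)%:R by rewrite divr_ge0// ltW.
have part (p : C -> R) : (forall k, `|p k| <= cabs k) ->
    (forall x y, p (x - y) = p x - p y) -> (forall n, rL2 (fun x => p (f n x))) ->
    exists2 w, rL2 w & forall n,
    \int[mu]_(x in `[0, 1]) ((w x - p (f n x)) ^+ 2) <= (c / (2 ^ n.+1)%:R) ^+ 2.
  move=> pc pB hp; apply: rL2_complete => // n m nm.
  apply: (@le_trans _ _ (L2norm (fun x => f m x - f n x) ^+ 2)); last first.
    by rewrite lerXn2r ?nnegrE ?L2norm_ge0 ?cau.
  rewrite L2norm_sqr; apply: rint_le.
  - have := (rL2D (hp m) (rL2Z (-1) (hp n))).2; apply: rintegrable_ext => x _.
    by rewrite mulN1r.
  - exact: L2_sqr (L2B (hf m) (hf n)).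
  - move=> x _; rewrite -pB -[X in X <= _]real_normK ?num_real//.
    by rewrite lerXn2r ?nnegrE ?cabs_ge0.
have [wr hr br] := part (@complex.Re R) (@normr_Re R) (fun x y => etrans (ReD _ _) (congr1 _ (ReN _)))
  (fun n => proj1 (proj1 (L2P (f n)) (hf n))).
have [wi hi bi] := part (@complex.Im R) (@normr_Im R) (fun x y => etrans (ImD _ _) (congr1 _ (ImN _)))
  (fun n => proj2 (proj1 (L2P (f n)) (hf n))).
exists (fun x => wr x +i* wi x); first by apply/L2P.
move=> n; have h2 : 0 <= 2 * (c / (2 ^ n.+1)%:R) by apply: mulr_ge0.
rewrite -(ler_pXn2r (ltn0Sn 1)) ?nnegrE ?L2norm_ge0//.
have [hr' hi'] : rL2 (fun x => wr x - Re (f n x)) /\ rL2 (fun x => wi x - Im (f n x)).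
  have /L2P[fr fi] := hf n; split.
    have := rL2D hr (rL2Z (-1) fr); by under eq_fun do rewrite mulN1r.
  have := rL2D hi (rL2Z (-1) fi); by under eq_fun do rewrite mulN1r.
rewrite L2norm_sqr (@eq_rint _ _ _ _ (fun x => (wr x - Re (f n x)) ^+ 2 + (wi x - Im (f n x)) ^+ 2)).
  rewrite RintegralD//; [|exact: hr'.2|exact: hi'.2].
  apply: le_trans (lerD (br n) (bi n)) _.
  move: (c / (2 ^ n.+1)%:R) => t; have -> : (2 * t) ^+ 2 = 4 * t ^+ 2 by ring.
  have := sqr_ge0 t; lra.
by move=> x _; rewrite sqr_cabs !cE.
Qed.

Lemma L2_complete (f : nat -> R -> C) : (forall n, L2 (f n)) ->
  (forall e : R, 0 < e -> exists N, forall n m, (N <= n)%N -> (n <= m)%N ->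
    L2norm (fun x => f m x - f n x) <= e) ->
  exists2 g, L2 g & forall e : R, 0 < e -> exists N, forall n, (N <= n)%N ->
    L2norm (fun x => g x - f n x) <= e.
Proof.
move=> hf cau.
have s0 k : 0 < (1 / (2 ^ k.+1)%:R : R) by rewrite divr_gt0// ltr0n expn_gt0.
have [N hN] := choice (fun k => cau _ (s0 k)).
(* Partial sums of the thresholds [N]: nondecreasing in [k] and at least [N k], so [f \o K] is a
   subsequence with geometric increments. *)
pose K k := (\sum_(i < k.+1) N i)%N.
have NK k : (N k <= K k)%N by rewrite /K (bigD1 ord_max)//= leq_addr.
have Kmono k l : (k <= l)%N -> (K k <= K l)%N.
  move=> kl; rewrite /K -!(big_mkord xpredT N) (@big_cat_nat _ _ _ k.+1 0 l.+1)//= leq_addr//.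
have [g hg bg] := @L2_geometric_limit (f \o K) 1 ltr01 (fun n => hf (K n))
  (fun n m nm => hN n (K n) (K m) (NK n) (Kmono n m nm)).
exists g => // e e0.
(* Three units of error: two from the limit to [f (K k)], one from there to [f n]. *)
have [k /= ke] : exists k, 3 * (1 / (2 ^ k.+1)%:R) <= e.
  have [k] := ltr_add_invr (y := 0) (x := e / 3) (divr_gt0 e0 (ltr0n _ 3)).
  rewrite add0r => ke; exists k; rewrite mulrC -ler_pdivlMr// (le_trans _ (ltW ke))//.
  by rewrite div1r lef_pV2 ?posrE ?ltr0n ?expn_gt0// ler_nat ltnW// ltn_expl.
exists (K k) => n nK.
have h3 := lerD (bg k) (hN k (K k) n (NK k) nK).
apply: le_trans (_ : _ <= 2 * (1 / (2 ^ k.+1)%:R) + 1 / (2 ^ k.+1)%:R) _; last by lra.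
apply: le_trans h3.
rewrite [X in _ + X]L2norm_distC.
apply: le_trans (L2norm_triangle (L2B hg (hf _)) (L2B (hf _) (hf _))).
by rewrite le_eqVlt; apply/orP; left; apply/eqP/eq_L2norm => x _ /=; ring.
Qed.
End Completeness.

(** * Cosine series *)

Section CosineCompleteness.
Context {R : realType}.
Notation mu := (@lebesgue_measure R).
Implicit Types (u g : R -> R) (a b c x : R) (j n : nat).

(** Lebesgue's differentiation theorem: the primitive is identically zero, and its derivative is [u]
    almost everywhere. *)
Lemma rint_zero_ae u : rintegrable 0 1 u ->
  (forall x, 0 <= x <= 1 -> \int[mu]_(y in `[0, x]) u y = 0) ->
  {ae mu, forall x, 0 <= x <= 1 -> u x = 0}.
Proof.
move=> iu hu; pose v := u \_ `[0, 1].
have iv (A : set R) : measurable A -> mu.-integrable A (EFin \o v).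
  move=> mA; apply: (@integrableS _ _ _ mu setT) => //.
  by rewrite /v -restrict_EFin; apply/integrable_restrict => //; rewrite setTI.
have lv : locally_integrable [set: R] v by apply: integrable_locally.
have F0 x : \int[mu]_(y in `[0, x]) v y = 0.
  have [x0|x0] := leP 0 x; last first.
    by rewrite set_itv_ge ?Rintegral_set0// -leNgt bnd_simp.
  rewrite /v -Rintegral_mkcondr -(_ : `[0, Num.min x 1]%classic = `[0, x]%classic `&` `[0, 1]%classic).
    by apply: hu; rewrite le_min x0 ler01/= ge_min lexx orbT.
  apply/seteqP; split=> y /=; rewrite !in_itv/= le_min.
    by move=> /and3P[-> -> ->].
  by move=> [/andP[-> ->] /andP[_ ->]].
have := @FTC1 R v (BLeft 0) (fun y => iv _ (measurable_itv _)) lv.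
move=> h; have := ae_and h (ae_neq (0 : R)); apply: aeS => x [hx x0] /andP[x0' x1].
have [|_] := hx; first by rewrite lte_fin lt_neqAle eq_sym x0.
rewrite (_ : (fun _ => _) = cst 0); last by apply/funext => y; exact: F0.
by rewrite derive1_cst => ->; rewrite /v patchE mem_set//= in_itv/= x0' x1.
Qed.

(** Dominated convergence in the form that carries orthogonality over to a pointwise limit. *)
Lemma dominated_zero (f : nat -> R -> R) u g a b :
  (forall n, measurable_fun `[a, b] (f n)) -> measurable_fun `[a, b] u ->
  rintegrable a b g ->
  {ae mu, forall x, a <= x <= b -> f n x @[n --> \oo] --> u x} ->
  (forall n x, a <= x <= b -> `|f n x| <= g x) ->
  (forall n, \int[mu]_(x in `[a, b]) f n x = 0) -> \int[mu]_(x in `[a, b]) u x = 0.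
Proof.
move=> mf mu_ ig fu fg f0.
have mI : measurable `[a, b] by exact: measurable_itv.
have := @dominated_convergence _ _ R mu `[a, b]%classic _ (fun n => EFin \o f n) (EFin \o u) (EFin \o g).
case=> //.
- by move=> n; apply/measurable_EFinP; exact: mf.
- by apply/measurable_EFinP; exact: mu_.
- apply: aeS fu => x h; rewrite /= in_itv/= => xab.
  exact: (cvg_comp _ _ (h xab)).
- by apply: ae_all => x n; rewrite /= in_itv/= => xab; rewrite lee_fin fg.
move=> iu _ cv; rewrite /Rintegral.
have fi n : rintegrable a b (f n) by apply: rintegrable_dom ig _ => // x; exact: fg.
have e : (fun n => \int[mu]_(x in `[a, b]) (EFin \o f n) x)%E = (fun=> 0%E).
  by apply/funext => n; rewrite [LHS](EFin_rint (fi n)) f0.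
have /cvg_lim <- // := cv.
rewrite e; suff -> : limn (fun=> 0%E : \bar R) = 0%E by [].
by apply/cvg_lim => //; exact: cvg_cst.
Qed.

Lemma bernoulli_le (t : R) n : 0 <= t -> t <= 1 -> 1 - n%:R * t <= (1 - t) ^+ n.
Proof.
move=> t0 t1; elim: n => [|n ih]; first by rewrite expr0 mul0r subr0.
rewrite exprS; have h : (1 - t) * (1 - n%:R * t) <= (1 - t) * (1 - t) ^+ n.
  by rewrite ler_wpM2l// subr_ge0.
apply: le_trans h; rewrite -natr1; have := sqr_ge0 t; have := ler0n R n; nra.
Qed.

(** The inductive form is (1 + n t) (1 - t)^n <= 1, where each step multiplies by (1 - t) and
    discards a negative square. *)
Lemma bernoulli_ge (t : R) n : 0 <= t -> t <= 1 -> n%:R * t * (1 - t) ^+ n <= 1.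
Proof.
move=> t0 t1.
have h : forall m, (1 + m%:R * t) * (1 - t) ^+ m <= 1.
  elim=> [|m ih]; first by rewrite expr0 mul0r addr0 mulr1.
  apply: le_trans ih; rewrite exprS mulrA ler_wpM2r ?exprn_ge0 ?subr_ge0//.
  rewrite -natr1; have := sqr_ge0 t; have := ler0n R m; nra.
apply: le_trans (h n); rewrite ler_wpM2r ?exprn_ge0 ?subr_ge0//; lra.
Qed.

(* With [v] affine in [cos (pi x)], these polynomials tend boundedly to the indicator of
   an interval, so that a function orthogonal to all cosines has vanishing integrals. *)
Lemma step_approx (v : R) : 0 <= v <= 1 -> v != 2^-1 ->
  (1 - v ^+ n) ^+ (2 ^ n) @[n --> \oo] --> (if v < 2^-1 then 1 else 0 : R).
Proof.
move=> /andP[v0 v1] vh.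
have vn0 n : 0 <= v ^+ n by apply: exprn_ge0.
have vn1 n : v ^+ n <= 1 by apply: exprn_ile1.
have q1 n : (1 - v ^+ n) ^+ (2 ^ n) <= 1.
  by apply: exprn_ile1; rewrite ?subr_ge0// lerBlDr lerDl.
have q0 n : 0 <= (1 - v ^+ n) ^+ (2 ^ n) by rewrite exprn_ge0// subr_ge0.
case: ltP => hv.
  (* Bernoulli's inequality with exponent 2^n bounds the power below by 1 - 2^n v^n. *)
  apply: (@squeeze_cvgr _ _ _ _ (fun n => 1 - (2 * v) ^+ n) (fun=> 1)).
  - apply: nearW => n; rewrite q1 andbT.
    by have := bernoulli_le (2 ^ n) (vn0 n) (vn1 n); rewrite natrX -exprMn.
  - rewrite -[X in _ --> X]subr0; apply: cvgB; first exact: cvg_cst.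
    by apply: cvg_expr; rewrite ger0_norm ?mulr_ge0//; lra.
  - exact: cvg_cst.
have {}hv : 2^-1 < v by rewrite lt_neqAle eq_sym vh.
(* Here [bernoulli_ge] with exponent 2^n bounds the power above by 1 / (2^n v^n). *)
apply: (@squeeze_cvgr _ _ _ _ (fun=> 0) (fun n => (2 * v)^-1 ^+ n)).
- apply: nearW => n; rewrite q0/=.
  have := bernoulli_ge (2 ^ n) (vn0 n) (vn1 n); rewrite natrX -exprMn => h.
  by rewrite exprVn -[leRHS]mul1r ler_pdivlMr ?exprn_gt0 ?mulr_gt0//; [rewrite mulrC|lra].
- exact: cvg_cst.
- apply: cvg_expr; rewrite normfV ger0_norm ?mulr_ge0// invf_lt1; lra.
Qed.

End CosineCompleteness.

Section CosineUniqueness.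
Context {R : realType}.
Notation mu := (@lebesgue_measure R).
Implicit Types (u g : R -> R) (a b c x : R) (j n : nat).

Definition cosn j x : R := cos (j%:R * (pi * x)).

Lemma continuous_cosn j : continuous (cosn j).
Proof.
move=> x; apply: (@continuous_comp _ _ _ (fun y => j%:R * (pi * y)) cos).
  by apply: continuousM; [exact: cvg_cst|apply: continuousM; [exact: cvg_cst|exact: cvg_id]].
exact: continuous_cos.
Qed.

Lemma measurable_cosn j (D : set R) : measurable_fun D (cosn j).
Proof. by apply: measurable_funTS; apply: continuous_measurable_fun; apply: continuous_cosn. Qed.

Lemma normr_cosn j x : `|cosn j x| <= 1.
Proof. by rewrite ler_norml cos_geN1 cos_le1. Qed.

Lemma cosn_mul j x : cosn 1 x * cosn j.+1 x = 2^-1 * (cosn j.+2 x + cosn j x).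
Proof.
rewrite /cosn mul1r.
have -> : j.+2%:R * (pi * x) = j.+1%:R * (pi * x) + pi * x by rewrite -[j.+2%:R]natr1; ring.
have -> : j%:R * (pi * x) = j.+1%:R * (pi * x) - pi * x by rewrite -[j.+1%:R]natr1; ring.
by rewrite cosD cosB; field.
Qed.

Lemma cosn0 x : cosn 0 x = 1. Proof. by rewrite /cosn mul0r cos0. Qed.

Section uniqueness.
Variable u : R -> R.
Hypothesis iu : rintegrable 0 1 u.
Hypothesis u0 : forall j, \int[mu]_(x in `[0, 1]) (u x * cosn j x) = 0.

(** Bounded multipliers g for which u g is still orthogonal to every cosine. They form a linear
    space stable under multiplication by cos(pi x), so they contain all polynomials in cos(pi x). *)
Let ann g := [/\ measurable_fun (@I01 R) g, exists M, forall x, 0 <= x <= 1 -> `|g x| <= M &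
  forall j, \int[mu]_(x in `[0, 1]) (u x * (g x * cosn j x)) = 0].

Let ann_int g j : ann g -> rintegrable 0 1 (fun x => u x * (g x * cosn j x)).
Proof.
move=> [mg [M gM] _].
have mgc : measurable_fun (@I01 R) (fun x => g x * cosn j x).
  by apply: measurable_funM => //; apply: measurable_cosn.
have bgc x : 0 <= x <= 1 -> `|g x * cosn j x| <= M.
  move=> x01; rewrite normrM -[leRHS]mulr1; apply: ler_pM => //; first exact: gM.
  exact: normr_cosn.
by apply: (rintegrable_ext _ (rintegrable_bM mgc bgc iu)) => x _; rewrite mulrC.
Qed.

Let ann1 : ann (fun=> 1).
Proof.
split => //; first by exists 1 => x _; rewrite normr1.
by move=> j; rewrite -[RHS](u0 j); apply: eq_rint => x _; rewrite mul1r.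
Qed.

Let annZD c d g h : ann g -> ann h -> ann (fun x => c * g x + d * h x).
Proof.
move=> ag ah; have [mg [M gM] g0] := ag; have [mh [N hN] h0] := ah; split.
- by apply: measurable_funD; apply: measurable_funM.
- exists (`|c| * M + `|d| * N) => x x01; apply: le_trans (ler_normD _ _) _.
  by rewrite !normrM lerD// ler_wpM2l// ?gM ?hN.
- move=> j; have := rint_lin4 c d 0 0 (ann_int j ag) (ann_int j ah) (ann_int j ah) (ann_int j ah).
  rewrite g0 h0 !mulr0 !addr0 => hh; rewrite -[RHS]hh; apply: eq_rint => x _; ring.
Qed.

Let ann_cos g : ann g -> ann (fun x => cosn 1 x * g x).
Proof.
move=> ag; have [mg [M gM] g0] := ag; split.
- by apply: measurable_funM => //; apply: measurable_cosn.
- exists M => x x01; rewrite normrM -[leRHS]mul1r; apply: ler_pM => //; last exact: gM.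
  exact: normr_cosn.
- case=> [|j].
    rewrite -[RHS](g0 1%N); apply: eq_rint => x _; rewrite cosn0; ring.
  have := rint_lin4 2^-1 2^-1 0 0 (ann_int j.+2 ag) (ann_int j ag) (ann_int j ag) (ann_int j ag).
  rewrite !g0 !mulr0 !addr0 => hh; rewrite -[RHS]hh; apply: eq_rint => x _.
  by rewrite [cosn 1 x * _]mulrC -[g x * _ * _]mulrA cosn_mul; ring.
Qed.

Lemma ann_ext g h : ann g -> g =1 h -> ann h.
Proof. by move=> ag /funext <-. Qed.

(** It suffices that every primitive value, the integral of [u] over [0, b], is zero. The integral
    over [0, 1] vanishes by the cosine of index 0, so the integral over [b, 1] may be treated
    instead; it is a limit of integrals of [u] against polynomials in cos(pi x). *)
Lemma cosine_uniqueness : {ae mu, forall x, 0 <= x <= 1 -> u x = 0}.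
Proof.
apply: rint_zero_ae => // b /andP[b0 b1].
have tot : \int[mu]_(x in `[0, 1]) u x = 0.
  by rewrite -[RHS](u0 0); apply: eq_rint => x _; rewrite cosn0 mulr1.
have [->|b1'] := eqVneq b 1 => //.
have {b1 b1'} b1 : b < 1 by rewrite lt_neqAle b1'.
have := rint_chasles b0 (ltW b1) iu; rewrite tot => /esym/eqP.
rewrite addr_eq0 => /eqP ->; apply/eqP; rewrite oppr_eq0; apply/eqP.
(* Strictly decreasing on [0, 1], equal to 1/2 exactly at [b]; the division by 4 keeps its values in
   [0, 1]. Hence the limit in [step_approx] is the indicator of x > b. *)
pose v x : R := 2^-1 + (cosn 1 x - cosn 1 b) / 4.
have v01 x : 0 <= v x <= 1.
  have := normr_cosn 1 x; have := normr_cosn 1 b; rewrite !ler_norml /v.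
  by move=> /andP[? ?] /andP[? ?]; apply/andP; split; lra.
have annv g : ann g -> ann (fun x => v x * g x).
  move=> ag; have := annZD (4^-1) (2^-1 - cosn 1 b / 4) (ann_cos ag) ag.
  by move/ann_ext; apply => x; rewrite /v; field.
have annvn n g : ann g -> ann (fun x => v x ^+ n * g x).
  elim: n => [|n ih] ag; first by apply: (ann_ext ag) => x; rewrite expr0 mul1r.
  by apply: (ann_ext (annv _ (ih ag))) => x; rewrite exprS mulrA.
have annq n m : ann (fun x => (1 - v x ^+ n) ^+ m).
  elim: m => [|m ih]; first by apply: (ann_ext ann1) => x; rewrite expr0.
  by apply: (ann_ext (annZD 1 (-1) ih (annvn n _ ih))) => x; rewrite exprS; ring.
have pib y : 0 <= y <= 1 -> pi * y \in `[0, (pi : R)].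
  by move=> /andP[y0 y1]; rewrite in_itv/= mulr_ge0 ?pi_ge0//= ger_pMr ?pi_gt0.
have vlt x : 0 <= x <= 1 -> (v x < 2^-1) = (b < x).
  move=> x01; rewrite /v -ltrBrDl subrr pmulr_llt0 ?invr_gt0// subr_lt0 /cosn !mul1r.
  have b01 : 0 <= b <= 1 by rewrite b0 ltW.
  rewrite (ltr_cos (pib _ b01) (pib _ x01)).
  by rewrite ltr_pM2l// pi_gt0.
have vne x : 0 <= x <= 1 -> x != b -> v x != 2^-1.
  move=> x01 xb; rewrite /v -subr_eq0 addrC addKr mulf_eq0 invr_eq0 pnatr_eq0 orbF.
  rewrite subr_eq0 /cosn !mul1r; apply: contra_neq xb => /cos_inj h.
  have : pi * x = pi * b by apply: h; apply: pib => //; rewrite b0 ltW.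
  by apply: mulfI; rewrite gt_eqF ?pi_gt0.
have mu_ := rintegrable_meas iu.
have msel : measurable_fun (@I01 R) (fun x => if b <= x then u x else 0).
  apply: (eq_measurable_fun (fun x => u x * (if b <= x then 1 else 0))).
    by move=> x _; case: ifP; rewrite ?mulr1 ?mulr0.
  apply: measurable_funM => //; apply: measurable_funTS.
  by apply: measurable_fun_ifT => //; apply: measurable_fun_ler.
have sel0 : \int[mu]_(x in `[0, 1]) (if b <= x then u x else 0) = 0.
  apply: (@dominated_zero _ (fun n x => u x * ((1 - v x ^+ n) ^+ (2 ^ n) * cosn 0 x)) _ (fun x => `|u x|)).
  - by move=> n; apply: rintegrable_meas; apply: ann_int.
  - exact: msel.
  - exact: rintegrable_norm.
  - apply: aeS (ae_neq b) => x xb x01.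
    under eq_fun do rewrite cosn0 mulr1.
    have := step_approx (v01 x) (vne x x01 xb); rewrite vlt// => h.
    have -> : (if b <= x then u x else 0) = u x * (if b < x then 1 else 0).
      by rewrite le_eqVlt eq_sym (negbTE xb)/=; case: (b < x); rewrite ?mulr1 ?mulr0.
    by apply: cvgM => //; exact: cvg_cst.
  - move=> n x x01; rewrite cosn0 mulr1 normrM -[leRHS]mulr1 ler_wpM2l//.
    have /andP[v0 v1] := v01 x.
    have h1 : 0 <= 1 - v x ^+ n by rewrite subr_ge0 exprn_ile1.
    by rewrite ger0_norm ?exprn_ge0// exprn_ile1// lerBlDr lerDl exprn_ge0.
  - by move=> n; have [_ _] := annq n (2 ^ n)%N.
have isel : rintegrable 0 1 (fun x => if b <= x then u x else 0).
  apply: (rintegrable_dom msel (rintegrable_norm iu)) => x _.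
  by case: ifP => //; rewrite normr0.
move: sel0; rewrite (rint_chasles b0 (ltW b1) isel).
rewrite [X in X + _](_ : _ = 0) ?add0r; last first.
  rewrite (@rint_ae _ _ _ _ (fun=> 0)) ?rint_cst ?mul0r//.
  - exact: rintegrableS (ltW b1) isel.
  - exact: rintegrable_cst.
  - apply: aeS (ae_neq b) => x xb /andP[_ xb'].
    by rewrite leNgt lt_neqAle xb xb'.
by move=> <-; apply: eq_rint => x /andP[-> _].
Qed.
End uniqueness.

End CosineUniqueness.

(** * The orthonormal cosines as Neumann eigenfunctions *)

Section CosineBasis.
Context {R : realType}.
Notation C := R[i].
Notation mu := (@lebesgue_measure R).
Implicit Types (f g F G : R -> C) (a b c x : R) (j n N : nat).

Definition sinn j x : R := sin (j%:R * (pi * x)).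

Lemma continuous_sinn j : continuous (sinn j).
Proof.
move=> x; apply: (@continuous_comp _ _ _ (fun y => j%:R * (pi * y)) sin).
  by apply: continuousM; [exact: cvg_cst|apply: continuousM; [exact: cvg_cst|exact: cvg_id]].
exact: continuous_sin.
Qed.

Lemma is_derive_cosn j x : is_derive x 1 (cosn j) (- (j%:R * pi) * sinn j x).
Proof.
have h : is_derive x 1 (fun y => j%:R * (pi * y)) (j%:R * pi).
  by apply: is_derive_eq; rewrite /GRing.scale/= mulr1 ?mulr0 ?addr0.
have := @is_derive1_comp R cos (fun y => j%:R * (pi * y)) x _ _ (is_derive_cos _) h.
rewrite /sinn (_ : - sin _ * _ = - (j%:R * pi) * sin (j%:R * (pi * x)))//; ring.
Qed.

Lemma is_derive_sinn j x : is_derive x 1 (sinn j) (j%:R * pi * cosn j x).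
Proof.
have h : is_derive x 1 (fun y => j%:R * (pi * y)) (j%:R * pi).
  by apply: is_derive_eq; rewrite /GRing.scale/= mulr1 ?mulr0 ?addr0.
have := @is_derive1_comp R sin (fun y => j%:R * (pi * y)) x _ _ (is_derive_sin _) h.
by rewrite /cosn (_ : cos _ * _ = j%:R * pi * cos (j%:R * (pi * x)))//; ring.
Qed.

Lemma AC_real a b (u v : R -> R) : a <= b -> continuous u -> continuous v ->
  (forall x, is_derive x 1 v (u x)) -> AC a b (fun x => (v x)%:C) (fun x => (u x)%:C).
Proof.
move=> ab cu cv dv; apply: FTC_AC => //.
- by split; [exact: continuous_subspaceT|apply: continuous_subspaceT => x; exact: cvg_cst].
- by split; [exact: continuous_subspaceT|apply: continuous_subspaceT => x; exact: cvg_cst].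
- by move=> x _; split; [exact: dv|exact: is_derive_cst].
Qed.

Lemma AC_by_parts2 a b F F1 F2 G G1 G2 : a <= b -> AC a b F F1 -> AC a b F1 F2 ->
  AC a b G G1 -> AC a b G1 G2 ->
  cint (fun x => F2 x * G x) a b =
  F1 b * G b - F1 a * G a - (F b * G1 b - F a * G1 a) + cint (fun x => F x * G2 x) a b.
Proof.
move=> ab F0A F1A G0A G1A.
have i1 : cintegrable a b (fun x => F2 x * G x).
  by case: F1A => fi _; apply: (cintegrable_ext _ (AC_integrableM G0A fi)) => x _; rewrite mulrC.
have i2 := AC_integrableM F1A (AC_integrable G1A).
have i3 := AC_integrableM F0A G1A.1.
have := AC_by_parts ab F1A G0A; rewrite (cintD i1 i2).
have := AC_by_parts ab F0A G1A; rewrite (cintD i2 i3).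
by move=> -> ->; ring.
Qed.

(** Normalisation: the square of a nonconstant cosine has mean 1/2. *)
Definition wcos j : R := if j == 0%N then 1 else Num.sqrt 2.

Lemma wcos_gt0 j : 0 < wcos j.
Proof. by rewrite /wcos; case: eqP => // _; rewrite sqrtr_gt0. Qed.

Definition phi j x : C := (wcos j * cosn j x)%:C.
Definition phi1 j x : C := (wcos j * (- (j%:R * pi) * sinn j x))%:C.
(** The Neumann eigenvalue of -f'' on [phi j], that is, the square of the frequency j pi. *)
Definition freq j : R := (j%:R * pi) ^+ 2.

Lemma AC_phi j : AC 0 1 (phi j) (phi1 j).
Proof.
apply: AC_real => //.
- move=> x; apply: cvgM; first exact: cvg_cst.
  by apply: cvgM; [exact: cvg_cst|exact: continuous_sinn].
- by move=> x; apply: cvgM; [exact: cvg_cst|exact: continuous_cosn].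
- move=> x; have h := is_derive_cosn j x.
  by apply: is_derive_eq; rewrite /GRing.scale/= ?mulr0 ?addr0.
Qed.

Lemma AC_phi1 j : AC 0 1 (phi1 j) (fun x => - (freq j)%:C * phi j x).
Proof.
apply: (@AC_ext _ _ _ (fun x => (wcos j * (- (j%:R * pi) * sinn j x))%:C) _
   (fun x => (wcos j * (- (j%:R * pi) * (j%:R * pi * cosn j x)))%:C)) => //.
  by move=> x _; apply: complexP; rewrite !cE /freq; ring.
apply: AC_real => //.
- move=> x; apply: cvgM; first exact: cvg_cst.
  by do 2!(apply: cvgM; first exact: cvg_cst); exact: continuous_cosn.
- move=> x; apply: cvgM; first exact: cvg_cst.
  by apply: cvgM; [exact: cvg_cst|exact: continuous_sinn].
- move=> x; have h := is_derive_sinn j x.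
  by apply: is_derive_eq; rewrite /GRing.scale/= ?mulr0 ?addr0; ring.
Qed.

Lemma sin_nat_pi n : sin (n%:R * pi) = 0 :> R.
Proof.
elim: n => [|n ih]; first by rewrite mul0r sin0.
by rewrite -natr1 mulrDl mul1r sinDpi ih oppr0.
Qed.

Lemma phi1_0 j : phi1 j 0 = 0.
Proof. by rewrite /phi1 /sinn !mulr0 sin0 !mulr0. Qed.
Lemma phi1_1 j : phi1 j 1 = 0.
Proof. by rewrite /phi1 /sinn mulr1 sin_nat_pi !mulr0. Qed.

Lemma phiJ j x : (phi j x)^* = phi j x.
Proof. by apply: complexP; rewrite !cE ?oppr0. Qed.

Lemma L2_phi j : L2 (phi j). Proof. exact: L2_AC (AC_phi j). Qed.

Definition coef f j : C := L2dot f (phi j).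

Lemma coefE f j : coef f j = cint (fun x => f x * phi j x) 0 1.
Proof. by rewrite /coef /L2dot; apply: eq_cint => x _; rewrite phiJ. Qed.

(** Green's formula; the terms with F(0) and F(1) drop out because [phi1 j] vanishes at both ends.
    Under Neumann conditions the second derivative thus acts on coefficients as multiplication by
    -[freq j]. *)
Lemma coef_second_derivative F F1 F2 j : AC 0 1 F F1 -> AC 0 1 F1 F2 ->
  coef F2 j = F1 1 * phi j 1 - F1 0 * phi j 0 - (freq j)%:C * coef F j.
Proof.
move=> FA F1A; rewrite !coefE (AC_by_parts2 ler01 FA F1A (AC_phi j) (AC_phi1 j)).
rewrite phi1_0 phi1_1 !mulr0 subrr subr0; congr (_ + _).
rewrite -mulNr -cintZ; last by apply: AC_integrableM FA (AC_integrable (AC_phi j)).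
by apply: eq_cint => x _; ring.
Qed.

Lemma freq_inj j k : freq j = freq k -> j = k.
Proof.
rewrite /freq => /eqP; rewrite eqf_sqr => /orP[] /eqP.
  by move/(mulIf (lt0r_neq0 (pi_gt0 R)))/eqP; rewrite eqr_nat => /eqP.
rewrite -mulNr => /(mulIf (lt0r_neq0 (pi_gt0 R)))/eqP.
rewrite -addr_eq0 -natrD pnatr_eq0 addn_eq0 => /andP[/eqP -> /eqP ->] //.
Qed.

Lemma freq_ge0 j : 0 <= freq j. Proof. exact: sqr_ge0. Qed.

(** Eigenfunctions of a symmetric operator for distinct eigenvalues: Green's formula computes the
    same inner product with both eigenvalues. *)
Lemma coef_phi_neq j k : j != k -> coef (phi j) k = 0.
Proof.
move=> jk; have := coef_second_derivative k (AC_phi j) (AC_phi1 j).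
rewrite phi1_0 phi1_1 !mul0r subrr sub0r /coef L2dotZl; do ?exact: L2_phi.
move/eqP; rewrite -subr_eq0 -mulNr -mulrBl mulf_eq0 => /orP[|/eqP //].
rewrite opprK addrC subr_eq0 => /eqP/complexI/freq_inj kj.
by rewrite kj eqxx in jk.
Qed.

(** By the double-angle formula, the square of [phi j] is 1 plus a multiple of [phi j.*2], which is
    orthogonal to [phi 0] = 1. *)
Lemma coef_phi_eq j : coef (phi j) j = 1.
Proof.
have h0 : cint (fun x => phi 0 x) 0 1 = 1.
  rewrite (@eq_cint _ _ _ _ (fun=> 1)) ?cint_cst ?ler01 ?mul1r ?subr0// => x _.
  by rewrite /phi /wcos eqxx cosn0 mulr1.
rewrite coefE; have [->|j0] := eqVneq j 0%N.
  rewrite -[RHS]h0; apply: eq_cint => x _.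
  by rewrite /phi /wcos eqxx cosn0 mulr1 mulr1.
have w2 : wcos j ^+ 2 = 2 by rewrite /wcos (negbTE j0) sqr_sqrtr.
have e x : phi j x * phi j x = 1 + (wcos (j.*2))^-1%:C * (phi j.*2 x * phi 0 x).
  have c2 : cosn j.*2 x = 2 * cosn j x ^+ 2 - 1.
    rewrite /cosn -addnn natrD mulrDl cosD -!expr2 sin2cos2; ring.
  have W0 : wcos j.*2 != 0 by rewrite gt_eqF ?wcos_gt0.
  have w0 : wcos 0 = 1 by [].
  apply: complexP; rewrite !cE /=; last by ring.
  rewrite cosn0 w0 c2; apply: (@etrans _ _ (wcos j ^+ 2 * cosn j x ^+ 2)); first by ring.
  by rewrite w2; field.
rewrite (eq_cint (fun x _ => e x)) cintD; first last.
- by apply: cintegrableZ; apply: AC_integrableM (AC_phi _) (AC_integrable (AC_phi _)).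
- exact: cintegrable_cst.
rewrite cintZ; last by apply: AC_integrableM (AC_phi _) (AC_integrable (AC_phi _)).
rewrite -coefE coef_phi_neq ?mulr0 ?addr0 ?cint_cst ?ler01 ?mul1r ?subr0//.
by rewrite double_eq0.
Qed.

Lemma coef_phi j k : coef (phi j) k = (j == k)%:R.
Proof. by case: eqVneq => [->|/coef_phi_neq]; first exact: coef_phi_eq. Qed.

Lemma coef_uniqueness f : L2 f -> (forall j, coef f j = 0) -> ae01 (fun x => f x = 0).
Proof.
move=> hf f0; have /L2P[/rL2_i fr /rL2_i fi] := hf.
have part (u : R -> R) : rintegrable 0 1 u ->
    (forall j, \int[mu]_(x in `[0, 1]) (u x * (wcos j * cosn j x)) = 0) ->
    {ae mu, forall x, 0 <= x <= 1 -> u x = 0}.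
  move=> iu h; apply: cosine_uniqueness => // j.
  have ic : rintegrable 0 1 (fun x => u x * cosn j x).
    apply: (rintegrable_ext _ (@rintegrable_bM _ 0 1 1 (cosn j) _ _ _ iu)).
    - by move=> x _; rewrite mulrC.
    - exact: measurable_cosn.
    - by move=> x _; exact: normr_cosn.
  have := h j; rewrite (@eq_rint _ _ _ _ (fun x => wcos j * (u x * cosn j x))); last first.
    by move=> x _; ring.
  by rewrite RintegralZl// => /eqP; rewrite mulf_eq0 gt_eqF ?wcos_gt0//= => /eqP.
have hr := part _ fr; have hi := part _ fi.
have {}hr : {ae mu, forall x, 0 <= x <= 1 -> Re (f x) = 0}.
  apply: hr => j; have := congr1 (@complex.Re R) (f0 j).
  rewrite coefE Re_cint => h; rewrite -[RHS]h; apply: eq_rint => x _; rewrite !cE; ring.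
have {}hi : {ae mu, forall x, 0 <= x <= 1 -> Im (f x) = 0}.
  apply: hi => j; have := congr1 (@complex.Im R) (f0 j).
  rewrite coefE Im_cint => h; rewrite -[RHS]h; apply: eq_rint => x _; rewrite !cE; ring.
apply: aeS (ae_and hr hi) => x [h1 h2]; rewrite /I01/= in_itv/= => x01.
by apply: complexP; [exact: h1|exact: h2].
Qed.

End CosineBasis.

(** * Fourier expansion and Parseval's identity *)

Section Parseval.
Context {R : realType}.
Notation C := R[i].
Notation mu := (@lebesgue_measure R).
Implicit Types (f g : R -> C) (a : nat -> C) (x : R) (j n N : nat).

Lemma coefD f g j : L2 f -> L2 g -> coef (fun x => f x + g x) j = coef f j + coef g j.
Proof. by move=> hf hg; rewrite /coef L2dotDl//; exact: L2_phi. Qed.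
Lemma coefB f g j : L2 f -> L2 g -> coef (fun x => f x - g x) j = coef f j - coef g j.
Proof. by move=> hf hg; rewrite /coef L2dotBl//; exact: L2_phi. Qed.
Lemma coefZ (k : C) f j : L2 f -> coef (fun x => k * f x) j = k * coef f j.
Proof. by move=> hf; rewrite /coef L2dotZl//; exact: L2_phi. Qed.
Lemma coef_le f j : L2 f -> cabs (coef f j) <= L2norm (@phi R j) * L2norm f.
Proof. by move=> hf; rewrite mulrC; apply: Cauchy_Schwarz => //; exact: L2_phi. Qed.

Definition psum (r : seq nat) a x : C := \sum_(j <- r) a j * phi j x.

Lemma L2_psum r a : L2 (psum r a).
Proof. by apply: L2_sum => j; apply: L2Z; exact: L2_phi. Qed.

Lemma coef_psum r a k : uniq r -> coef (psum r a) k = if k \in r then a k else 0.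
Proof.
move=> ur; rewrite /coef L2dot_suml; first last.
- exact: L2_phi.
- by move=> j; apply: L2Z; exact: L2_phi.
rewrite (eq_bigr (fun j => a j * (j == k)%:R)); last first.
  by move=> j _; rewrite -coef_phi /coef L2dotZl//; exact: L2_phi.
case: ifP => kr.
  rewrite (bigD1_seq k)//= eqxx mulr1 big1 ?addr0// => j jk.
  by rewrite (negbTE jk) mulr0.
rewrite big_seq big1// => j jr; have [jk|_] := eqVneq j k; last by rewrite mulr0.
by rewrite -jk jr in kr.
Qed.

Lemma L2dot_psum r a f : L2 f ->
  L2dot (psum r a) f = \sum_(j <- r) a j * (coef f j)^*.
Proof.
move=> hf; rewrite L2dot_suml//; last by move=> j; apply: L2Z; exact: L2_phi.
apply: eq_bigr => j _; rewrite (L2dotZl _ (L2_phi j) hf); congr (_ * _).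
exact: L2dotJ (L2_phi j).
Qed.

Lemma mulcJ (z : C) : z * z^* = (cabs z ^+ 2)%:C.
Proof. by rewrite sqr_cabs; apply: complexP; rewrite !cE; ring. Qed.

Lemma L2norm_psum r a : uniq r -> L2norm (psum r a) ^+ 2 = \sum_(j <- r) cabs (a j) ^+ 2.
Proof.
move=> ur; apply: complexI; rewrite -L2norm_dot; last exact: L2_psum.
rewrite L2dot_psum; last exact: L2_psum.
rewrite rmorph_sum/= big_seq [in RHS]big_seq; apply: eq_bigr => j jr.
by rewrite coef_psum// jr mulcJ.
Qed.

Lemma bessel r f : uniq r -> L2 f ->
  L2norm (fun x => f x - psum r (coef f) x) ^+ 2 =
  L2norm f ^+ 2 - \sum_(j <- r) cabs (coef f j) ^+ 2.
Proof.
move=> ur hf; have hS := L2_psum r (coef f).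
have := @L2dotD_norm R f (psum r (coef f)) (-1) hf hS.
rewrite (_ : (fun x => f x + _) = fun x => f x - psum r (coef f) x); last first.
  by apply/funext => x; rewrite rmorphN/= mulN1r.
move=> ->; rewrite L2norm_psum// (L2dotJ hS hf) ReJ L2dot_psum//.
rewrite Re_sum; under [\sum_(i <- r) Re _]eq_bigr do rewrite mulcJ Re_real.
by ring.
Qed.

Lemma bessel_le r f : uniq r -> L2 f -> \sum_(j <- r) cabs (coef f j) ^+ 2 <= L2norm f ^+ 2.
Proof. by move=> ur hf; rewrite -subr_ge0 -bessel// sqr_ge0. Qed.

Lemma sum_iota_split n m (u : nat -> R) : (n <= m)%N ->
  \sum_(0 <= j < m) u j = \sum_(0 <= j < n) u j + \sum_(n <= j < m) u j.
Proof. by move=> nm; rewrite (@big_cat_nat _ _ _ n). Qed.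

Lemma psum_split n m a x : (n <= m)%N ->
  psum (index_iota 0 m) a x - psum (index_iota 0 n) a x = psum (index_iota n m) a x.
Proof.
move=> nm; have -> : psum (index_iota 0 m) a x = psum (index_iota 0 n) a x + psum (index_iota n m) a x.
  by rewrite /psum (@big_cat_nat _ _ _ n).
by rewrite addrC addKr.
Qed.

(** The partial sums are Cauchy because their squared distances are increments of a bounded
    nondecreasing sequence; coefficients pass to the limit since each is a bounded functional. *)
Lemma synthesis a (M : R) :
  (forall n, \sum_(0 <= j < n) cabs (a j) ^+ 2 <= M) ->
  exists2 f, L2 f & (forall j, coef f j = a j) /\
    forall e : R, 0 < e -> exists N, forall n, (N <= n)%N ->
      L2norm (fun x => f x - psum (index_iota 0 n) a x) <= e.
Proof.
move=> aM; pose s n := \sum_(0 <= j < n) cabs (a j) ^+ 2.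
have s_nd : nondecreasing_seq s.
  by move=> n m nm; rewrite /s (sum_iota_split _ nm) lerDl sumr_ge0// => j _; rewrite sqr_ge0.
have sc : cvgn s by apply: nondecreasing_is_cvgn => //; exists M => _ [n _ <-]; exact: aM.
have sle n : s n <= limn s by exact: nondecreasing_cvgn_le.
have hc e : 0 < e -> exists N, forall n m, (N <= n)%N -> (n <= m)%N ->
    L2norm (fun x => psum (index_iota 0 m) a x - psum (index_iota 0 n) a x) <= e.
  move=> e0; have e2 : 0 < e ^+ 2 by rewrite exprn_gt0.
  have /cvgrPdist_le/(_ (e ^+ 2) e2)[N _ hN] : s @ \oo --> limn s by exact: sc.
  exists N => n m Nn nm.
  rewrite -(ler_pXn2r (ltn0Sn 1)) ?nnegrE ?L2norm_ge0 ?(ltW e0)//.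
  rewrite (eq_L2norm (fun x _ => psum_split a x nm)) L2norm_psum ?iota_uniq//.
  have -> : \sum_(j <- index_iota n m) cabs (a j) ^+ 2 = s m - s n.
    by rewrite /s (sum_iota_split _ nm) addrC addKr.
  have := hN n Nn; rewrite /= ger0_norm ?subr_ge0// => h.
  by apply: le_trans h; rewrite lerB.
have [f hf bf] := L2_complete (fun n => L2_psum (index_iota 0 n) a) hc.
exists f => //; split => // j; apply/eqP; rewrite -subr_eq0; apply/eqP/cabs_eq0/eqP.
rewrite eq_le cabs_ge0 andbT; apply/ler_addgt0Pr => e e0; rewrite add0r.
have p0 : 0 < L2norm (@phi R j) + 1 by rewrite ltr_wpDl ?L2norm_ge0.
have [N hN] := bf _ (divr_gt0 e0 p0).
(* Beyond index [j] the partial sum has [j]-th coefficient exactly [a j]. *)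
have -> : coef f j - a j = coef (fun x => f x - psum (index_iota 0 (maxn N j.+1)) a x) j.
  rewrite coefB ?coef_psum ?iota_uniq//; last exact: L2_psum.
  by rewrite mem_index_iota/= leq_max ltnSn orbT.
apply: le_trans (coef_le _ (L2B hf (L2_psum _ _))) _.
have := hN (maxn N j.+1) (leq_maxl _ _); rewrite ler_pdivlMr// mulrC; apply: le_trans.
by rewrite ler_wpM2r ?L2norm_ge0// lerDl.
Qed.

(** The function synthesised from the coefficients of [f] has the same coefficients as [f], hence
    equals it almost everywhere by uniqueness. *)
Lemma fourier_cvg f : L2 f -> forall e : R, 0 < e -> exists N, forall n, (N <= n)%N ->
  L2norm (fun x => f x - psum (index_iota 0 n) (coef f) x) <= e.
Proof.
move=> hf; have [g hg [cg bg]] := @synthesis (coef f) (L2norm f ^+ 2)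
  (fun n => bessel_le (iota_uniq 0 _) hf).
move=> e e0; have [N hN] := bg e e0; exists N => n Nn; apply: le_trans (hN n Nn).
have fg : ae01 (fun x => f x - g x = 0).
  by apply: coef_uniqueness; [exact: L2B|move=> j; rewrite coefB// cg subrr].
have hS := L2_psum (index_iota 0 n) (coef f).
rewrite le_eqVlt; apply/orP; left; apply/eqP; apply: L2norm_ae; do ?exact: L2B.
by apply: aeS fg => x h x01; move/eqP: (h x01); rewrite subr_eq0 => /eqP ->.
Qed.

Lemma parseval f : L2 f -> forall e : R, 0 < e -> exists N, forall n, (N <= n)%N ->
  L2norm f ^+ 2 <= \sum_(0 <= j < n) cabs (coef f j) ^+ 2 + e.
Proof.
move=> hf e e0; have s0 : 0 < Num.sqrt e by rewrite sqrtr_gt0.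
have [N hN] := fourier_cvg hf s0.
exists N => n Nn; rewrite -lerBlDl -bessel ?iota_uniq//.
have := hN n Nn; rewrite -(ler_pXn2r (ltn0Sn 1)) ?nnegrE ?L2norm_ge0 ?sqrtr_ge0//.
by rewrite (sqr_sqrtr (ltW e0)).
Qed.

(** Parseval for [f] and Bessel for [g]: this is how a bound on every mode becomes a bound in
    norm. *)
Lemma L2norm_coef_le f g (k : R) : 0 <= k -> L2 f -> L2 g ->
  (forall j, cabs (coef f j) <= k * cabs (coef g j)) -> L2norm f <= k * L2norm g.
Proof.
move=> k0 hf hg fg.
rewrite -(ler_pXn2r (ltn0Sn 1)) ?nnegrE ?L2norm_ge0 ?mulr_ge0 ?L2norm_ge0//.
apply/ler_addgt0Pr => e e0; have [N hN] := parseval hf e0.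
apply: le_trans (hN N (leqnn N)) _; rewrite lerD2r exprMn.
apply: le_trans (ler_wpM2l (sqr_ge0 k) (bessel_le (iota_uniq 0 (N - 0)) hg)).
rewrite mulr_sumr; apply: ler_sum => j _; rewrite -exprMn lerXn2r ?nnegrE ?cabs_ge0//.
by rewrite mulr_ge0 ?cabs_ge0.
Qed.

Lemma coef_ae f g : L2 f -> L2 g -> (forall j, coef f j = coef g j) ->
  ae01 (fun x => f x = g x).
Proof.
move=> hf hg fg.
have : ae01 (fun x => f x - g x = 0).
  by apply: coef_uniqueness; [exact: L2B|move=> j; rewrite coefB// fg subrr].
by apply: aeS => x h x01; move/eqP: (h x01); rewrite subr_eq0 => /eqP ->.
Qed.

(* Uniform smallness of the tails: the family of all [f] with coefficients dominated
   by those of [g] is relatively compact, only finitely many coefficients matter. *)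
Lemma L2norm_dominated_tail g (k e : R) : L2 g -> 0 < e -> exists N, forall f, L2 f ->
  (forall j, cabs (coef f j) <= k * cabs (coef g j)) ->
  L2norm f ^+ 2 <= \sum_(0 <= j < N) cabs (coef f j) ^+ 2 + e.
Proof.
move=> hg e0; have k1 : 0 < k ^+ 2 + 1 by rewrite ltr_wpDl ?sqr_ge0.
have [N hN] := parseval hg (divr_gt0 e0 k1); exists N => f hf fg.
apply/ler_addgt0Pr => d d0; have [M hM] := parseval hf d0.
apply: le_trans (hM (maxn N M) (leq_maxr _ _)) _; rewrite lerD2r.
rewrite (sum_iota_split _ (leq_maxl N M)) lerD2l.
apply: le_trans (_ : k ^+ 2 * \sum_(N <= j < maxn N M) cabs (coef g j) ^+ 2 <= _).
  rewrite mulr_sumr; apply: ler_sum => j _; rewrite -exprMn lerXn2r ?nnegrE ?cabs_ge0//.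
  exact: le_trans (cabs_ge0 _) (fg j).
have h1 := bessel_le (iota_uniq 0 (maxn N M - 0)) hg.
rewrite -/(index_iota 0 _) (sum_iota_split _ (leq_maxl N M)) in h1.
have := hN N (leqnn N); set S := \sum_(N <= j < _) _ in h1 *.
move=> h2; have h3 : S <= e / (k ^+ 2 + 1) by lra.
move: h3; rewrite ler_pdivlMr// => h3; apply: le_trans h3.
rewrite mulrC ler_wpM2l ?lerDl//.
by rewrite sumr_ge0// => j _; rewrite sqr_ge0.
Qed.

End Parseval.

(** * Volterra equations of the second kind *)

Section Volterra.
Context {R : realType}.
Notation C := R[i].
Notation mu := (@lebesgue_measure R).
Implicit Types (f g v z : R -> C) (a b c x y A : R).

Definition kerop (K : R -> R -> C) f x := cint (fun y => K x y * f y) 0 1.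

Section kerop.
Variables (K : R -> R -> C) (M : R).
Hypothesis KM : ckernel K M.

Lemma kerop_le f x : L2 f -> cabs (kerop K f x) <= M * L2norm f.
Proof.
move=> hf; apply: le_trans (ckernel_bound x KM (L2_i hf)) _.
by rewrite ler_wpM2l ?L1_le_L2// (ckernel_ge0 KM).
Qed.

Lemma L2_kerop f : L2 f -> L2 (kerop K f).
Proof.
move=> hf; apply: (@L2_bounded _ (M * L2norm f)); first exact: cmeas_kernel KM (L2_i hf) 0 1.
by move=> x _; exact: kerop_le.
Qed.

Lemma L2norm_kerop f : L2 f -> L2norm (kerop K f) <= M * L2norm f.
Proof.
move=> hf; apply: L2norm_bound; first by rewrite mulr_ge0 ?L2norm_ge0 ?(ckernel_ge0 KM).
- exact: L2_kerop.
- by move=> x _; exact: kerop_le.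
Qed.

Lemma keropD f g x : L2 f -> L2 g -> kerop K (fun y => f y + g y) x = kerop K f x + kerop K g x.
Proof.
move=> hf hg; rewrite /kerop -cintD; do ?by apply: ckernel_intr KM (L2_i _).
by apply: eq_cint => y _; rewrite mulrDr.
Qed.

Lemma keropB f g x : L2 f -> L2 g -> kerop K (fun y => f y - g y) x = kerop K f x - kerop K g x.
Proof.
move=> hf hg; rewrite /kerop -cintB; do ?by apply: ckernel_intr KM (L2_i _).
by apply: eq_cint => y _; rewrite mulrBr.
Qed.

Lemma eq_kerop f g x : L2 f -> L2 g -> ae01 (fun y => f y = g y) -> kerop K f x = kerop K g x.
Proof.
move=> hf hg fg; apply: cint_ae; do ?by apply: ckernel_intr KM (L2_i _).
by apply: aeS fg => y; rewrite /I01/= in_itv/= => h y01; rewrite h.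
Qed.
End kerop.

Section weighted.
Variables (K : R -> R -> C) (M : R) (w : R -> R) (w0 W : R).
Hypothesis KM : ckernel K M.
Hypothesis w0_gt0 : 0 < w0.
Hypothesis wb : forall x, 0 <= x <= 1 -> w0 <= w x <= W.
(* A Bielecki weight: [w] makes the integral operator a strict contraction. *)
Hypothesis contr : forall f A x, cintegrable 0 1 f -> 0 <= A ->
  (forall y, 0 <= y <= 1 -> cabs (f y) <= A * w y) -> 0 <= x <= 1 ->
  cabs (kerop K f x) <= 2^-1 * A * w x.

Let W_ge0 : 0 <= W.
Proof.
have h01 : 0 <= (0 : R) <= 1 by rewrite lexx ler01.
by have /andP[h1 h2] := wb h01; apply: le_trans (le_trans h1 h2); rewrite ltW.
Qed.

Let M0 := ckernel_ge0 KM.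

Let q0 f : 0 <= M * L2norm f / w0.
Proof. by apply: divr_ge0; [rewrite mulr_ge0 ?L2norm_ge0|exact: ltW]. Qed.

Let bound_w f x : L2 f -> 0 <= x <= 1 -> cabs (kerop K f x) <= M * L2norm f / w0 * w x.
Proof.
move=> hf x01; apply: le_trans (kerop_le KM x hf) _.
rewrite -mulrA ler_peMr ?mulr_ge0 ?L2norm_ge0// mulrC ler_pdivlMr// mul1r.
by have /andP[] := wb x01.
Qed.

(** The difference u = v - z solves u = K z + K u. With |K z| <= A w, each use of the contraction
    turns the bound (2 A + B / 2^n) w into the next one, and 2 A w remains in the limit. *)
Lemma volterra_apriori v z : L2 v -> L2 z ->
  (forall x, 0 <= x <= 1 -> v x = z x + kerop K v x) ->
  forall x, 0 <= x <= 1 -> cabs (v x - z x) <= 2 * (M * L2norm z / w0) * W.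
Proof.
move=> hv hz vz x x01.
pose A := M * L2norm z / w0; pose B := M * L2norm v / w0.
have A0 : 0 <= A by exact: q0.
have B0 : 0 <= B by exact: q0.
have hu := L2B hv hz.
have it n : forall y, 0 <= y <= 1 -> cabs (v y - z y) <= (2 * A + B / (2 ^ n)%:R) * w y.
  elim: n => [|n ih] y y01.
    have -> : v y - z y = kerop K v y by rewrite vz// addrC addKr.
    apply: le_trans (bound_w hv y01) _; rewrite -/B expn0 divr1; apply: ler_wpM2r.
      by have /andP[h _] := wb y01; rewrite (le_trans _ h)// ltW.
    by rewrite lerDr mulr_ge0.
  have -> : v y - z y = kerop K z y + kerop K (fun y => v y - z y) y.
    by rewrite (keropB KM)// vz//; ring.
  have D0 : 0 <= 2 * A + B / (2 ^ n)%:R.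
    by apply: addr_ge0; [rewrite mulr_ge0|rewrite divr_ge0].
  apply: le_trans (cabsD _ _) (le_trans (lerD (bound_w hz y01) (contr (L2_i hu) D0 ih y01)) _).
  rewrite -/A -mulrDl le_eqVlt; apply/orP; left; apply/eqP; congr (_ * _).
  by rewrite expnS natrM; field; rewrite pnatr_eq0 -lt0n expn_gt0.
have /andP[h1 h2] := wb x01.
have wx : 0 <= w x by rewrite (le_trans _ h1)// ltW.
apply: le_trans (_ : 2 * A * w x <= _); last by rewrite ler_wpM2l// mulr_ge0.
apply/ler_addgt0Pr => e e0.
have Bw : 0 <= B * w x by rewrite mulr_ge0.
have [n hn] : exists n, B * w x / (2 ^ n)%:R <= e.
  have [n hn] := @ltr_add_invr R 0 (e / (B * w x + 1)) (divr_gt0 e0 (ltr_wpDl Bw ltr01)).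
  exists n.+1; rewrite add0r in hn.
  have le2 : ((2 ^ n.+1)%:R : R)^-1 <= n.+1%:R^-1.
    by rewrite lef_pV2 ?posrE ?ltr0n ?expn_gt0// ler_nat ltnW// ltn_expl.
  have /ltW := le_lt_trans le2 hn; rewrite ler_pdivlMr ?ltr_wpDl// => h.
  apply: le_trans h; rewrite mulrC ler_wpM2l ?invr_ge0//; lra.
apply: le_trans (it n x x01) _; rewrite mulrDl lerD2l.
by apply: le_trans hn; rewrite mulrAC.
Qed.

(** Neumann series: the iterates of the operator decrease geometrically in the weighted supremum
    norm, so the partial sums converge in L^2(0,1). *)
Lemma volterra_solve z : L2 z ->
  exists2 v, L2 v & forall x, 0 <= x <= 1 -> v x = z x + kerop K v x.
Proof.
move=> hz.
(* The series begins with K z: [z] itself is only square integrable, whereas all images under K are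
   bounded pointwise. *)
pose a := fix a n := if n is n'.+1 then kerop K (a n') else kerop K z.
have ha n : L2 (a n) by elim: n => [|n ih]; apply: (L2_kerop KM).
pose A := M * L2norm z / w0 + 1.
have A1 : 0 < A by rewrite ltr_wpDl ?q0.
have an n : forall x, 0 <= x <= 1 -> cabs (a n x) <= A / (2 ^ n)%:R * w x.
  elim: n => [|n ih] x x01 /=.
    apply: le_trans (bound_w hz x01) _; rewrite expn0 divr1 ler_wpM2r ?lerDl//.
    by have /andP[h _] := wb x01; rewrite (le_trans _ h)// ltW.
  have D0 : 0 <= A / (2 ^ n)%:R by rewrite divr_ge0 ?(ltW A1).
  apply: le_trans (contr (L2_i (ha n)) D0 ih x01) _.
  rewrite le_eqVlt; apply/orP; left; apply/eqP; congr (_ * _).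
  by rewrite expnS natrM; field; rewrite pnatr_eq0 -lt0n expn_gt0.
pose S n x := \sum_(0 <= k < n) a k x.
have hS n : L2 (S n) by apply: L2_sum.
have SS n : forall x, S n.+1 x = a 0%N x + kerop K (S n) x.
  elim: n => [|n ih] x.
    rewrite /S big_nat1 /kerop (@eq_cint _ _ _ _ (fun=> 0)) ?cint0 ?addr0// => y _.
    by rewrite big_geq// mulr0.
  have -> : S n.+2 x = S n.+1 x + a n.+1 x by rewrite /S big_nat_recr.
  rewrite ih -addrA; congr (_ + _).
  rewrite -[a n.+1 x]/(kerop K (a n) x) -(keropD KM _ (hS n) (ha n)).
  by apply: eq_cint => y _; rewrite [in RHS]/S big_nat_recr.
(* A factor 2 comes from the geometric sum, another from the exponent n + 1 in [L2_geometric_limit];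
   the summand 1 makes [c] positive. *)
pose c := 4 * A * (W + 1).
have c0 : 0 < c by rewrite /c !mulr_gt0// ltr_wpDl.
have Sc n m : (n <= m)%N -> L2norm (fun x => S m x - S n x) <= c / (2 ^ n.+1)%:R.
  move=> nm; have pw x : 0 <= x <= 1 ->
      cabs (S m x - S n x) <= (2 * A * W) * ((2 ^ n)%:R^-1 - (2 ^ m)%:R^-1).
    move=> x01; have /andP[h1 h2] := wb x01.
    elim: m nm => [|m ih].
      by rewrite leqn0 => /eqP ->; rewrite !subrr mulr0 cabs0.
    rewrite leq_eqVlt => /predU1P[->|nm]; first by rewrite !subrr mulr0 cabs0.
    have -> : S m.+1 x - S n x = S m x - S n x + a m x.
      by rewrite /S big_nat_recr//=; ring.
    apply: le_trans (cabsD _ _) (le_trans (lerD (ih nm) (an m x x01)) _).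
    have -> : 2 * A * W * ((2 ^ n)%:R^-1 - (2 ^ m.+1)%:R^-1) =
       2 * A * W * ((2 ^ n)%:R^-1 - (2 ^ m)%:R^-1) + A / (2 ^ m)%:R * W.
      rewrite expnS natrM; field.
      by rewrite !pnatr_eq0 -!lt0n !expn_gt0.
    by rewrite lerD2l ler_wpM2l// divr_ge0 ?(ltW A1).
  apply: L2norm_bound; first by rewrite divr_ge0 ?(ltW c0).
  - exact: L2B.
  move=> x x01; apply: le_trans (pw x x01) _.
  have -> : c / (2 ^ n.+1)%:R = 2 * A * (W + 1) * (2 ^ n)%:R^-1.
    by rewrite /c expnS natrM; field; rewrite pnatr_eq0 -lt0n expn_gt0.
  have i0 : 0 <= ((2 ^ n)%:R : R)^-1 by rewrite invr_ge0.
  have i1 : 0 <= ((2 ^ m)%:R : R)^-1 by rewrite invr_ge0.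
  apply: ler_pM; rewrite ?mulr_ge0 ?(ltW A1) ?subr_ge0//.
  - by rewrite lef_pV2 ?posrE ?ltr0n ?expn_gt0// ler_nat leq_pexp2l.
  - by rewrite ler_wpM2l ?mulr_ge0 ?(ltW A1)// lerDl.
  - by rewrite lerBlDr lerDl.
have [u hu bu] := L2_geometric_limit c0 hS Sc.
have uE : ae01 (fun x => u x = a 0%N x + kerop K u x).
  have hT := L2_kerop KM hu; have h0 := ha 0%N.
  have : L2norm (fun x => u x - (a 0%N x + kerop K u x)) = 0.
    apply/eqP; rewrite eq_le L2norm_ge0 andbT; apply/ler_addgt0Pr => e e0; rewrite add0r.
    pose D := (1 + M) * (2 * c) + 1.
    have D0 : 0 < D by rewrite ltr_wpDl// !mulr_ge0// ?addr_ge0// ltW.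
    have [n hn] := @ltr_add_invr R 0 (e / D) (divr_gt0 e0 D0); rewrite add0r in hn.
    have le2 : ((2 ^ n.+1)%:R : R)^-1 <= n.+1%:R^-1.
      by rewrite lef_pV2 ?posrE ?ltr0n ?expn_gt0// ler_nat ltnW// ltn_expl.
    have /ltW := le_lt_trans le2 hn; rewrite ler_pdivlMr// => h.
    apply: le_trans h.
    have hT' := L2_kerop KM (L2B (hS n) hu).
    rewrite (@eq_L2norm _ _ (fun x => (u x - S n.+1 x) + kerop K (fun y => S n y - u y) x)); last first.
      by move=> x _; rewrite SS (keropB KM)//; ring.
    apply: le_trans (L2norm_triangle (L2B hu (hS _)) hT') _.
    have b1 : L2norm (fun x => u x - S n.+1 x) <= 2 * c * (2 ^ n.+1)%:R^-1.
      apply: le_trans (bu n.+1) _; rewrite mulrA; apply: ler_wpM2l; first by rewrite mulr_ge0// ltW.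
      by rewrite lef_pV2 ?posrE ?ltr0n ?expn_gt0// ler_nat leq_pexp2l.
    have b2 : L2norm (kerop K (fun y => S n y - u y)) <= M * (2 * c * (2 ^ n.+1)%:R^-1).
      apply: le_trans (L2norm_kerop KM (L2B (hS n) hu)) _; rewrite ler_wpM2l//.
      by rewrite L2norm_distC -mulrA; exact: bu.
    apply: le_trans (lerD b1 b2) _.
    have i0 : 0 <= ((2 ^ n.+1)%:R : R)^-1 by rewrite invr_ge0.
    have -> : (2 ^ n.+1)%:R^-1 * D = 2 * c * (2 ^ n.+1)%:R^-1 +
        M * (2 * c * (2 ^ n.+1)%:R^-1) + (2 ^ n.+1)%:R^-1 by rewrite /D; ring.
    by rewrite lerDl.
  move/(L2norm_eq0 (L2B hu (L2D h0 hT))); apply: aeS => x h x01.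
  by apply/eqP; rewrite -subr_eq0; apply/eqP/h.
have hzu := L2D hz hu.
(* The limit solves the equation only almost everywhere. Replacing it by the right-hand side gives a
   solution at every point, since K depends only on the class of its argument. *)
exists (fun x => z x + kerop K (fun y => z y + u y) x); first by apply: L2D => //; apply: L2_kerop KM _ _.
move=> x _; congr (_ + _); apply: (eq_kerop KM) => //.
  by apply: L2D => //; apply: L2_kerop KM _ _.
apply: aeS uE => y h y01; rewrite (keropD KM)//; congr (_ + _); exact: h.
Qed.
End weighted.

End Volterra.

(** * Volterra operators with a kernel on the triangle *)

Section TriangularVolterra.
Context {R : realType}.
Notation C := R[i].
Notation mu := (@lebesgue_measure R).
Implicit Types (f g v z : R -> C) (a b c x y A : R) (K : R -> R -> C).

Lemma is_derive_expRM c x : is_derive x 1 (fun y => expR (c * y)) (c * expR (c * x)).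
Proof.
have h : is_derive x 1 (fun y => c * y) c.
  by apply: is_derive_eq; rewrite /GRing.scale/= mulr1 ?mulr0 ?addr0.
have := @is_derive1_comp R expR (fun y => c * y) x _ _ (is_derive_expR _) h.
by rewrite mulrC.
Qed.

Lemma continuous_expRM c : continuous (fun y : R => expR (c * y)).
Proof.
move=> x; apply: (@continuous_comp _ _ _ (fun y => c * y) expR); last exact: continuous_expR.
by apply: continuousM; [exact: cvg_cst|exact: cvg_id].
Qed.

Lemma rintegrable_expRM a b c : rintegrable a b (fun y => expR (c * y)).
Proof. by apply: rintegrable_cont; apply: continuous_subspaceT; exact: continuous_expRM. Qed.

Lemma rint_expRM a b c : a <= b -> c != 0 ->
  \int[mu]_(y in `[a, b]) expR (c * y) = (expR (c * b) - expR (c * a)) / c.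
Proof.
move=> ab c0.
have h : AC a b (fun x => (c^-1 * expR (c * x))%:C) (fun x => (expR (c * x))%:C).
  apply: AC_real => //.
  - exact: continuous_expRM.
  - by move=> x; apply: cvgM; [exact: cvg_cst|exact: continuous_expRM].
  - move=> x; have d := is_derive_expRM c x.
    by apply: is_derive_eq; rewrite /GRing.scale/= ?mulr0 ?addr0; field.
have := congr1 (@complex.Re R) (AC_bnd ab h); rewrite Re_cint /= => ->.
ring.
Qed.

Section kernel.
Variables (K0 : R -> R -> C) (M : R).
Hypothesis KM : ckernel K0 M.
(** Rate of the exponential weight: integrating the weight costs a factor 1 / k, and M / k <= 1/2.
    The weight is exp(-k x) for integrals over [x, 1] and exp(k x) for integrals over [0, x]. *)
Let k := 2 * M + 1.
Let M0 := ckernel_ge0 KM.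
Let k0 : 0 < k. Proof. by rewrite /k ltr_wpDl// mulr_ge0. Qed.
Let Mk : M / k <= 2^-1. Proof. by rewrite ler_pdivrMr// /k; lra. Qed.

Let Ku x y := if x <= y then K0 x y else 0.
Let Kl x y := if y <= x then K0 x y else 0.

Let KuE f x : cintegrable 0 1 f -> 0 <= x <= 1 -> kerop Ku f x = cint (fun y => K0 x y * f y) x 1.
Proof.
move=> fi x01; rewrite (cint_upper x01 (ckernel_intr x KM fi)); apply: eq_cint => y _.
by rewrite /Ku; case: ifP; rewrite ?mul0r.
Qed.

Let KlE f x : cintegrable 0 1 f -> 0 <= x <= 1 -> kerop Kl f x = cint (fun y => K0 x y * f y) 0 x.
Proof.
move=> fi x01; rewrite (cint_lower x01 (ckernel_intr x KM fi)); apply: eq_cint => y _.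
by rewrite /Kl; case: ifP; rewrite ?mul0r.
Qed.

Let exp_bound a b c f A x : 0 <= a -> a <= b -> b <= 1 -> cintegrable 0 1 f -> 0 <= A ->
  (forall y, 0 <= y <= 1 -> cabs (f y) <= A * expR (c * y)) -> c != 0 ->
  cabs (cint (fun y => K0 x y * f y) a b) <= M * A * ((expR (c * b) - expR (c * a)) / c).
Proof.
move=> a0 ab b1 fi A0 fA c0; rewrite -(rint_expRM ab c0) -RintegralZl//; last exact: rintegrable_expRM.
apply: cint_le.
- exact: cintegrableS a0 b1 (ckernel_intr x KM fi).
- by apply: rintegrableZ; exact: rintegrable_expRM.
- move=> y /andP[ay yb]; rewrite cabsM -mulrA; apply: ler_pM; rewrite ?cabs_ge0//.
    by case: KM.
  by apply: fA; rewrite (le_trans a0)// (le_trans yb).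
Qed.

Let Mk2 A t : 0 <= A -> 0 <= t -> M * A * (t / k) <= 2^-1 * A * t.
Proof.
move=> A0 t0; have -> : M * A * (t / k) = (M / k) * (A * t) by rewrite -!mulrA; congr (_ * _); ring.
by rewrite -[leRHS]mulrA; apply: ler_wpM2r => //; rewrite mulr_ge0.
Qed.

Let contr_u f A x : cintegrable 0 1 f -> 0 <= A ->
  (forall y, 0 <= y <= 1 -> cabs (f y) <= A * expR (- k * y)) -> 0 <= x <= 1 ->
  cabs (kerop Ku f x) <= 2^-1 * A * expR (- k * x).
Proof.
move=> fi A0 fA x01; rewrite KuE//; have [x0 x1] := andP x01.
have kn : - k != 0 by rewrite oppr_eq0 gt_eqF.
apply: le_trans (exp_bound x x0 x1 (lexx _) fi A0 fA kn) _.
apply: le_trans (Mk2 A0 (expR_ge0 (- k * x))); apply: ler_wpM2l; first by rewrite mulr_ge0.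
rewrite invrN mulrN -mulNr opprB ler_wpM2r ?invr_ge0 ?(ltW k0)//.
by rewrite gerBl expR_ge0.
Qed.

Let contr_l f A x : cintegrable 0 1 f -> 0 <= A ->
  (forall y, 0 <= y <= 1 -> cabs (f y) <= A * expR (k * y)) -> 0 <= x <= 1 ->
  cabs (kerop Kl f x) <= 2^-1 * A * expR (k * x).
Proof.
move=> fi A0 fA x01; rewrite KlE//; have [x0 x1] := andP x01.
apply: le_trans (exp_bound x (lexx _) x0 x1 fi A0 fA (lt0r_neq0 k0)) _.
apply: le_trans (Mk2 A0 (expR_ge0 (k * x))); apply: ler_wpM2l; first by rewrite mulr_ge0.
rewrite ler_wpM2r ?invr_ge0 ?(ltW k0)//.
by rewrite gerBl expR_ge0.
Qed.

Let wu x : 0 <= x <= 1 -> expR (- k) <= expR (- k * x) <= 1.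
Proof.
move=> /andP[x0 x1]; rewrite ler_expR -expR0 ler_expR mulNr lerN2 oppr_le0.
by rewrite ger_pMr// x1 mulr_ge0// ltW.
Qed.

Let wl x : 0 <= x <= 1 -> 1 <= expR (k * x) <= expR k.
Proof.
move=> /andP[x0 x1]; rewrite ler_expR -[leLHS]expR0 ler_expR.
by rewrite ger_pMr// x1 mulr_ge0// ltW.
Qed.

Let KuM : ckernel Ku M. Proof. exact: ckernel_upper. Qed.
Let KlM : ckernel Kl M. Proof. exact: ckernel_lower. Qed.

Lemma volterra_upper_solve z : L2 z -> exists2 v, L2 v &
  forall x, 0 <= x <= 1 -> v x = z x + cint (fun y => K0 x y * v y) x 1.
Proof.
move=> hz; have [v hv vE] := volterra_solve KuM (expR_gt0 _) wu contr_u hz.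
by exists v => // x x01; rewrite vE// KuE//; exact: L2_i.
Qed.

Lemma volterra_upper_apriori : exists2 D : R, 0 <= D & forall v z, L2 v -> L2 z ->
  (forall x, 0 <= x <= 1 -> v x = z x + cint (fun y => K0 x y * v y) x 1) ->
  forall x, 0 <= x <= 1 -> cabs (v x - z x) <= D * L2norm z.
Proof.
exists (2 * (M / expR (- k)) * 1); first by rewrite !mulr_ge0 ?invr_ge0 ?expR_ge0.
move=> v z hv hz vE x x01.
have vE' y : 0 <= y <= 1 -> v y = z y + kerop Ku v y.
  by move=> y01; rewrite vE// KuE//; exact: L2_i.
apply: le_trans (volterra_apriori KuM (expR_gt0 _) wu contr_u hv hz vE' x01) _.
by rewrite le_eqVlt; apply/orP; left; apply/eqP; ring.
Qed.

Lemma volterra_lower_solve z : L2 z -> exists2 v, L2 v &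
  forall x, 0 <= x <= 1 -> v x = z x + cint (fun y => K0 x y * v y) 0 x.
Proof.
move=> hz; have [v hv vE] := volterra_solve KlM ltr01 wl contr_l hz.
by exists v => // x x01; rewrite vE// KlE//; exact: L2_i.
Qed.

Lemma L2_upper f : L2 f -> L2 (fun x => cint (fun y => K0 x y * f y) x 1).
Proof.
move=> hf; have h := L2_kerop KuM hf.
apply: (@L2_bounded _ (M * L2norm f)).
  by apply: (cmeas_ext _ (L2_meas h)) => x x01; rewrite KuE//; exact: L2_i.
by move=> x x01; rewrite -KuE//; [exact: (kerop_le KuM)|exact: L2_i].
Qed.

Lemma upper_le f x : L2 f -> 0 <= x <= 1 ->
  cabs (cint (fun y => K0 x y * f y) x 1) <= M * L2norm f.
Proof. by move=> hf x01; rewrite -KuE//; [exact: (kerop_le KuM)|exact: L2_i]. Qed.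

Lemma L2_lower f : L2 f -> L2 (fun x => cint (fun y => K0 x y * f y) 0 x).
Proof.
move=> hf; have h := L2_kerop KlM hf.
apply: (@L2_bounded _ (M * L2norm f)).
  by apply: (cmeas_ext _ (L2_meas h)) => x x01; rewrite KlE//; exact: L2_i.
by move=> x x01; rewrite -KlE//; [exact: (kerop_le KlM)|exact: L2_i].
Qed.

Lemma fubini_triangle a b f g : 0 <= a -> a <= b -> b <= 1 -> cintegrable 0 1 f -> cintegrable 0 1 g ->
  cint (fun x => f x * cint (fun y => K0 x y * g y) x b) a b =
  cint (fun y => g y * cint (fun x => K0 x y * f x) a y) a b.
Proof.
move=> a0 ab b1 fi gi.
have fi' := cintegrableS a0 b1 fi; have gi' := cintegrableS a0 b1 gi.
have := fubini_kernel KuM fi' gi' => h.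
apply: etrans (etrans h _).
- apply: eq_cint => x xab; congr (_ * _).
  rewrite (cint_upper xab (ckernel_intr x KM gi')); apply: eq_cint => y _.
  by rewrite /Ku; case: ifP; rewrite ?mul0r.
- apply: eq_cint => y yab; congr (_ * _).
  rewrite (cint_lower yab (ckernel_intl y KM fi')); apply: eq_cint => x _.
  by rewrite /Ku; case: ifP; rewrite ?mul0r.
Qed.
End kernel.

(* The retraction of the plane onto the triangle turns a kernel that is continuous on
   the triangle into one that is continuous, hence measurable, on the plane. *)
Definition clamp a b x : R := Num.max a (Num.min b x).
Definition retract (s : R * R) : R * R :=
  (clamp 0 (clamp 0 1 s.2) s.1, clamp 0 1 s.2).
Definition ext K x y : C := K (retract (x, y)).1 (retract (x, y)).2.

Lemma clampE a b x : a <= x <= b -> clamp a b x = x.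
Proof. by move=> /andP[ax xb]; rewrite /clamp (min_idPr xb) (max_idPr ax). Qed.
Lemma clamp_itv a b x : a <= b -> a <= clamp a b x <= b.
Proof. by move=> ab; rewrite /clamp le_max lexx/= ge_max ab ge_min lexx. Qed.

Lemma retract_triangle (s : R * R) : triangle (retract s).
Proof.
have /andP[h0 h1] := clamp_itv s.2 (@ler01 R).
by split => //=; exact: clamp_itv.
Qed.

Lemma retractE x y : triangle (x, y) -> retract (x, y) = (x, y).
Proof.
move=> [/= /andP[x0 xy] y1]; rewrite /retract /= [clamp 0 1 y]clampE ?y1 ?(le_trans x0)//.
by rewrite clampE// x0.
Qed.

Lemma retractK s : retract (retract s) = retract s.
Proof. by have := retract_triangle s; case: (retract s) => x y; exact: retractE. Qed.

Lemma extE K x y : triangle (x, y) -> ext K x y = K x y.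
Proof. by move=> /retractE e; rewrite /ext e. Qed.

Lemma continuous_retract : continuous retract.
Proof.
have cc (c0 : R) : continuous (fun _ : R * R => c0) by move=> s; exact: cvg_cst.
have c2 : continuous (fun s : R * R => clamp 0 1 s.2).
  apply: (max_fun_continuous (cc 0)).
  apply: (min_fun_continuous (cc 1)) => s; exact: cvg_snd.
have c1 : continuous (fun s : R * R => clamp 0 (clamp 0 1 s.2) s.1).
  apply: (max_fun_continuous (cc 0)).
  apply: (min_fun_continuous c2) => s; exact: cvg_fst.
move=> s; exact: (cvg_pair (c1 s) (c2 s)).
Qed.

Lemma continuous_ext_real (u : R * R -> R) : {within triangle, continuous u} ->
  continuous (u \o retract).
Proof.
move=> cu s; have /subspace_continuousP h := cu.
apply: (@cvg_comp _ _ _ retract u _ (within triangle (nbhs (retract s)))).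
  move=> A /= hA; have := continuous_retract hA; rewrite /nbhs/=.
  by apply: filterS => y /=; apply; exact: retract_triangle.
exact: h (retract_triangle s).
Qed.

(** Boundedness by compactness of the unit square: it contains every retracted point, and retracting
    once more changes nothing. *)
Lemma ext_ckernel K : ccontinuous2 triangle K -> exists M, ckernel (ext K) M.
Proof.
move=> [c1 c2]; have d1 := continuous_ext_real c1; have d2 := continuous_ext_real c2.
have bnd (u : R * R -> R) : continuous (u \o retract) ->
    exists M, forall s, `|u (retract s)| <= M.
  move=> cu; pose Q : set (R * R) := (`[0, 1]%classic `*` `[0, 1]%classic).
  have cQ : compact Q by apply: compact_setX; exact: segment_compact.
  have [M [_ hM]] := compact_bounded (continuous_compact (continuous_subspaceT cu) cQ).
  exists (M + 1) => s; apply: (hM (M + 1)); first by rewrite ltrDl.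
  exists (retract s).
    have [/= h1 h2] := retract_triangle s; have /andP[a1 a2] := h1.
    split => /=; rewrite in_itv/=; first by rewrite a1 (le_trans a2).
    by rewrite h2 (le_trans a1).
  by rewrite /= retractK.
have [M1 h1] := bnd _ d1; have [M2 h2] := bnd _ d2.
exists (M1 + M2); split.
- exact: (continuous_measurable_plane d1).
- exact: (continuous_measurable_plane d2).
- by move=> x y; apply: le_trans (cabs_le _) (lerD (h1 (x, y)) (h2 (x, y))).
Qed.

End TriangularVolterra.

(** * The backstepping transformation *)

Section LeibnizRule.
Context {R : realType}.
Notation C := R[i].
Notation mu := (@lebesgue_measure R).
Implicit Types (f g v : R -> C) (a b x y : R) (k kx kxi : R -> R -> C).

Definition ccont_at (F : R * R -> C) (s : R * R) :=
  {for s, continuous (fun z => Re (F z))} /\ {for s, continuous (fun z => Im (F z))}.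

Lemma ext_cont k : ccontinuous2 triangle k -> forall s, ccont_at (fun z => ext k z.1 z.2) s.
Proof.
move=> [c1 c2] [x y]; split.
- by have := continuous_ext_real c1 (x := (x, y)).
- by have := continuous_ext_real c2 (x := (x, y)).
Qed.

Lemma continuous_curve k (u w : R -> R) (D : set R) : ccontinuous2 triangle k -> continuous u ->
  continuous w -> ccontinuous D (fun y => ext k (u y) (w y)).
Proof.
move=> ck cu cw; have cp y : (u z, w z) @[z --> y] --> (u y, w y) by exact: cvg_pair (cu y) (cw y).
split; apply: continuous_subspaceT => y.
- exact: (@cvg_comp _ _ _ (fun z => (u z, w z)) (fun z => Re (ext k z.1 z.2)) _ _ _ (cp y) (ext_cont ck (u y, w y)).1).
- exact: (@cvg_comp _ _ _ (fun z => (u z, w z)) (fun z => Im (ext k z.1 z.2)) _ _ _ (cp y) (ext_cont ck (u y, w y)).2).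
Qed.

Lemma L2_diag k v : ccontinuous2 triangle k -> L2 v -> L2 (fun x => ext k x x * v x).
Proof. by move=> ck; apply: L2_contM; apply: continuous_curve ck _ _ => x; exact: cvg_id. Qed.

Section x_derivative.
Variables (k kx : R -> R -> C) (M Mx : R).
Hypotheses (ck : ccontinuous2 triangle k) (ckx : ccontinuous2 triangle kx).
Hypotheses (kM : ckernel (ext k) M) (kxM : ckernel (ext kx) Mx).
Hypothesis dk : forall x y, 0 < x < y -> y < 1 -> is_cderive (fun z => k z y) x (kx x y).

Lemma AC_kernel_x y : 0 < y < 1 -> AC 0 y (fun x => ext k x y) (fun x => ext kx x y).
Proof.
move=> /andP[y0 y1].
have tri x : 0 <= x <= y -> triangle (x, y) by move=> h; split => //=; exact: ltW.
have e1 x : 0 <= x <= y -> ext k x y = k x y by move=> /tri/extE.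
have e2 x : 0 <= x <= y -> ext kx x y = kx x y by move=> /tri/extE.
have cy : continuous (fun _ : R => y) by move=> z; exact: cvg_cst.
have cid : continuous (fun z : R => z) by move=> z; exact: cvg_id.
have tr (K : R -> R -> C) : ccontinuous2 triangle K -> ccontinuous `[0, y] (fun x => K x y).
  move=> cK; have [c1 c2] := continuous_curve `[0, y] cK cid cy; split.
  - apply: (subspace_eq_continuous _ c1) => x; rewrite inE/= in_itv/= => x01.
    by rewrite /from_subspace/= extE//; exact: tri.
  - apply: (subspace_eq_continuous _ c2) => x; rewrite inE/= in_itv/= => x01.
    by rewrite /from_subspace/= extE//; exact: tri.
apply: (@AC_ext _ _ _ (fun x => k x y) _ (fun x => kx x y)).
- by move=> x /e1.
- by move=> x /e2.
apply: FTC_AC; [exact: ltW|exact: tr|exact: tr|].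
by move=> x x0y; exact: dk.
Qed.

(** Since [v] is only square integrable, the rule is proved in integrated form. The proposed
    derivative is integrated over [0, X] and the order exchanged; integrating [kx] in x then leaves
    values of [k] at the ends of the x-range, and the diagonal terms cancel. *)
Lemma leibniz_rule v : L2 v ->
  AC 0 1 (fun x => cint (fun y => ext k x y * v y) x 1)
         (fun x => - (ext k x x * v x) + cint (fun y => ext kx x y * v y) x 1).
Proof.
move=> hv; have iv := L2_i hv; have hT := L2_upper kxM hv; have hD := L2_diag ck hv.
split; first exact/L2_i/L2D/hT/L2N.
move=> X /andP[X0 X1].
have iD : cintegrable 0 X (fun x => ext k x x * v x) := cintegrableS (lexx _) X1 (L2_i hD).
have iT : cintegrable 0 X (fun x => cint (fun y => ext kx x y * v y) x 1) :=
  cintegrableS (lexx _) X1 (L2_i hT).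
rewrite (cintD (cintegrableN iD) iT) (cintN iD).
have iv0 := cintegrableS (lexx 0) X1 iv; have iv1 := cintegrableS X0 (lexx 1) iv.
have one a b : cintegrable a b (fun=> (1 : C)) := cintegrable_cst a b 1.
have i0 : cintegrable 0 1 (fun y => ext k 0 y * v y) := ckernel_intr 0 kM iv.
have rect := fubini_kernel kxM (one 0 X) iv1.
have tria := fubini_triangle kxM (lexx _) X0 X1 (one 0 1) iv.
have irect : cintegrable 0 X (fun x => cint (fun y => ext kx x y * v y) X 1).
  exact: cintegrable_kernel kxM iv1 0 X.
(* The region x <= X, x <= y <= 1 is cut at y = X into a triangle and a rectangle. *)
have splitE x : 0 <= x <= X -> cint (fun y => ext kx x y * v y) x 1 =
    1 * cint (fun y => ext kx x y * v y) x X + 1 * cint (fun y => ext kx x y * v y) X 1.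
  move=> /andP[x0 xX]; have ix : cintegrable x 1 (fun y => ext kx x y * v y).
    by apply: (ckernel_intr x kxM); exact: cintegrableS x0 (lexx 1) iv.
  rewrite (cint_chasles xX X1 ix); ring.
have itria : cintegrable 0 X (fun x => 1 * cint (fun y => ext kx x y * v y) x X).
  apply: (cintegrable_ext _ (cintegrableB iT irect)) => x xX.
  by rewrite (splitE x xX); ring.
have irect1 : cintegrable 0 X (fun x => 1 * cint (fun y => ext kx x y * v y) X 1).
  exact: cintegrableZ.
rewrite (eq_cint splitE) (cintD itria irect1) tria rect.
have bd y : 0 < y < 1 -> forall b, 0 <= b <= y ->
    cint (fun x => ext kx x y * 1) 0 b = ext k b y - ext k 0 y.
  move=> y01 b b0y; have [_ /(_ b b0y) ->] := AC_kernel_x y01.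
  by rewrite addrC addKr; apply: eq_cint => x _; rewrite mulr1.
(* On the triangle x runs up to y, which produces the diagonal value of [k]. *)
have ae1 : cint (fun y => v y * cint (fun x => ext kx x y * 1) 0 y) 0 X =
    cint (fun y => ext k y y * v y) 0 X - cint (fun y => ext k 0 y * v y) 0 X.
  have i00 := cintegrableS (lexx 0) X1 i0.
  rewrite -(cintB iD i00); apply: cint_ae.
  - have h := L2_kerop (ckernel_lower (ckernel_tr kxM)) (L2_cst (1 : C)).
    apply: (cintegrableS (lexx _) X1); apply: (cintegrable_ext _ (L2Mi hv h)) => y y01.
    congr (_ * _); rewrite (cint_lower y01 (ckernel_intl y kxM (one 0 1))).
    by apply: eq_cint => x _; case: ifP; rewrite ?mul0r.
  - exact: cintegrableB.
  - apply: aeS (ae_and (ae_neq 0) (ae_neq 1)) => y [y0 y1] /andP[y0' y1'].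
    have yy : 0 < y < 1 by rewrite !lt_neqAle eq_sym y0 y0' y1 (le_trans y1').
    have XX : 0 <= y <= y by rewrite y0' lexx.
    rewrite (bd y yy y XX); ring.
(* On the rectangle x runs up to [X] for every y, which produces the kernel integral at [X]. *)
have ae2 : cint (fun y => v y * cint (fun x => ext kx x y * 1) 0 X) X 1 =
    cint (fun y => ext k X y * v y) X 1 - cint (fun y => ext k 0 y * v y) X 1.
  have i1 : cintegrable X 1 (fun y => ext k X y * v y) := ckernel_intr X kM iv1.
  have i2 : cintegrable X 1 (fun y => ext k 0 y * v y) := ckernel_intr 0 kM iv1.
  rewrite -(cintB i1 i2); apply: cint_ae.
  - have h := L2_kerop (ckernel_tr kxM) (L2_cst (1 : C)).
    have h2 := cmeas_kernel (ckernel_tr kxM) (one 0 X) X 1.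
    have h3 y : X <= y <= 1 -> cabs (cint (fun x => ext kx x y * 1) 0 X) <= Mx * \int[mu]_(x in `[0, X]) cabs (1 : C).
      by move=> _; exact: (ckernel_bound y (ckernel_tr kxM) (one 0 X)).
    by apply: (cintegrable_ext _ (cintegrable_bM h2 h3 iv1)) => y _; rewrite mulrC.
  - exact: cintegrableB.
  - apply: aeS (ae_and (ae_neq 0) (ae_neq 1)) => y [y0 y1] /andP[Xy y1'].
    have yy : 0 < y < 1 by rewrite !lt_neqAle eq_sym y0 y1 y1' (le_trans X0).
    have XX : 0 <= X <= y by rewrite X0.
    rewrite (bd y yy X XX); ring.
rewrite ae1 ae2 (cint_chasles X0 X1 i0); ring.
Qed.
End x_derivative.

Lemma AC_kernel_xi k kxi x : ccontinuous2 triangle k -> ccontinuous2 triangle kxi ->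
  (forall x y, 0 < x < y -> y < 1 -> is_cderive (fun z => k x z) y (kxi x y)) ->
  0 < x < 1 -> AC x 1 (fun y => ext k x y) (fun y => ext kxi x y).
Proof.
move=> ck ckxi dk /andP[x0 x1].
have tri y : x <= y <= 1 -> triangle (x, y) by move=> /andP[xy y1]; split => //=; rewrite (ltW x0).
have cx : continuous (fun _ : R => x) by move=> z; exact: cvg_cst.
have cid : continuous (fun z : R => z) by move=> z; exact: cvg_id.
have tr (K : R -> R -> C) : ccontinuous2 triangle K -> ccontinuous `[x, 1] (fun y => K x y).
  move=> cK; have [c1 c2] := continuous_curve `[x, 1] cK cx cid; split.
  - apply: (subspace_eq_continuous _ c1) => y; rewrite inE/= in_itv/= => y01.
    by rewrite /from_subspace/= extE//; exact: tri.
  - apply: (subspace_eq_continuous _ c2) => y; rewrite inE/= in_itv/= => y01.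
    by rewrite /from_subspace/= extE//; exact: tri.
apply: (@AC_ext _ _ _ (fun y => k x y) _ (fun y => kxi x y)).
- by move=> y /tri/extE.
- by move=> y /tri/extE.
apply: FTC_AC; [exact: ltW|exact: tr|exact: tr|].
by move=> y /andP[xy y1]; apply: dk => //; rewrite x0.
Qed.

End LeibnizRule.

Section Backstepping.
Context {R : realType}.
Notation C := R[i].
Notation mu := (@lebesgue_measure R).
Implicit Types (f g v V Z : R -> C) (a b x y : R).

Lemma cvg_ball_le (T : pseudoMetricType R) (u : T -> R) (s : T) (l e : R) :
  u z @[z --> s] --> l -> 0 < e ->
  exists2 d : R, 0 < d & forall z, ball s d z -> `|l - u z| <= e.
Proof.
by move=> /cvgrPdist_le h e0; have /nbhs_ballP[d d0 hd] := h _ e0; exists d => // z /hd.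
Qed.

Lemma ccont_at_eps (F : R * R -> C) x y (e : R) : ccont_at F (x, y) -> 0 < e ->
  exists2 d : R, 0 < d & forall x' y', `|x - x'| < d -> `|y - y'| < d ->
    cabs (F (x', y') - F (x, y)) <= e.
Proof.
move=> [c1 c2] e0; have e2 : 0 < e / 2 by lra.
have [d1 d10 h1] := cvg_ball_le c1 e2.
have [d2 d20 h2] := cvg_ball_le c2 e2.
exists (Num.min d1 d2); first by rewrite lt_min d10.
move=> x' y'; rewrite !lt_min => /andP[x1 x2] /andP[y1 y2].
have {}h1 := h1 (x', y') (conj x1 y1); have {}h2 := h2 (x', y') (conj x2 y2).
apply: (le_trans (cabs_le _)); rewrite !cE distrC (distrC (Im _)).
by apply: (le_trans (lerD h1 h2)); lra.
Qed.

Lemma ccontinuous_eps a b f x (e : R) : ccontinuous `[a, b] f -> a < x < b -> 0 < e ->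
  exists2 d : R, 0 < d & forall y, `|x - y| < d -> cabs (f y - f x) <= e.
Proof.
move=> [c1 c2] /[dup] axb /andP[ax xb] e0; have ab := lt_trans ax xb.
have e2 : 0 < e / 2 by lra.
have xi : x \in `]a, b[ by rewrite in_itv.
move: c1 c2 => /(continuous_within_itvP _ ab)[/(_ x xi) c1 _ _] /(continuous_within_itvP _ ab)[/(_ x xi) c2 _ _].
have [d1 d10 h1] := cvg_ball_le c1 e2.
have [d2 d20 h2] := cvg_ball_le c2 e2.
exists (Num.min d1 d2); first by rewrite lt_min d10.
move=> y; rewrite !lt_min => /andP[x1 x2].
have {}h1 := h1 y x1; have {}h2 := h2 y x2.
apply: (le_trans (cabs_le _)); rewrite !cE distrC (distrC (Im _)).
by apply: (le_trans (lerD h1 h2)); lra.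
Qed.

Lemma ccontinuousD (A : set R) f g : ccontinuous A f -> ccontinuous A g ->
  ccontinuous A (fun x => f x + g x).
Proof.
move=> [f1 f2] [g1 g2]; split.
- by rewrite (_ : (fun x => _) = (fun x => Re (f x) + Re (g x))); [move=> x; apply: cvgD; [exact: f1|exact: g1]|apply/funext => x; rewrite cE].
- by rewrite (_ : (fun x => _) = (fun x => Im (f x) + Im (g x))); [move=> x; apply: cvgD; [exact: f2|exact: g2]|apply/funext => x; rewrite cE].
Qed.

Lemma ccontinuousZ (A : set R) (k : C) f : ccontinuous A f -> ccontinuous A (fun x => k * f x).
Proof.
move=> [f1 f2]; have c (r : R) : {within A, continuous (fun=> r)} by move=> x; exact: cvg_cst.
split.
- rewrite (_ : (fun x => _) = (fun x => Re k * Re (f x) - Im k * Im (f x))); last by apply/funext => x; rewrite cE.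
  by move=> x; apply: cvgB; apply: cvgM; [exact: c|exact: f1|exact: c|exact: f2].
- rewrite (_ : (fun x => _) = (fun x => Re k * Im (f x) + Im k * Re (f x))); last by apply/funext => x; rewrite cE.
  by move=> x; apply: cvgD; apply: cvgM; [exact: c|exact: f2|exact: c|exact: f1].
Qed.

Lemma ccontinuous_cst (A : set R) (k : C) : ccontinuous A (fun=> k).
Proof. by split=> x; exact: cvg_cst. Qed.

Variables (q co : R) (h : R -> C) (p px pxi pxx pxxi pxixi : R -> R -> C).
Hypothesis hh : ccontinuous I01 h.
Hypothesis hp : is_kernel q co h p px pxi pxx pxxi pxixi.

Let cp : ccontinuous2 triangle p. Proof. by case: hp => -[[]]. Qed.
Let cpx : ccontinuous2 triangle px. Proof. by case: hp => -[[]]. Qed.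
Let cpxi : ccontinuous2 triangle pxi. Proof. by case: hp => -[[]]. Qed.
Let cpxx : ccontinuous2 triangle pxx. Proof. by case: hp => -[_ []]. Qed.
Let cpxixi : ccontinuous2 triangle pxixi. Proof. by case: hp => -[_ []]. Qed.
Let dp x y : 0 < x < y -> y < 1 -> is_cderive (fun z => p z y) x (px x y).
Proof. by case: hp => -[_ _ d] _ _ _ xy y1; case: (d x y xy y1). Qed.
Let dpx x y : 0 < x < y -> y < 1 -> is_cderive (fun z => px z y) x (pxx x y).
Proof. by case: hp => -[_ _ d] _ _ _ xy y1; case: (d x y xy y1). Qed.
Let dpxi x y : 0 < x < y -> y < 1 -> is_cderive (fun z => p x z) y (pxi x y).
Proof. by case: hp => -[_ _ d] _ _ _ xy y1; case: (d x y xy y1). Qed.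
Let dpxixi x y : 0 < x < y -> y < 1 -> is_cderive (fun z => pxi x z) y (pxixi x y).
Proof. by case: hp => -[_ _ d] _ _ _ xy y1; case: (d x y xy y1). Qed.

(** The derivative of x -> p(x,x), read off from the diagonal condition on the kernel. *)
Let d1 x : C := - ('i%C / 2%:R) * (h x + co%:C).
Let Tr (k : R -> R -> C) f x := cint (fun y => ext k x y * f y) x 1.

Let diag_tri x : 0 <= x <= 1 -> triangle (x, x).
Proof. by move=> /andP[x0 x1]; split => //=; rewrite x0 lexx. Qed.

Let hco_i : cintegrable 0 1 (fun y => h y + co%:C).
Proof. by apply: cintegrableD; [exact: ccontinuous_integrable|exact: cintegrable_cst]. Qed.

Lemma AC_diag : AC 0 1 (fun x => ext p x x) d1.
Proof.
have [_ _ _ e] := hp.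
apply: (@AC_ext _ _ _ (fun x => - ('i%C / 2%:R) * (0 + cint (fun y => h y + co%:C) 0 x) - 'i%C * q%:C) _
  (fun x => - ('i%C / 2%:R) * (h x + co%:C) - 0)).
- by move=> x x01; rewrite extE ?e ?add0r//; exact: diag_tri.
- by move=> x _; rewrite subr0.
by apply: ACB; [apply: ACZ; exact: AC_primitive|exact: AC_cst].
Qed.

(** The chain rule on the diagonal, where the partial derivatives are not given as derivatives but
    only as continuous extensions from the open triangle. The increment of p between (x,x) and (y,y)
    is integrated inside the triangle, and continuity is used as y tends to x. *)
Lemma diag_derivative x : 0 < x < 1 -> ext px x x + ext pxi x x = d1 x.
Proof.
move=> /[dup] x01 /andP[x0 x1].
set c := ext px x x + ext pxi x x - d1 x.
suff : cabs c = 0 by move=> /cabs_eq0/eqP; rewrite subr_eq0 => /eqP.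
apply/eqP; rewrite eq_le cabs_ge0 andbT; apply/ler_addgt0Pl => e e0; rewrite addr0.
have e3 : 0 < e / 3 by lra.
have [da da0 ha] := ccont_at_eps (ext_cont cpx (x, x)) e3.
have [db db0 hb] := ccont_at_eps (ext_cont cpxi (x, x)) e3.
have cd1 : ccontinuous `[0, 1] d1.
  by apply/ccontinuousZ/ccontinuousD; [exact: hh|exact: ccontinuous_cst].
have [dc dc0 hc] := ccontinuous_eps cd1 x01 e3.
(* Half of the minimum lies strictly below the three radii and keeps x + d below 1. *)
set d := Num.min (Num.min da db) (Num.min dc (1 - x)) / 2.
have [dda [ddb [ddc [dd1 d0]]]] : d < da /\ d < db /\ d < dc /\ x + d < 1 /\ 0 < d.
  have m0 : 0 < Num.min (Num.min da db) (Num.min dc (1 - x)) by rewrite !lt_min da0 db0 dc0; lra.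
  have [] : Num.min (Num.min da db) (Num.min dc (1 - x)) <= da /\ Num.min (Num.min da db) (Num.min dc (1 - x)) <= db by rewrite !ge_min !lexx !orbT.
  have [] : Num.min (Num.min da db) (Num.min dc (1 - x)) <= dc /\ Num.min (Num.min da db) (Num.min dc (1 - x)) <= 1 - x by rewrite !ge_min !lexx !orbT.
  by rewrite /d; lra.
set y := x + d; have xy : x <= y by rewrite lerDl ltW.
have y01 : 0 < y < 1 by rewrite dd1 andbT; exact: lt_le_trans x0 xy.
have [y0 y1] := andP y01.
have Ax := ACS (ltW x0) (lexx y) (AC_kernel_x cp cpx dp y01).
have Axi := ACS (lexx x) (ltW y1) (AC_kernel_xi cp cpxi dpxi x01).
have Ad := ACS (ltW x0) (ltW y1) AC_diag.
(* The increment p(y,y) - p(x,x), computed along (x,x), (x,y), (y,y) and along the diagonal. *)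
have key : cint (fun s => ext px s y + ext pxi x s - d1 s) x y = 0.
  rewrite (cintB (cintegrableD Ax.1 Axi.1) Ad.1) (cintD Ax.1 Axi.1).
  by rewrite (AC_bnd xy Ax) (AC_bnd xy Axi) (AC_bnd xy Ad); ring.
have iK := cintegrableB (cintegrableD Ax.1 Axi.1) Ad.1.
have ic := cintegrable_cst x y c.
have : cabs (cint (fun s => (ext px s y + ext pxi x s - d1 s) - c) x y) <= e * (y - x).
  apply: cint_bound => //; first exact: cintegrableB.
  move=> s /andP[xs sy].
  have ds : `|x - s| <= d by rewrite ler_distlC; move: xs sy; rewrite /y; lra.
  have dy : `|x - y| <= d by rewrite /y opprD addNKr normrN gtr0_norm.
  have dx : `|x - x| < db by rewrite subrr normr0.
  have {ha} := ha s y (le_lt_trans ds dda) (le_lt_trans dy dda).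
  have {hb} := hb x s dx (le_lt_trans ds ddb).
  have {hc} := hc s (le_lt_trans ds ddc) => /= b3 b2 b1.
  have -> : ext px s y + ext pxi x s - d1 s - c =
    (ext px s y - ext px x x) + (ext pxi x s - ext pxi x x) - (d1 s - d1 x) by rewrite /c; ring.
  apply: (le_trans (cabsB _ _)); apply: (le_trans (lerD (cabsD _ _) b3)).
  by apply: (le_trans (lerD (lerD b1 b2) (lexx _))); lra.
rewrite (cintB iK ic) key sub0r cabsN (cint_cst c xy) cabsM cabs_real.
have yx : y - x = d by rewrite /y addrC addKr.
by rewrite yx (gtr0_norm d0) ler_pM2r.
Qed.

(** F_o with the kernel extended to the plane. The next two definitions are its first and second
    derivative as given by Leibniz's rule, with [V1] and [V2] in the place of V' and V''. *)
Definition transform V x := V x - Tr p V x.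
Definition transform1 V V1 x := V1 x + ext p x x * V x - Tr px V x.
Definition transform2 V V1 V2 x :=
  V2 x + (d1 x * V x + ext p x x * V1 x) + ext px x x * V x - Tr pxx V x.

Lemma FoE f x : 0 <= x <= 1 -> Fo p f x = transform f x.
Proof.
move=> /andP[x0 x1]; congr (_ - _); apply: eq_cint => y /andP[xy y1].
by rewrite extE//; split => //=; rewrite x0.
Qed.

Let AC_Tp v : L2 v -> AC 0 1 (Tr p v) (fun x => - (ext p x x * v x) + Tr px v x).
Proof.
by have [M hM] := ext_ckernel cp; have [N hN] := ext_ckernel cpx; exact: leibniz_rule hM hN dp v.
Qed.

Let AC_Tpx v : L2 v -> AC 0 1 (Tr px v) (fun x => - (ext px x x * v x) + Tr pxx v x).
Proof.
by have [M hM] := ext_ckernel cpx; have [N hN] := ext_ckernel cpxx; exact: leibniz_rule hM hN dpx v.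
Qed.

Let L2_Tr k v : ccontinuous2 triangle k -> L2 v -> L2 (Tr k v).
Proof. by move=> ck; have [M hM] := ext_ckernel ck; exact: L2_upper hM v. Qed.

Let L2_d1 v : L2 v -> L2 (fun x => d1 x * v x).
Proof.
move=> hv; have : L2 (fun x => - ('i%C / 2%:R) * (h x * v x + co%:C * v x)).
  by apply/L2Z/L2D; [exact: L2_contM|exact: L2Z].
by congr L2; apply/funext => x; rewrite /d1; ring.
Qed.

Lemma transform_H2 V V1 V2 : AC 0 1 V V1 -> AC 0 1 V1 V2 -> L2 V2 ->
  [/\ AC 0 1 (transform V) (transform1 V V1),
      AC 0 1 (transform1 V V1) (transform2 V V1 V2) & L2 (transform2 V V1 V2)].
Proof.
move=> A1 A2 h2; have hV := L2_AC A1; have hV1 := L2_AC A2.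
split.
- apply: (AC_ext _ _ (ACB A1 (AC_Tp hV))) => // x _.
  by rewrite /transform1; ring.
- apply: (AC_ext _ _ (ACB (ACD A2 (ACM AC_diag A1)) (AC_Tpx hV))) => // x _.
  by rewrite /transform2; ring.
- by apply: L2B (L2_Tr cpxx hV); apply: L2D (L2_diag cpx hV); apply: L2D => //;
    apply: L2D (L2_d1 hV) (L2_diag cp hV1).
Qed.

(** Regularity is gained from the equation V = Z + (Volterra integral of V): for square-integrable V
    the integral is already absolutely continuous, hence so is V, and the same argument applies to
    V'. *)
Lemma inverse_H2 V Z Z1 Z2 : L2 V -> (forall x, 0 <= x <= 1 -> Z x = transform V x) ->
  AC 0 1 Z Z1 -> AC 0 1 Z1 Z2 -> L2 Z2 ->
  exists V1 V2, [/\ AC 0 1 V V1, AC 0 1 V1 V2, L2 V2,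
    forall x, 0 <= x <= 1 -> Z1 x = transform1 V V1 x &
    forall x, 0 <= x <= 1 -> Z2 x = transform2 V V1 V2 x].
Proof.
move=> hV e A1 A2 h2.
pose V1 x := Z1 x + (- (ext p x x * V x) + Tr px V x).
have B1 : AC 0 1 V V1.
  by apply: (AC_ext _ _ (ACD A1 (AC_Tp hV))) => // x x01; rewrite e// /transform; ring.
pose V2 x := Z2 x - (d1 x * V x + ext p x x * V1 x) + (- (ext px x x * V x) + Tr pxx V x).
have B2 : AC 0 1 V1 V2.
  apply: (AC_ext _ _ (ACD (ACB A2 (ACM AC_diag B1)) (AC_Tpx hV))) => // x x01.
  by rewrite /V1; ring.
have hV1 := L2_AC B2.
exists V1, V2; split; [exact: B1|exact: B2| | |].
- apply: L2D; first by apply: L2B => //; apply: L2D (L2_d1 hV) (L2_diag cp hV1).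
  by apply: L2D (L2_Tr cpxx hV); apply: L2N; exact: L2_diag.
- by move=> x _; rewrite /V1 /transform1; ring.
- by move=> x _; rewrite /V2 /transform2; ring.
Qed.

(** The conditions p(0,0) = -iq and p_x(0,.) = -iq p(0,.) are made for this: the Robin condition on
    the image at 0 becomes a Neumann condition on V. *)
Lemma transform_bnd0 V V1 : L2 V ->
  transform1 V V1 0 = - 'i%C * q%:C * transform V 0 + V1 0.
Proof.
move=> hV; have [_ _ e0 e1] := hp; have [M hM] := ext_ckernel cp.
have z1 : 0 <= (0 : R) <= 1 by rewrite lexx ler01.
rewrite /transform1 /transform (extE _ (diag_tri z1)) e1// cint_pt.
have -> : Tr px V 0 = cint (fun y => - ('i%C * q%:C) * (ext p 0 y * V y)) 0 1.
  apply: eq_cint => y y01; have t : triangle (0, y) by split => /=; rewrite ?lexx; case/andP: y01.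
  by rewrite !extE// -[px 0 y](addrK ('i%C * q%:C * p 0 y)) e0//; ring.
rewrite (cintZ _ (ckernel_intr 0 hM (L2_i hV))) -/(Tr p V 0); ring.
Qed.

Lemma transform_at1 V : transform V 1 = V 1.
Proof. by rewrite /transform /Tr cint_pt subr0. Qed.

(** As V(1) is also the value of the image at 1, the gain l_0 = p(1,1) leaves V'(1) = 0. *)
Lemma transform1_at1 V V1 : transform1 V V1 1 = V1 1 + p 1 1 * V 1.
Proof.
by rewrite /transform1 /Tr cint_pt subr0 extE//; apply: diag_tri; rewrite ler01 lexx.
Qed.

(** Two integrations by parts in xi take the derivatives off V''; the kernel equation turns p_{xi
    xi} into p_{xx} plus the potential term, and [diag_derivative] cancels the contributions of the
    diagonal. Those of xi = 1 remain, and the part of l containing p_xi(x,1) exists to cancel one of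
    them. *)
Lemma transform_equation V V1 V2 x : AC 0 1 V V1 -> AC 0 1 V1 V2 -> L2 V2 -> 0 < x < 1 ->
  - 'i%C * transform2 V V1 V2 x + h x * transform V x =
  transform (fun y => - 'i%C * V2 y - co%:C * V y) x +
  'i%C * pxi x 1 * V 1 - 'i%C * p x 1 * V1 1.
Proof.
move=> A1 A2 h2 /[dup] x01 /andP[x0 x1]; have hV := L2_AC A1.
have [_ e _ _] := hp.
have [M hM] := ext_ckernel cp; have [N hN] := ext_ckernel cpxx.
have B1 := ACS (ltW x0) (lexx 1) A1; have B2 := ACS (ltW x0) (lexx 1) A2.
have ip f : L2 f -> cintegrable x 1 (fun y => ext p x y * f y).
  by move=> hf; apply: (ckernel_intr x hM); exact: cintegrableS (ltW x0) (lexx 1) (L2_i hf).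
have ipxx : cintegrable x 1 (fun y => ext pxx x y * V y).
  by apply: (ckernel_intr x hN); exact: cintegrableS (ltW x0) (lexx 1) (L2_i hV).
have K1 := AC_kernel_xi cp cpxi dpxi x01; have K2 := AC_kernel_xi cpxi cpxixi dpxixi x01.
have key := AC_by_parts2 (ltW x1) B1 B2 K1 K2.
have tx1 : triangle (x, 1) by split => //=; rewrite !ltW.
rewrite /= in key.
have e1 : Tr p (fun y => - 'i%C * V2 y - co%:C * V y) x =
    - 'i%C * Tr p V2 x - co%:C * Tr p V x.
  rewrite -(cintZ _ (ip _ h2)) -(cintZ _ (ip _ hV)).
  rewrite -(cintB (cintegrableZ _ (ip _ h2)) (cintegrableZ _ (ip _ hV))).
  by apply: eq_cint => y _; ring.
have e2 : Tr p V2 x = cint (fun y => V2 y * ext p x y) x 1 by apply: eq_cint => y _; exact: mulrC.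
have e3 : cint (fun y => V y * ext pxixi x y) x 1 =
    Tr pxx V x + 'i%C * (h x + co%:C) * Tr p V x.
  rewrite -(cintZ _ (ip _ hV)) -(cintD ipxx (cintegrableZ _ (ip _ hV))).
  apply: eq_cint => y /andP[xy y1]; have t : triangle (x, y) by split => //=; rewrite (ltW x0).
  by rewrite !extE// -[pxixi x y](subrK (pxx x y)) e//; ring.
have := diag_derivative x01; rewrite /d1 => dd.
rewrite /transform2 /transform e1 e2 key e3 !(extE _ tx1).
have -> : ext pxi x x = - ('i%C / 2%:R) * (h x + co%:C) - ext px x x by rewrite -dd addrC addKr.
have ii : 'i%C * 'i%C = -1 :> C by rewrite -expr2 sqr_i.
apply/eqP; rewrite -subr_eq0; apply/eqP; rewrite /d1.
(* The imaginary unit is an atom for [field]; what is left is a multiple of 1 + i^2. *)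
apply: (@eq_trans _ _ ((1 + 'i%C * 'i%C) * (h x + co%:C) * (V x - Tr p V x))); first by field.
by rewrite ii subrr !mul0r.
Qed.

End Backstepping.

(** * Linear differential equations *)

Section LinearODE.
Context {R : realType}.
Notation C := R[i].
Notation mu := (@lebesgue_measure R).
Implicit Types (y b f : R -> C) (s t T m B : R) (lam : C).

Definition cexp lam t : C :=
  (expR (Re lam * t))%:C * ((cos (Im lam * t))%:C + 'i%C * (sin (Im lam * t))%:C).

Lemma cexp0 lam : cexp lam 0 = 1.
Proof. by rewrite /cexp !mulr0 expR0 cos0 sin0 mulr0 addr0 mulr1. Qed.

Lemma cabs_cexp lam t : cabs (cexp lam t) = expR (Re lam * t).
Proof.
rewrite cabsM cabs_real ger0_norm ?expR_ge0//.
have -> : cabs ((cos (Im lam * t))%:C + 'i%C * (sin (Im lam * t))%:C) = 1; last by rewrite mulr1.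
apply/eqP; rewrite -(eqrXn2 (n := 2))// ?cabs_ge0// sqr_cabs !cE.
by apply/eqP; rewrite expr1n -[RHS](cos2Dsin2 (Im lam * t)); ring.
Qed.

Lemma cexpN lam t : cexp lam t * cexp (- lam) t = 1.
Proof.
have e : expR (Re lam * t) * expR (- Re lam * t) = 1 by rewrite -expRD mulNr subrr expR0.
have := cos2Dsin2 (Im lam * t); set c := cos _; set s := sin _ => cs.
rewrite /cexp ReN ImN [- Im lam * t]mulNr cosN sinN -/c -/s.
apply: complexP; rewrite !cE.
- by apply: (@eq_trans _ _ ((expR (Re lam * t) * expR (- Re lam * t)) * (c ^+ 2 + s ^+ 2))); [ring|rewrite e cs mulr1].
- by ring.
Qed.

Lemma AC_cexp lam T : 0 <= T -> AC 0 T (cexp lam) (fun t => lam * cexp lam t).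
Proof.
move=> T0.
have dl (a s : R) : is_derive s 1 (fun z => a * z) a.
  by apply: is_derive_eq; rewrite /GRing.scale/= mulr1 ?mulr0 ?addr0.
have cl (a : R) : continuous (fun z => a * z) by move=> z; apply: cvgM; [exact: cvg_cst|exact: cvg_id].
have cc : continuous (fun z => cos (Im lam * z)).
  by move=> z; apply: continuous_comp; [exact: cl|exact: continuous_cos].
have cs : continuous (fun z => sin (Im lam * z)).
  by move=> z; apply: continuous_comp; [exact: cl|exact: continuous_sin].
have A1 : AC 0 T (fun t => (expR (Re lam * t))%:C) (fun t => (Re lam * expR (Re lam * t))%:C).
  apply: AC_real => //; [|exact: continuous_expRM|exact: is_derive_expRM].
  by move=> z; apply: cvgM; [exact: cvg_cst|exact: continuous_expRM].
have A2 : AC 0 T (fun t => (cos (Im lam * t))%:C) (fun t => (- sin (Im lam * t) * Im lam)%:C).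
  apply: (AC_real T0 _ cc); first by move=> z; apply: cvgM; [apply: cvgN; exact: cs|exact: cvg_cst].
have A3 : AC 0 T (fun t => (sin (Im lam * t))%:C) (fun t => (cos (Im lam * t) * Im lam)%:C).
  apply: (AC_real T0 _ cs); first by move=> z; apply: cvgM; [exact: cc|exact: cvg_cst].
apply: (AC_ext _ _ (ACM A1 (ACD A2 (ACZ 'i%C A3)))) => // t _.
by apply: complexP; rewrite /cexp !cE; ring.
Qed.

(** Integrating factor: exp(-lam s) y(s) has derivative exp(-lam s) b(s). *)
Lemma ode1_formula lam b y t : 0 <= t -> cintegrable 0 t b -> cintegrable 0 t y ->
  (forall s, 0 <= s <= t -> y s = y 0 + lam * cint y 0 s + cint b 0 s) ->
  y t = cexp lam t * (y 0 + cint (fun s => cexp (- lam) s * b s) 0 t).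
Proof.
move=> t0 ib iy hy.
have Ay : AC 0 t y (fun s => lam * y s + b s).
  split; first exact: cintegrableD (cintegrableZ lam iy) ib.
  move=> s /[dup] s0t /andP[s0 st]; rewrite hy//.
  have iys := cintegrableS (lexx 0) st iy; have ibs := cintegrableS (lexx 0) st ib.
  by rewrite (cintD (cintegrableZ lam iys) ibs) (cintZ lam iys) addrA.
have /AC_ext : AC 0 t (fun s => cexp (- lam) s * y s) _ := ACM (AC_cexp (- lam) t0) Ay.
move=> /(_ (fun s => cexp (- lam) s * y s) (fun s => cexp (- lam) s * b s)) [//| |_ /(_ t)].
  by move=> s _; ring.
rewrite t0 lexx cexp0 mul1r => /(_ isT) <-.
by rewrite mulrA cexpN mul1r.
Qed.

Lemma ode1_solution lam b (y0 : C) T : 0 <= T -> cintegrable 0 T b ->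
  AC 0 T (fun t => cexp lam t * (y0 + cint (fun s => cexp (- lam) s * b s) 0 t))
    (fun t => lam * (cexp lam t * (y0 + cint (fun s => cexp (- lam) s * b s) 0 t)) + b t).
Proof.
move=> T0 ib; have iE := AC_integrableM (AC_cexp (- lam) T0) ib.
apply: (AC_ext _ _ (ACM (AC_cexp lam T0) (AC_primitive y0 iE))) => // t _.
rewrite -[b t in RHS]mul1r -(cexpN lam t); ring.
Qed.

(** The convolution of exp(-m (t - s)) with exp(-co s) is at most exp(-m t) / (co - m); the strict
    inequality m < co excludes a factor t. *)
Lemma ode1_decay lam b (y0 : C) t m co B : 0 <= t -> cintegrable 0 t b ->
  Re lam <= - m -> m < co -> 0 <= B -> cabs y0 <= B ->
  (forall s, 0 <= s <= t -> cabs (b s) <= B * expR (- co * s)) ->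
  cabs (cexp lam t * (y0 + cint (fun s => cexp (- lam) s * b s) 0 t)) <=
  (1 + (co - m)^-1) * B * expR (- m * t).
Proof.
move=> t0 ib lm mco B0 hy hb.
have iE := AC_integrableM (AC_cexp (- lam) t0) ib.
rewrite mulrDr; apply: (le_trans (cabsD _ _)).
have e1 : cabs (cexp lam t * y0) <= expR (- m * t) * B.
  rewrite cabsM cabs_cexp; apply: (ler_pM (expR_ge0 _) (cabs_ge0 _) _ hy).
  by rewrite ler_expR; exact: ler_wpM2r.
have cm : m - co < 0 by lra.
have iu : rintegrable 0 t (fun s => B * expR (- m * t) * expR ((m - co) * s)).
  by apply: rintegrableZ; exact: rintegrable_expRM.
have e2 : cabs (cexp lam t * cint (fun s => cexp (- lam) s * b s) 0 t) <=
    \int[mu]_(s in `[0, t]) (B * expR (- m * t) * expR ((m - co) * s)).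
  rewrite -(cintZ (cexp lam t) iE).
  apply: cint_le iu _; first exact: cintegrableZ.
  move=> s /[dup] s0t /andP[s0 st]; rewrite (cabsM (cexp lam t)) (cabsM (cexp (- lam) s) (b s)) !cabs_cexp ReN.
  apply: (@le_trans _ _ (expR (- m * (t - s)) * (B * expR (- co * s)))).
    rewrite mulrA -expRD; apply: (ler_pM (expR_ge0 _) (cabs_ge0 _) _ (hb s s0t)).
    rewrite ler_expR; rewrite (_ : Re lam * t + - Re lam * s = Re lam * (t - s)); last by ring.
    by apply: ler_wpM2r => //; rewrite subr_ge0.
  rewrite mulrCA -expRD -mulrA -expRD; apply: ler_wpM2l => //; rewrite ler_expR; lra.
have e3 : \int[mu]_(s in `[0, t]) (B * expR (- m * t) * expR ((m - co) * s)) <=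
    (co - m)^-1 * B * expR (- m * t).
  have -> : \int[mu]_(s in `[0, t]) (B * expR (- m * t) * expR ((m - co) * s)) =
     B * expR (- m * t) * ((expR ((m - co) * t) - expR ((m - co) * 0)) / (m - co)).
    have ie : rintegrable 0 t (fun s : R => expR ((m - co) * s)) := rintegrable_expRM _ _ _.
    by rewrite RintegralZl ?rint_expRM//; lra.
  rewrite mulr0 expR0 [X in _ <= X](_ : _ = B * expR (- m * t) * (co - m)^-1); last by ring.
  apply: ler_wpM2l; first by rewrite mulr_ge0// expR_ge0.
  rewrite -[m - co]opprB invrN mulrN -mulNr opprB ler_piMl//; first by rewrite invr_ge0; lra.
by apply: (le_trans (lerD e1 (le_trans e2 e3))); lra.
Qed.

Lemma halfline_continuous f : (forall T, 0 <= T -> ccontinuous `[0, T] f) ->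
  ccontinuous [set t | 0 <= t] f.
Proof.
have real (u : R -> R) : (forall T, 0 <= T -> {within `[0, T], continuous u}) ->
    {within [set t | 0 <= t], continuous u}.
  move=> hu; apply/subspace_continuousP => x /= x0.
  have x1 : 0 <= x + 1 by lra.
  have := hu _ x1 => /subspace_continuousP/(_ x); rewrite /= in_itv/= x0 lerDl ler01 => /(_ isT).
  move=> h; apply/cvgrPdist_le => e e0; move/cvgrPdist_le: h => /(_ e e0).
  rewrite /within/= => h.
  have h1 : \forall z \near x, `|x - z| < 1 by apply/nbhs_ballP; exists 1 => //= z.
  have {}h : nbhs x (fun z => `[0, x + 1]%classic z -> `|u x - u z| <= e) := h.
  suff : nbhs x (fun z => 0 <= z -> `|u x - u z| <= e) by [].
  apply: filterS2 h h1 => z {}h {}h1 z0.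
  by apply: h; rewrite /= in_itv/= z0/=; move: h1; rewrite ltr_distlC => /andP[_ /ltW]; lra.
by move=> hf; split; apply: real => T T0; have [] := hf T T0.
Qed.

Lemma ccontinuousS (A A' : set R) f : A `<=` A' -> ccontinuous A' f -> ccontinuous A f.
Proof. by move=> AA [h1 h2]; split; [exact: continuous_subspaceW h1|exact: continuous_subspaceW h2]. Qed.

Lemma halfline_integrable f t : ccontinuous [set t | 0 <= t] f -> cintegrable 0 t f.
Proof.
move=> h; apply: ccontinuous_integrable; apply: ccontinuousS h => s/=.
by rewrite in_itv/= => /andP[].
Qed.
End LinearODE.

(** * Linear systems with simple spectrum *)

Section MatrixODE.
Context {R : realType}.
Notation C := R[i].
Notation mu := (@lebesgue_measure R).
Notation halfline := [set t : R | 0 <= t].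
Implicit Types (s t T B : R).

Lemma mulmxE_col m n (P : 'M[C]_(m, n)) (v : 'cV[C]_n) i :
  (P *m v) i 0 = \sum_j P i j * v j 0.
Proof. by rewrite mxE. Qed.

Lemma mulmx_bound m n (P : 'M[C]_(m, n)) : exists2 c : R, 0 <= c & forall (v : 'cV[C]_n) B,
  0 <= B -> (forall j, cabs (v j 0) <= B) -> forall i, cabs ((P *m v) i 0) <= c * B.
Proof.
exists (\sum_i \sum_j cabs (P i j)); first by apply: sumr_ge0 => i _; apply: sumr_ge0 => j _; exact: cabs_ge0.
move=> v B B0 hv i; rewrite mulmxE_col; apply: (le_trans (cabs_sum _ _ _)).
apply: (@le_trans _ _ (\sum_j cabs (P i j) * B)).
  by apply: ler_sum => j _; rewrite cabsM; apply: ler_wpM2l (hv j); exact: cabs_ge0.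
rewrite -mulr_suml; apply: ler_wpM2r => //.
rewrite (bigD1 i)//= lerDl; apply: sumr_ge0 => k _; apply: sumr_ge0 => j _; exact: cabs_ge0.
Qed.

Lemma ccontinuous_sum (D : set R) I (r : seq I) (F : I -> R -> C) :
  (forall i, ccontinuous D (F i)) -> ccontinuous D (fun x => \sum_(i <- r) F i x).
Proof.
move=> h; elim: r => [|i r IH].
  by under eq_fun do rewrite big_nil; exact: ccontinuous_cst.
by under eq_fun do rewrite big_cons; exact: ccontinuousD.
Qed.

Lemma vcontinuous_mulmx (D : set R) m n (P : 'M[C]_(m, n)) (w : R -> 'cV[C]_n) :
  vcontinuous D w -> vcontinuous D (fun t => P *m w t).
Proof.
move=> h i; under eq_fun do rewrite mulmxE_col.
by apply: ccontinuous_sum => j; exact: ccontinuousZ.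
Qed.

Lemma vcontinuousD (D : set R) n (v w : R -> 'cV[C]_n) :
  vcontinuous D v -> vcontinuous D w -> vcontinuous D (fun t => v t + w t).
Proof. by move=> h1 h2 i; under eq_fun do rewrite mxE; exact: ccontinuousD. Qed.

Lemma vcontinuous_scale (D : set R) n (f : R -> C) (v : 'cV[C]_n) :
  ccontinuous D f -> vcontinuous D (fun t => f t *: v).
Proof. by move=> h i; under eq_fun do rewrite mxE mulrC; exact: ccontinuousZ. Qed.

Lemma vcontinuousZ (D : set R) n (c : C) (w : R -> 'cV[C]_n) :
  vcontinuous D w -> vcontinuous D (fun t => c *: w t).
Proof. by move=> h i; under eq_fun do rewrite mxE; exact: ccontinuousZ. Qed.

Lemma vintegrable n (w : R -> 'cV[C]_n) t i : vcontinuous halfline w ->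
  cintegrable 0 t (fun s => w s i 0).
Proof. by move=> h; exact: halfline_integrable. Qed.

Lemma vint_mulmx m n (P : 'M[C]_(m, n)) (w : R -> 'cV[C]_n) t : vcontinuous halfline w ->
  vint (fun s => P *m w s) 0 t = P *m vint w 0 t.
Proof.
move=> h; apply/matrixP => i j; rewrite ord1 mulmxE_col mxE.
under eq_cint do rewrite mulmxE_col.
rewrite cint_sum; last by move=> k; apply: cintegrableZ; exact: vintegrable.
by apply: eq_bigr => k _; rewrite mxE (cintZ _ (vintegrable t k h)).
Qed.

Lemma vintD n (v w : R -> 'cV[C]_n) t : vcontinuous halfline v -> vcontinuous halfline w ->
  vint (fun s => v s + w s) 0 t = vint v 0 t + vint w 0 t.
Proof.
move=> h1 h2; apply/matrixP => i j; rewrite !mxE.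
under eq_cint do rewrite mxE.
by rewrite (cintD (vintegrable t i h1) (vintegrable t i h2)).
Qed.

Lemma vintZ n (c : C) (w : R -> 'cV[C]_n) t : vcontinuous halfline w ->
  vint (fun s => c *: w s) 0 t = c *: vint w 0 t.
Proof.
move=> h; apply/matrixP => i j; rewrite !mxE.
under eq_cint do rewrite mxE.
by rewrite (cintZ c (vintegrable t i h)).
Qed.

Lemma vint_scale n (f : R -> C) (v : 'cV[C]_n) t : cintegrable 0 t f ->
  vint (fun s => f s *: v) 0 t = cint f 0 t *: v.
Proof.
move=> h; apply/matrixP => i j; rewrite ord1 !mxE.
under eq_cint do rewrite mxE mulrC.
by rewrite (cintZ _ h) mulrC.
Qed.

Lemma dotE n (a b : 'cV[C]_n) : dot a b = \sum_i a i 0 * b i 0.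
Proof. by rewrite /dot mxE; apply: eq_bigr => i _; rewrite mxE. Qed.

Lemma dotC n (a b : 'cV[C]_n) : dot a b = dot b a.
Proof. by rewrite !dotE; apply: eq_bigr => i _; rewrite mulrC. Qed.

Lemma dotDr n (a b c : 'cV[C]_n) : dot a (b + c) = dot a b + dot a c.
Proof. by rewrite /dot mulmxDr mxE. Qed.

Lemma dotZr n (a b : 'cV[C]_n) (k : C) : dot a (k *: b) = k * dot a b.
Proof. by rewrite /dot -scalemxAr mxE. Qed.

Lemma ccontinuous_dot (D : set R) n (a : 'cV[C]_n) (w : R -> 'cV[C]_n) :
  vcontinuous D w -> ccontinuous D (fun t => dot a (w t)).
Proof. by move=> h; have := vcontinuous_mulmx a^T h 0. Qed.

Lemma cint_dot n (a : 'cV[C]_n) (w : R -> 'cV[C]_n) t : vcontinuous halfline w ->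
  cint (fun s => dot a (w s)) 0 t = dot a (vint w 0 t).
Proof. by move=> h; rewrite /dot -vint_mulmx// [RHS]mxE. Qed.

Lemma diag_mildE n (d : 'rV[C]_n) (w : 'cV[C]_n) (u b : R -> 'cV[C]_n) t i :
  (w + diag_mx d *m vint u 0 t + vint b 0 t) i 0 =
  w i 0 + d 0 i * cint (fun s => u s i 0) 0 t + cint (fun s => b s i 0) 0 t.
Proof.
rewrite mxE; congr (_ + _); last by rewrite mxE.
by rewrite mxE; congr (_ + _); rewrite mul_diag_mx !mxE.
Qed.

Section diagonal.
Variables (n : nat) (A : 'M[C]_n) (lam : 'I_n -> C).
Hypothesis hA : simple_spectrum A lam.

(** The minimal polynomial divides the characteristic one, a product of distinct linear factors. The
    diagonal [d] need not follow the order of [lam]; that its entries are eigenvalues is seen on the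
    rows of [P], which are left eigenvectors. *)
Lemma simple_spectrum_diagonal : exists (P Q : 'M[C]_n) (d : 'rV[C]_n),
  [/\ Q *m P = 1%:M, P *m Q = 1%:M, P *m A = diag_mx d *m P &
      forall j, eigenvalue A (d 0 j)].
Proof.
have [P [Q [d [QP PQ PA]]]] : exists (P Q : 'M[C]_n) (d : 'rV[C]_n),
    [/\ Q *m P = 1%:M, P *m Q = 1%:M & P *m A = diag_mx d *m P].
  case: n A lam hA => [|k] A0 lam0 [inj chi].
    by exists 0, 0, 0; split; apply: flatmx0_eq || (by rewrite flatmx0 [RHS]flatmx0).
  have [P Pu /similar_diagPex[d /(similarRL Pu) e]] : exists2 P : 'M[C]_k.+1, P \in unitmx & similar_diag P A0.
    apply/diagonalizableP; exists [seq lam0 j | j <- enum 'I_k.+1].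
      by rewrite map_inj_uniq ?enum_uniq.
    rewrite big_map big_enum/= -chi; exact: mxminpoly_dvd_char.
  exists P, (invmx P), d; rewrite mulVmx// mulmxV//; split => //.
  by rewrite e mulmxKV.
exists P, Q, d; split => // j; apply/eigenvalueP; exists (row j P).
  rewrite -row_mul PA row_mul row_diag_mx -scalemxAl -rowE.
  by [].
apply/eqP => e; have := congr1 (row j) PQ; rewrite row_mul e mul0mx => /rowP/(_ j).
by rewrite !mxE eqxx => /eqP; rewrite eq_sym oner_eq0.
Qed.

(** In the coordinates given by [P] the system is a family of scalar equations, solved by variation
    of constants; [Q] leads back. *)
Lemma ode_solve (beta : R -> 'cV[C]_n) (y0 : 'cV[C]_n) : vcontinuous halfline beta ->
  exists2 y, ode_mild A (fun t => vint beta 0 t) y & y 0 = y0.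
Proof.
move=> cb; have [P [Q [d [QP PQ PA _]]]] := simple_spectrum_diagonal.
pose b t := P *m beta t; have cPb : vcontinuous halfline b by exact: vcontinuous_mulmx.
pose u t : 'cV[C]_n := \col_j (cexp (d 0 j) t *
  ((P *m y0) j 0 + cint (fun s => cexp (- d 0 j) s * b s j 0) 0 t)).
have ACu j T : 0 <= T -> AC 0 T (fun t => u t j 0) (fun t => d 0 j * u t j 0 + b t j 0).
  move=> T0; have := ode1_solution (d 0 j) ((P *m y0) j 0) T0 (vintegrable T j cPb).
  by apply: AC_ext => t _; rewrite !mxE.
have cu : vcontinuous halfline u.
  by move=> j; apply: halfline_continuous => T T0; exact: AC_continuous T0 (ACu j T T0).
have u0 : u 0 = P *m y0.
  by apply/matrixP => i j; rewrite ord1 [LHS]mxE cint_pt addr0 cexp0 mul1r.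
have eu t : 0 <= t -> u t = P *m y0 + diag_mx d *m vint u 0 t + vint b 0 t.
  move=> t0; apply/matrixP => i j; rewrite ord1 diag_mildE.
  have [_ /(_ t)] := ACu i t t0; rewrite t0 lexx => /(_ isT) ->.
  rewrite (cintD (cintegrableZ _ (vintegrable t i cu)) (vintegrable t i cPb)).
  by rewrite (cintZ _ (vintegrable t i cu)) u0 addrA.
exists (fun t => Q *m u t); last by rewrite u0 mulmxA QP mul1mx.
split; first exact: vcontinuous_mulmx.
move=> t t0; rewrite (vint_mulmx Q t cu) (eu t t0) u0 !mulmxDr !mulmxA QP !mul1mx; congr (_ + _ + _).
- congr (_ *m _); rewrite -[A]mul1mx -QP -[Q *m P *m A]mulmxA PA.
  by rewrite !mulmxA -mulmxA PQ mulmx1.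
- by rewrite (vint_mulmx P t cb) mulmxA QP mul1mx.
Qed.

(** One bound [B] serves both the initial value and the amplitude of the forcing, so that [M] and
    [m] depend only on [A] and [co]. *)
Lemma ode_decay (co : R) : hurwitz A -> 0 < co -> exists M m : R, [/\ 0 <= M, 0 < m &
  forall y beta B, vcontinuous halfline beta -> ode_mild A (fun t => vint beta 0 t) y ->
    0 <= B -> (forall i, cabs (y 0 i 0) <= B) ->
    (forall s i, 0 <= s -> cabs (beta s i 0) <= B * expR (- co * s)) ->
    forall t i, 0 <= t -> cabs (y t i 0) <= M * B * expR (- m * t)].
Proof.
move=> hur co0; have [P [Q [d [QP PQ PA ev]]]] := simple_spectrum_diagonal.
have [m m0 [mco hm]] : exists2 m, 0 < m & m < co /\ forall j, Re (d 0 j) <= - m.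
  suff [m m0 [mco hm]] : exists2 m, 0 < m & m < co /\ forall j, j \in enum 'I_n -> Re (d 0 j) <= - m.
    by exists m => //; split => // j; apply: hm; rewrite mem_enum.
  (* The rate is a minimum over the eigenvalues; starting it at co / 2 keeps it strictly below [co],
     also in dimension 0. *)
  elim: (enum 'I_n) => [|j r [m m0 [mco IH]]]; first by exists (co / 2); [lra|split; [lra|]].
  have dj := hur _ (ev j).
  exists (Num.min m (- Re (d 0 j))); first by rewrite lt_min m0 oppr_gt0.
  split=> [|k]; first by rewrite gt_min mco.
  rewrite inE lerNr => /orP[/eqP ->|/IH]; first by rewrite ge_min lexx orbT.
  by move=> h; rewrite ge_min [m <= _]lerNr h.
have [cP cP0 hP] := mulmx_bound P; have [cQ cQ0 hQ] := mulmx_bound Q.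
exists (cQ * ((1 + (co - m)^-1) * cP)), m.
have k0 : 0 <= (1 + (co - m)^-1) * cP by rewrite mulr_ge0// addr_ge0// invr_ge0; lra.
split=> //; first exact: mulr_ge0.
move=> y beta B cb [cy ey] B0 hy hb t i t0.
rewrite -[y t]mul1mx -QP -mulmxA -!mulrA; apply: hQ; first by rewrite !mulr_ge0// ?expR_ge0// addr_ge0// invr_ge0; lra.
move=> j.
pose u s := P *m y s; pose b s := P *m beta s.
have cu : vcontinuous halfline u by exact: vcontinuous_mulmx.
have cPb : vcontinuous halfline b by exact: vcontinuous_mulmx.
have eu s : 0 <= s <= t -> u s j 0 = u 0 j 0 + d 0 j * cint (fun s => u s j 0) 0 s + cint (fun s => b s j 0) 0 s.
  move=> /andP[s0 _]; have : u s = u 0 + diag_mx d *m vint u 0 s + vint b 0 s.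
    by rewrite /u /b (ey s s0) !mulmxDr (vint_mulmx P s cy) (vint_mulmx P s cb) !mulmxA PA.
  by move=> ->; rewrite diag_mildE.
have := ode1_formula t0 (vintegrable t j cPb) (vintegrable t j cu) eu.
rewrite -/(u t) => ->; rewrite mulrA; apply: (le_trans (ode1_decay t0 (vintegrable t j cPb) (hm j) mco _ _ _)).
- exact: (mulr_ge0 cP0 B0).
- exact: hP.
- move=> s /andP[s0 _]; rewrite -mulrA; apply: hP; first by rewrite mulr_ge0// expR_ge0.
  by move=> k; exact: hb.
- by rewrite le_eqVlt; apply/orP; left; apply/eqP; ring.
Qed.
End diagonal.

End MatrixODE.

(** * The Neumann evolution *)

Section Neumann.
Context {R : realType}.
Notation C := R[i].
Notation mu := (@lebesgue_measure R).
Notation halfline := [set t : R | 0 <= t].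
Implicit Types (f g : R -> C) (z e : R -> R -> C) (s t T B x : R) (j n : nat).

Lemma is_H2P f (f1 f2 : R -> C) : is_H2 f f1 f2 <-> [/\ L2 f2, AC 0 1 f1 f2 & AC 0 1 f f1].
Proof.
split=> [[h2 a1 a0]|[h2 [_ a1] [_ a0]]]; last by split.
have A1 : AC 0 1 f1 f2 by split; [exact: L2_i|].
by split => //; split; [exact: L2_i (L2_AC A1)|].
Qed.

Lemma within_halfline (u : R -> R) t (l : R) :
  u s @[s --> within halfline (nbhs t)] --> l <->
  forall a : R, 0 < a -> exists2 d : R, 0 < d & forall s, 0 <= s -> `|t - s| < d -> `|l - u s| <= a.
Proof.
split=> [/cvgrPdist_le h a a0|h].
  have /nbhs_ballP[d d0 hd] : nbhs t (fun s => 0 <= s -> `|l - u s| <= a) := h a a0.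
  by exists d => // s s0 ts; apply: hd.
apply/cvgrPdist_le => a a0; have [d d0 hd] := h a a0.
suff : nbhs t (fun s => 0 <= s -> `|l - u s| <= a) by [].
by apply/nbhs_ballP; exists d => //= s ts s0; exact: hd.
Qed.

Lemma halfline_continuousP f : ccontinuous halfline f <->
  forall t, 0 <= t -> forall a : R, 0 < a -> exists2 d : R, 0 < d &
    forall s, 0 <= s -> `|t - s| < d -> cabs (f s - f t) <= a.
Proof.
split=> [[/subspace_continuousP h1 /subspace_continuousP h2] t t0 a a0|h].
  have a2 : 0 < a / 2 by lra.
  have /within_halfline/(_ _ a2)[d1 d10 hd1] := h1 t t0.
  have /within_halfline/(_ _ a2)[d2 d20 hd2] := h2 t t0.
  exists (Num.min d1 d2); first by rewrite lt_min d10.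
  move=> s s0; rewrite lt_min => /andP[ts1 ts2].
  apply: (le_trans (cabs_le _)); rewrite !cE distrC (distrC (Im _)).
  by apply: (le_trans (lerD (hd1 s s0 ts1) (hd2 s s0 ts2))); lra.
split; apply/subspace_continuousP => t t0; apply/within_halfline => a a0;
  have [d d0 hd] := h t t0 a a0; exists d => // s s0 ts;
  apply: (le_trans _ (hd s s0 ts)); rewrite distrC -?ReN -?ReD -?ImN -?ImD.
- exact: normr_Re.
- exact: normr_Im.
Qed.

Lemma L2_continuousP z : L2_continuous z <-> (forall t, 0 <= t -> L2 (z t)) /\
  forall t, 0 <= t -> forall a : R, 0 < a -> exists2 d : R, 0 < d &
    forall s, 0 <= s -> `|t - s| < d -> L2norm (fun x => z s x - z t x) <= a.
Proof.
split=> -[h1 h2]; split => // t t0.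
  move=> a a0; have /within_halfline/(_ _ a0)[d d0 hd] := h2 t t0.
  exists d => // s s0 ts; apply: (le_trans _ (hd s s0 ts)).
  by rewrite sub0r normrN ger0_norm ?L2norm_ge0.
apply/within_halfline => a a0; have [d d0 hd] := h2 t t0 a a0; exists d => // s s0 ts.
by rewrite sub0r normrN ger0_norm ?L2norm_ge0//; exact: hd.
Qed.

Lemma L2dot_time_continuous z f : L2_continuous z -> L2 f ->
  ccontinuous halfline (fun s => L2dot (z s) f).
Proof.
move=> /L2_continuousP[hz cz] hf; apply/halfline_continuousP => t t0 a a0.
have k0 : 0 < L2norm f + 1 by rewrite ltr_wpDl// L2norm_ge0.
have [d d0 hd] := cz t t0 (a / (L2norm f + 1)) (divr_gt0 a0 k0).
exists d => // s s0 ts; have hs := hz s s0; have ht := hz t t0.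
rewrite -(L2dotBl hs ht hf); apply: (le_trans (Cauchy_Schwarz (L2B hs ht) hf)).
apply: (@le_trans _ _ (a / (L2norm f + 1) * (L2norm f + 1))); last by rewrite divfK ?gt_eqF.
by apply: ler_pM => //; [exact: L2norm_ge0|exact: L2norm_ge0|exact: hd|rewrite lerDl].
Qed.

Lemma L2dot_time_integrable z f t : L2_continuous z -> L2 f ->
  cintegrable 0 t (fun s => L2dot (z s) f).
Proof. by move=> cz hf; exact/halfline_integrable/L2dot_time_continuous. Qed.

Variable co : R.
Hypothesis co0 : 0 < co.

Definition neumann_mild e (Y : R -> C) : Prop :=
  L2_continuous e /\ forall t, 0 <= t -> exists E E1 E2 : R -> C,
    [/\ is_H2 E E1 E2 /\ is_L2_integral e t E, E1 0 = 0, E1 1 = 0, Y t = E 1 &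
        ae01 (fun x => e t x = e 0 x + (- 'i%C * E2 x - co%:C * E x))].

(** The eigenvalue of e -> -i e'' - c_o e on [phi j]. *)
Let lam j : C := 'i%C * (freq j)%:C - co%:C.

Let Re_lam j : Re (lam j) = - co.
Proof. by rewrite /lam !cE; ring. Qed.

Let L2_step (e0 E E2 : R -> C) : L2 e0 -> L2 E -> L2 E2 ->
  L2 (fun x => e0 x + (- 'i%C * E2 x - co%:C * E x)).
Proof. by move=> h0 h h2; exact: L2D h0 (L2B (L2Z _ h2) (L2Z _ h)). Qed.

Let coef_step (e0 E E2 : R -> C) j : L2 e0 -> L2 E -> L2 E2 ->
  coef E2 j = - (freq j)%:C * coef E j ->
  coef (fun x => e0 x + (- 'i%C * E2 x - co%:C * E x)) j = coef e0 j + lam j * coef E j.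
Proof.
move=> h0 h h2 e; have a := L2Z (- 'i%C) h2; have b := L2Z co%:C h.
by rewrite (coefD j h0 (L2B a b)) (coefB j a b) (coefZ _ j h2) (coefZ _ j h) e /lam; ring.
Qed.

Let coef_ae_eq f g j : L2 f -> L2 g -> ae01 (fun x => f x = g x) -> coef f j = coef g j.
Proof.
move=> hf hg fg; rewrite !coefE; apply: cint_ae; [exact: L2Mi hf (L2_phi j)|exact: L2Mi hg (L2_phi j)|].
by apply: aeS fg => x h x01; rewrite h.
Qed.

(** Testing the integrated equation with [phi j] leaves a scalar equation: the time integral
    commutes with the coefficient by its weak definition, and the boundary terms vanish by the
    Neumann conditions. *)
Lemma neumann_coef e Y t j : neumann_mild e Y -> 0 <= t ->
  coef (e t) j = cexp (lam j) t * coef (e 0) j.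
Proof.
move=> [ce he] t0; have [hL _] := ce.
have ic := halfline_integrable t (L2dot_time_continuous ce (L2_phi j)).
have := @ode1_formula _ (lam j) (fun=> 0) (fun s => coef (e s) j) t t0 (cintegrable_cst _ _ _) ic.
rewrite (eq_cint (g := fun=> 0)) ?cint0 ?addr0; last by move=> s _; rewrite mulr0.
apply=> s /andP[s0 st]; rewrite cint0 addr0.
have [E [E1 [E2 [[/is_H2P[h2 A1 A0] [hE int]] b0 b1 _ ae]]]] := he s s0.
rewrite (coef_ae_eq j (hL s s0) (L2_step (hL 0 (lexx 0)) hE h2) ae).
rewrite (coef_step (hL 0 (lexx 0)) hE h2).
  by rewrite /coef int//; exact: L2_phi.
by rewrite (coef_second_derivative j A0 A1) b0 b1 !mul0r subrr sub0r mulNr.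
Qed.

(** All modes have exponents with real part -c_o, so no mode is slower than another. *)
Lemma neumann_decay e Y t : neumann_mild e Y -> 0 <= t ->
  L2norm (e t) <= expR (- co * t) * L2norm (e 0).
Proof.
move=> he t0; have [[hL _] _] := he.
apply: L2norm_coef_le; [exact: expR_ge0|exact: hL|exact: hL|].
by move=> j; rewrite (neumann_coef j he t0) cabsM cabs_cexp Re_lam.
Qed.

Lemma synthesis_dominated (a : nat -> C) g (k : R) : 0 <= k -> L2 g ->
  (forall j, cabs (a j) <= k * cabs (coef g j)) -> exists2 f, L2 f & forall j, coef f j = a j.
Proof.
move=> k0 hg h; have [n|f hf [cf _]] := @synthesis _ a (k ^+ 2 * L2norm g ^+ 2).
  apply: (@le_trans _ _ (\sum_(0 <= j < n) (k ^+ 2 * cabs (coef g j) ^+ 2))).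
    by apply: ler_sum => j _; rewrite -exprMn lerXn2r// ?nnegrE ?cabs_ge0// mulr_ge0// cabs_ge0.
  by rewrite -mulr_sumr ler_wpM2l ?sqr_ge0// bessel_le// iota_uniq.
by exists f.
Qed.

Lemma phi_0 x : phi 0 x = 1 :> C.
Proof. by rewrite /phi /wcos /cosn eqxx !mul0r cos0 mulr1. Qed.

Lemma coef0E f : coef f 0 = cint f 0 1.
Proof. by rewrite coefE; apply: eq_cint => x _; rewrite phi_0 mulr1. Qed.

Lemma freq0 : freq 0 = 0 :> R. Proof. by rewrite /freq mul0r expr0n. Qed.

(** The second derivative is synthesised and integrated twice from 0, which gives E'(0) = 0 for
    free; its coefficients then determine those of E except the one of index 0. *)
Lemma neumann_primitive (I : nat -> C) g (k : R) : 0 <= k -> L2 g ->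
  (forall j, (freq j) * cabs (I j) <= k * cabs (coef g j)) ->
  exists E E1 E2 : R -> C, [/\ is_H2 E E1 E2, E1 0 = 0, E1 1 = 0,
    forall j, coef E j = I j & forall j, coef E2 j = - (freq j)%:C * I j].
Proof.
move=> k0 hg hI.
have [j|E2 h2 c2] := @synthesis_dominated (fun j => - (freq j)%:C * I j) g k k0 hg.
  by rewrite cabsM cabsN cabs_real ger0_norm ?freq_ge0.
pose E1 x := 0 + cint E2 0 x; have A1 : AC 0 1 E1 E2 := AC_primitive 0 (L2_i h2).
pose F x := 0 + cint E1 0 x; have A0 : AC 0 1 F E1 := AC_primitive 0 (L2_i (L2_AC A1)).
(* The free constant of integration, used to correct the coefficient of index 0. *)
have hF := L2_AC A0; pose w := I 0%N - coef F 0.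
have b0 : E1 0 = 0 by rewrite /E1 cint_pt addr0.
(* The integral of [E2] is its coefficient of index 0, which carries the factor [freq 0] = 0. *)
have b1 : E1 1 = 0 by rewrite /E1 -coef0E c2 freq0 oppr0 mul0r addr0.
have A : AC 0 1 (fun x => w + F x) E1.
  by apply: (AC_ext _ _ (ACD (AC_cst 0 1 w) A0)) => // x _; rewrite add0r.
exists (fun x => w + F x), E1, E2; split => //; first exact/is_H2P.
case=> [|j]; first by rewrite (coefD 0 (L2_cst w) hF) coef0E (cint_cst w ler01) subr0 mulr1 /w subrK.
have := coef_second_derivative j.+1 A A1; rewrite b0 b1 !mul0r subrr sub0r c2 mulNr => /oppr_inj.
have f0 : freq j.+1 != 0 :> R.
  by rewrite /freq expf_eq0/= mulf_eq0 negb_or pnatr_eq0/= gt_eqF// pi_gt0.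
by move=> /mulfI ->//; rewrite eq_complex/= (negbTE f0).
Qed.

Section existence.
Variable e0 : R -> C.
Hypothesis h0 : L2 e0.
Let c j t : C := cexp (lam j) t * coef e0 j.

Let c_le j t : 0 <= t -> cabs (c j t) <= 1 * cabs (coef e0 j).
Proof.
move=> t0; rewrite /c cabsM cabs_cexp Re_lam; apply: ler_wpM2r; first exact: cabs_ge0.
by rewrite -expR0 ler_expR mulNr oppr_le0 mulr_ge0// ltW.
Qed.

Let AC_c j T : 0 <= T -> AC 0 T (c j) (fun t => lam j * c j t).
Proof.
move=> T0; apply: (AC_ext _ _ (ACZ (coef e0 j) (AC_cexp (lam j) T0))) => t _; rewrite /c; ring.
Qed.

Let c_cont j : ccontinuous halfline (c j).
Proof. by apply: halfline_continuous => T T0; exact: AC_continuous T0 (AC_c j T0). Qed.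

(** [synthesis_dominated] supplies a state for each time separately, so everything about the
    dependence on time is recovered from coefficients: continuity by uniformly small tails,
    membership of the time integral in H^2 by the growth of the exponents, and the weak integral by
    density of trigonometric sums. *)
Lemma neumann_solve : exists2 e, exists Y, neumann_mild e Y & ae01 (fun x => e 0 x = e0 x).
Proof.
have /choice[e he] : forall t, exists f, 0 <= t -> L2 f /\ forall j, coef f j = c j t.
  move=> t; have [t0|t0] := leP 0 t; last by exists (fun=> 0).
  have [j|f hf cf] := @synthesis_dominated (c ^~ t) e0 1 ler01 h0; first exact: c_le.
  by exists f.
have hL t (tp : 0 <= t) := (he t tp).1; have hc t (tp : 0 <= t) := (he t tp).2.
have norm_e t : 0 <= t -> L2norm (e t) <= L2norm e0.
  move=> t0; rewrite -[leRHS]mul1r; apply: L2norm_coef_le => //; first exact: hL.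
  by move=> j; rewrite hc//; exact: c_le.
have ce : L2_continuous e.
  apply/L2_continuousP; split=> // t t0 a a0.
  (* One half of a^2 is spent on the tail, uniformly in s, the other on the finitely many leading
     coefficients. *)
  have a2 : 0 < a ^+ 2 / 2 by rewrite divr_gt0// exprn_gt0.
  (* The coefficients of e(s) - e(t) are at most twice those of the initial state. *)
  have [N hN] := L2norm_dominated_tail 2 h0 a2.
  have [d d0 hd] : exists2 d : R, 0 < d & forall s, 0 <= s -> `|t - s| < d ->
      \sum_(0 <= j < N) cabs (c j s - c j t) ^+ 2 <= a ^+ 2 / 2.
    have : forall b : R, 0 < b -> exists2 d : R, 0 < d & forall s, 0 <= s -> `|t - s| < d ->
      \sum_(0 <= j < N) cabs (c j s - c j t) ^+ 2 <= b; last by apply.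
    have sqle (x y : R) : 0 <= x -> 0 <= y -> x <= Num.sqrt y -> x ^+ 2 <= y.
      by move=> x0 y0 xy; rewrite -(sqr_sqrtr y0) lerXn2r ?nnegrE ?sqrtr_ge0.
    elim: N {hN} => [|N IH] b b0; first by exists 1 => // s _ _; rewrite big_geq// ltW.
    have b2 : 0 < b / 2 by lra.
    have [d1 d10 hd1] := IH _ b2.
    have sb : 0 < Num.sqrt (b / 2) by rewrite sqrtr_gt0.
    have [d2 d20 hd2] := proj1 (halfline_continuousP _) (c_cont N) t t0 _ sb.
    exists (Num.min d1 d2); first by rewrite lt_min d10.
    move=> s s0; rewrite lt_min => /andP[ts1 ts2]; rewrite big_nat_recr//=.
    have h1 := hd1 s s0 ts1; have : cabs (c N s - c N t) ^+ 2 <= b / 2.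
      exact: sqle (cabs_ge0 _) (ltW b2) (hd2 s s0 ts2).
    by move=> h2; apply: (le_trans (lerD h1 h2)); lra.
  exists d => // s s0 ts; have hs := hL s s0; have ht := hL t t0.
  have cst j : coef (fun x => e s x - e t x) j = c j s - c j t by rewrite (coefB j hs ht) !hc.
  have dom j : cabs (coef (fun x => e s x - e t x) j) <= 2 * cabs (coef e0 j).
    rewrite cst; apply: (le_trans (cabsB _ _)).
    by apply: (le_trans (lerD (c_le j s0) (c_le j t0))); lra.
  have h := hN _ (L2B hs ht) dom.
  have a0' := ltW a0.
  rewrite -(ler_pXn2r (n := 2))// ?nnegrE ?L2norm_ge0//.
  apply: (le_trans h); under eq_bigr do rewrite cst.
  by have := hd s s0 ts; lra.
exists e; last first.
  apply: coef_ae => //; first exact: hL.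
  by move=> j; rewrite hc// /c cexp0 mul1r.
have sol t : 0 <= t -> exists E E1 E2 : R -> C,
    [/\ is_H2 E E1 E2 /\ is_L2_integral e t E, E1 0 = 0, E1 1 = 0 &
        ae01 (fun x => e t x = e 0 x + (- 'i%C * E2 x - co%:C * E x))].
  move=> t0; pose I j := cint (c j) 0 t.
  have lamI j : lam j * I j = c j t - coef e0 j.
    have := AC_bnd t0 (AC_c j t0); rewrite (cintZ _ (halfline_integrable t (c_cont j))) -/(I j) => ->.
    by rewrite {2}/c cexp0 mul1r.
  (* [freq j] is the imaginary part of [lam j], and [lam j] times the integrated mode is a
     difference of two values of the mode. This bound puts the second derivative into L^2(0,1). *)
  have fI j : freq j * cabs (I j) <= 2 * cabs (coef e0 j).
    apply: (@le_trans _ _ (cabs (lam j * I j))).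
      rewrite cabsM; apply: ler_wpM2r; first exact: cabs_ge0.
      apply: (le_trans (ler_norm _)); apply: (le_trans _ (normr_Im _)).
      by rewrite /lam !cE; rewrite le_eqVlt; apply/orP; left; apply/eqP; congr `|_|; ring.
    by rewrite lamI; apply: (le_trans (cabsB _ _)); have := c_le j t0; lra.
  have [E [E1 [E2 [hE b0 b1 ceE ceE2]]]] := neumann_primitive (ler0n _ 2) h0 fI.
  have /is_H2P[h2 A1 A0] := hE; have hE0 := L2_AC A0.
  exists E, E1, E2; split => //; last first.
    apply: coef_ae; [exact: hL|exact: L2_step (hL 0 (lexx 0)) hE0 h2|].
    move=> j; rewrite coef_step ?ceE2 ?ceE//; last exact: hL.
    by rewrite lamI !hc// {2}/c cexp0 mul1r addrC subrK.
  split=> //; split=> // f hf.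
  (* The defect of the weak integral: conjugate-linear, bounded, and zero on every [phi j], hence
     zero by Fourier approximation of the test function. *)
  pose D (g : R -> C) := L2dot E g - cint (fun s => L2dot (e s) g) 0 t.
  have Dphi j : D (phi j) = 0.
    rewrite /D -[L2dot E _]/(coef E j) ceE; apply/eqP; rewrite subr_eq0; apply/eqP.
    by apply: eq_cint => s /andP[s0 _]; rewrite -[RHS]/(coef (e s) j) hc.
  have D_le g : L2 g -> cabs (D g) <= (L2norm E + L2norm e0 * t) * L2norm g.
    move=> hg; rewrite mulrDl; apply: (le_trans (cabsB _ _)); apply: lerD; first exact: Cauchy_Schwarz.
    have := @cint_bound _ 0 t (L2norm e0 * L2norm g) _ t0 (L2dot_time_integrable t ce hg).
    rewrite subr0 mulrAC; apply=> s /andP[s0 _]; apply: (le_trans (Cauchy_Schwarz (hL s s0) hg)).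
    by apply: ler_wpM2r; [exact: L2norm_ge0|exact: norm_e].
  have dotD (F f1 f2 : R -> C) : L2 F -> L2 f1 -> L2 f2 ->
      L2dot F (fun x => f1 x + f2 x) = L2dot F f1 + L2dot F f2.
    move=> hF h1 h2'; rewrite (L2dotJ (L2D h1 h2') hF) (L2dotDl h1 h2' hF) (L2dotJ h1 hF) (L2dotJ h2' hF).
    by apply: complexP; rewrite !cE; ring.
  have dotZ (F f1 : R -> C) (k : C) : L2 F -> L2 f1 ->
      L2dot F (fun x => k * f1 x) = k^* * L2dot F f1.
    move=> hF h1; rewrite (L2dotJ (L2Z k h1) hF) (L2dotZl k h1 hF) (L2dotJ h1 hF).
    by apply: complexP; rewrite !cE; ring.
  have DD f1 f2 : L2 f1 -> L2 f2 -> D (fun x => f1 x + f2 x) = D f1 + D f2.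
    move=> h1 h2'; rewrite /D dotD//.
    rewrite (eq_cint (g := fun s => L2dot (e s) f1 + L2dot (e s) f2)); last first.
      by move=> s /andP[s0 _]; rewrite dotD//; exact: hL.
    by rewrite (cintD (L2dot_time_integrable t ce h1) (L2dot_time_integrable t ce h2')) opprD addrACA.
  have DZ k f1 : L2 f1 -> D (fun x => k * f1 x) = k^* * D f1.
    move=> h1; rewrite /D dotZ//.
    rewrite (eq_cint (g := fun s => k^* * L2dot (e s) f1)); last first.
      by move=> s /andP[s0 _]; rewrite dotZ//; exact: hL.
    by rewrite (cintZ _ (L2dot_time_integrable t ce h1)) mulrBr.
  have Dpsum r a : D (psum r a) = 0.
    elim: r => [|j r IH].
      have -> : psum [::] a = (fun x => 0 * phi 0 x) by apply/funext => x; rewrite /psum big_nil mul0r.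
      by rewrite DZ ?Dphi ?mulr0//; exact: L2_phi.
    have -> : psum (j :: r) a = (fun x => a j * phi j x + psum r a x).
      by apply/funext => x; rewrite /psum big_cons.
    rewrite DD; [|exact: L2Z (L2_phi j)|exact: L2_psum].
    by rewrite IH DZ ?Dphi ?mulr0 ?addr0//; exact: L2_phi.
  suff : cabs (D f) = 0 by move=> /cabs_eq0/eqP; rewrite subr_eq0 => /eqP.
  pose K := L2norm E + L2norm e0 * t.
  have K0 : 0 <= K by rewrite addr_ge0 ?mulr_ge0// L2norm_ge0.
  apply/eqP; rewrite eq_le cabs_ge0 andbT; apply/ler_addgt0Pl => a a0; rewrite addr0.
  have aK : 0 < a / (K + 1) by rewrite divr_gt0// ltr_wpDl.
  have [N /(_ N (leqnn N)) hN] := fourier_cvg hf aK.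
  have hp := L2_psum (index_iota 0 N) (coef f).
  have -> : D f = D (fun x => f x - psum (index_iota 0 N) (coef f) x).
    have := DD _ _ (L2B hf hp) hp; rewrite Dpsum addr0 => <-.
    by congr D; apply/funext => x; rewrite subrK.
  apply: (le_trans (D_le _ (L2B hf hp))); rewrite -/K.
  apply: (@le_trans _ _ ((K + 1) * (a / (K + 1)))); last by rewrite mulrC divfK// gt_eqF// ltr_wpDl.
  by apply: ler_pM => //; [exact: L2norm_ge0|rewrite lerDl].
(* The output is read off from the H^2 representative of the time integral; negative times receive
   the arbitrary value 0. *)
have /choice[Y hY] : forall t, exists y : C, 0 <= t -> exists E E1 E2 : R -> C,
    [/\ is_H2 E E1 E2 /\ is_L2_integral e t E, E1 0 = 0, E1 1 = 0, y = E 1 &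
        ae01 (fun x => e t x = e 0 x + (- 'i%C * E2 x - co%:C * E x))].
  move=> t; have [t0|t0] := leP 0 t; last by exists 0.
  by have [E [E1 [E2 [h1 h2 h3 h4]]]] := sol t t0; exists (E 1) => _; exists E, E1, E2.
by exists Y; split.
Qed.
End existence.

End Neumann.

(** * Linear combinations of mild solutions *)

Section LinearStructure.
Context {R : realType}.
Notation C := R[i].
Notation halfline := [set t : R | 0 <= t].
Implicit Types (f g : R -> C) (z : R -> R -> C) (s t x : R) (c : C).

Lemma L2_lin c f g : L2 f -> L2 g -> L2 (fun x => f x + c * g x).
Proof. by move=> hf hg; exact: L2D hf (L2Z c hg). Qed.

Lemma L2_continuous_lin c z z' : L2_continuous z -> L2_continuous z' ->
  L2_continuous (fun s x => z s x + c * z' s x).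
Proof.
move=> /L2_continuousP[hz cz] /L2_continuousP[hz' cz']; apply/L2_continuousP; split.
  by move=> t t0; apply: L2_lin; [exact: hz|exact: hz'].
move=> t t0 a a0; have a2 : 0 < a / 2 by lra.
have k0 : 0 < cabs c + 1 by rewrite ltr_wpDl// cabs_ge0.
have [d1 d10 hd1] := cz t t0 _ a2; have [d2 d20 hd2] := cz' t t0 _ (divr_gt0 a2 k0).
exists (Num.min d1 d2); first by rewrite lt_min d10.
move=> s s0; rewrite lt_min => /andP[/(hd1 s s0) h1 /(hd2 s s0) h2].
have i1 := L2B (hz s s0) (hz t t0); have i2 := L2B (hz' s s0) (hz' t t0).
rewrite (eq_L2norm (g := fun x => (z s x - z t x) + c * (z' s x - z' t x))); last by move=> x _; ring.
apply: (le_trans (L2norm_triangle i1 (L2Z c i2))); rewrite (L2normZ c i2).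
have h3 : cabs c * L2norm (fun x => z' s x - z' t x) <= (cabs c + 1) * (a / 2 / (cabs c + 1)).
  by apply: ler_pM => //; [exact: cabs_ge0|exact: L2norm_ge0|rewrite lerDl].
rewrite [X in _ <= X]mulrC divfK ?gt_eqF// in h3.
by apply: (le_trans (lerD h1 h3)); lra.
Qed.

Lemma eq_L2dot f f' g : (forall x, 0 <= x <= 1 -> f x = f' x) -> L2dot f g = L2dot f' g.
Proof. by move=> e; apply: eq_cint => x x01; rewrite e. Qed.

Lemma is_L2_integral_lin c z z' t (Z Z' : R -> C) : L2_continuous z -> L2_continuous z' ->
  is_L2_integral z t Z -> is_L2_integral z' t Z' ->
  is_L2_integral (fun s x => z s x + c * z' s x) t (fun x => Z x + c * Z' x).
Proof.
move=> cz cz' [hZ iZ] [hZ' iZ']; split; first exact: L2_lin.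
move=> f hf; rewrite (L2dotDl hZ (L2Z c hZ') hf) (L2dotZl c hZ' hf) iZ// iZ'//.
have i1 := L2dot_time_integrable t cz hf; have i2 := L2dot_time_integrable t cz' hf.
rewrite -(cintZ c i2) -(cintD i1 (cintegrableZ c i2)); apply: eq_cint => s /andP[s0 _].
by rewrite (L2dotDl (cz.1 s s0) (L2Z c (cz'.1 s s0)) hf) (L2dotZl c (cz'.1 s s0) hf).
Qed.

Lemma is_H2_lin c f (f1 f2 : R -> C) g (g1 g2 : R -> C) : is_H2 f f1 f2 -> is_H2 g g1 g2 ->
  is_H2 (fun x => f x + c * g x) (fun x => f1 x + c * g1 x) (fun x => f2 x + c * g2 x).
Proof.
move=> /is_H2P[a1 a2 a3] /is_H2P[b1 b2 b3]; apply/is_H2P; split.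
- exact: L2_lin.
- exact: ACD a2 (ACZ c b2).
- exact: ACD a3 (ACZ c b3).
Qed.

Lemma schrodinger_lin q (h : R -> C) (c : C) (F F' : R -> R -> C) (B0 B0' B1 B1' : R -> C) z z'
    (Y Y' : R -> C) :
  schrodinger_mild q h F B0 B1 z Y -> schrodinger_mild q h F' B0' B1' z' Y' ->
  schrodinger_mild q h (fun t x => F t x + c * F' t x) (fun t => B0 t + c * B0' t)
    (fun t => B1 t + c * B1' t) (fun t x => z t x + c * z' t x) (fun t => Y t + c * Y' t).
Proof.
move=> [cz hz] [cz' hz']; split; first exact: L2_continuous_lin.
move=> t t0; have [Z [Z1 [Z2 [[H I] b0 b1 y e]]]] := hz t t0.
have [Z' [Z1' [Z2' [[H' I'] b0' b1' y' e']]]] := hz' t t0.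
exists (fun x => Z x + c * Z' x), (fun x => Z1 x + c * Z1' x), (fun x => Z2 x + c * Z2' x).
split; [split; [exact: is_H2_lin|exact: is_L2_integral_lin]| | | |].
- by rewrite b0 b0'; ring.
- by rewrite b1 b1'.
- by rewrite y y'.
- by apply: aeS (ae_and e e') => x [E E'] x01; rewrite E// E'//; ring.
Qed.

Lemma schrodinger_ext q (h : R -> C) (F F' : R -> R -> C) (B0 B0' B1 B1' : R -> C) z z'
    (Y Y' : R -> C) :
  (forall t x, 0 <= t -> F t x = F' t x) -> (forall t, 0 <= t -> B0 t = B0' t) ->
  (forall t, 0 <= t -> B1 t = B1' t) -> (forall t x, z t x = z' t x) ->
  (forall t, 0 <= t -> Y t = Y' t) ->
  schrodinger_mild q h F B0 B1 z Y -> schrodinger_mild q h F' B0' B1' z' Y'.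
Proof.
move=> eF e0 e1 ez eY; have -> : z = z' by apply/funext => t; apply/funext.
move=> [cz hz]; split=> // t t0; have [Z [Z1 [Z2 [H b0 b1 y e]]]] := hz t t0.
exists Z, Z1, Z2; split=> //; rewrite -?e0 -?e1 -?eY//.
by apply: aeS e => x E x01; rewrite E// eF.
Qed.

Lemma ode_lin n (A : 'M[C]_n) c (F F' w w' : R -> 'cV[C]_n) : ode_mild A F w -> ode_mild A F' w' ->
  ode_mild A (fun t => F t + c *: F' t) (fun t => w t + c *: w' t).
Proof.
move=> [cw ew] [cw' ew']; have cc := vcontinuousZ c cw'; split; first exact: vcontinuousD.
move=> t t0; rewrite (vintD t cw cc) (vintZ c t cw') {1}(ew t t0) {1}(ew' t t0).
rewrite !scalerDr mulmxDr -scalemxAr.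
by rewrite [w 0 + _ + _ + _]addrACA [w 0 + _ + _]addrACA !addrA.
Qed.

Lemma ode_ext n (A : 'M[C]_n) (F F' w : R -> 'cV[C]_n) : (forall t, 0 <= t -> F t = F' t) ->
  ode_mild A F w -> ode_mild A F' w.
Proof. by move=> e [cw ew]; split=> // t t0; rewrite -e//; exact: ew. Qed.

Lemma L2_continuous_cst_mul f g : ccontinuous halfline f -> L2 g ->
  L2_continuous (fun s x => f s * g x).
Proof.
move=> /halfline_continuousP cf hg; apply/L2_continuousP; split=> [t _|t t0 a a0]; first exact: L2Z.
have k0 : 0 < L2norm g + 1 by rewrite ltr_wpDl// L2norm_ge0.
have [d d0 hd] := cf t t0 _ (divr_gt0 a0 k0); exists d => // s s0 ts.
rewrite (eq_L2norm (g := fun x => (f s - f t) * g x)); last by move=> x _; ring.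
rewrite (L2normZ _ hg); apply: (@le_trans _ _ (a / (L2norm g + 1) * (L2norm g + 1))).
  by apply: ler_pM => //; [exact: cabs_ge0|exact: L2norm_ge0|exact: hd|rewrite lerDl].
by rewrite divfK ?gt_eqF.
Qed.

Lemma is_L2_integral_cst_mul f g t : ccontinuous halfline f -> L2 g ->
  is_L2_integral (fun s x => f s * g x) t (fun x => cint f 0 t * g x).
Proof.
move=> cf hg; split; first exact: L2Z.
move=> u hu; rewrite (L2dotZl _ hg hu) mulrC -(cintZ _ (halfline_integrable t cf)).
by apply: eq_cint => s _; rewrite (L2dotZl _ hg hu) mulrC.
Qed.

Section finite_rank.
Variables (n : nat) (N w : R -> 'cV[C]_n).
Hypotheses (hN : forall i, L2 (fun x => N x i 0)) (cw : vcontinuous halfline w).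

(** n^T w is a finite sum of scalar functions of time multiplied by fixed functions of x, treated
    one summand at a time. *)
Let step (r : seq 'I_n) t :
  L2_continuous (fun s x => \sum_(i <- r) w s i 0 * N x i 0) /\
  is_L2_integral (fun s x => \sum_(i <- r) w s i 0 * N x i 0) t
    (fun x => \sum_(i <- r) cint (fun s => w s i 0) 0 t * N x i 0).
Proof.
elim: r => [|i r [c1 i1]].
  have c0 : ccontinuous halfline (fun=> 0 : C) := ccontinuous_cst _ _.
  have h0 : L2 (fun=> 0 : C) := L2_cst 0.
  have [] := (L2_continuous_cst_mul c0 h0, is_L2_integral_cst_mul t c0 h0).
  have -> : (fun s x => \sum_(i <- [::]) w s i 0 * N x i 0) = (fun _ _ => 0 * 0).
    by apply/funext => s; apply/funext => x; rewrite big_nil mul0r.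
  have -> : (fun x => \sum_(i <- [::]) cint (fun s => w s i 0) 0 t * N x i 0) = (fun=> cint (fun=> 0) 0 t * 0).
    by apply/funext => x; rewrite big_nil mulr0.
  by [].
have c2 := L2_continuous_cst_mul (cw i) (hN i); have i2 := is_L2_integral_cst_mul t (cw i) (hN i).
have -> : (fun s x => \sum_(i <- i :: r) w s i 0 * N x i 0) =
    (fun s x => w s i 0 * N x i 0 + 1 * \sum_(i <- r) w s i 0 * N x i 0).
  by apply/funext => s; apply/funext => x; rewrite big_cons mul1r.
have -> : (fun x => \sum_(i <- i :: r) cint (fun s => w s i 0) 0 t * N x i 0) =
    (fun x => cint (fun s => w s i 0) 0 t * N x i 0 + 1 * \sum_(i <- r) cint (fun s => w s i 0) 0 t * N x i 0).
  by apply/funext => x; rewrite big_cons mul1r.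
by split; [exact: L2_continuous_lin|exact: is_L2_integral_lin].
Qed.

Let dot_sum (a b : 'cV[C]_n) : dot a b = \sum_i b i 0 * a i 0.
Proof. by rewrite dotC dotE. Qed.

Lemma L2_continuous_dot : L2_continuous (fun s x => dot (N x) (w s)).
Proof.
have -> : (fun s x => dot (N x) (w s)) = (fun s x => \sum_i w s i 0 * N x i 0).
  by apply/funext => s; apply/funext => x; rewrite dot_sum.
by have [] := step (index_enum _) 0.
Qed.

Lemma is_L2_integral_dot t : is_L2_integral (fun s x => dot (N x) (w s)) t (fun x => dot (N x) (vint w 0 t)).
Proof.
have [_ H] := step (index_enum _) t.
have -> : (fun s x => dot (N x) (w s)) = (fun s x => \sum_i w s i 0 * N x i 0).
  by apply/funext => s; apply/funext => x; rewrite dot_sum.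
have -> : (fun x => dot (N x) (vint w 0 t)) = (fun x => \sum_i cint (fun s => w s i 0) 0 t * N x i 0).
  by apply/funext => x; rewrite dot_sum; apply: eq_bigr => i _; rewrite mxE.
exact: H.
Qed.
End finite_rank.

End LinearStructure.

(** * The transformation of mild solutions *)

Section TransformOperator.
Context {R : realType}.
Notation C := R[i].
Implicit Types (f g v : R -> C) (z : R -> R -> C) (s t x y : R) (c : C).
Variable p : R -> R -> C.
Hypothesis cp : ccontinuous2 triangle p.

Let ip f x : L2 f -> 0 <= x -> cintegrable x 1 (fun y => ext p x y * f y).
Proof.
have [M hM] := ext_ckernel cp; move=> hf x0.
by apply: (ckernel_intr x hM); exact: cintegrableS x0 (lexx 1) (L2_i hf).
Qed.

Lemma transform_lin c f g x : L2 f -> L2 g -> 0 <= x ->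
  transform p (fun y => f y + c * g y) x = transform p f x + c * transform p g x.
Proof.
move=> hf hg x0; rewrite /transform.
have -> : cint (fun y => ext p x y * (f y + c * g y)) x 1 =
    cint (fun y => ext p x y * f y) x 1 + c * cint (fun y => ext p x y * g y) x 1.
  have i2 := ip hg x0.
  rewrite -(cintZ c i2) -(cintD (ip hf x0) (cintegrableZ c i2)).
  by apply: eq_cint => y _; ring.
ring.
Qed.

Lemma transform_ae f g x : L2 f -> L2 g -> ae01 (fun y => f y = g y) -> 0 <= x ->
  f x = g x -> transform p f x = transform p g x.
Proof.
move=> hf hg fg x0 e; rewrite /transform e; congr (_ - _).
apply: cint_ae; [exact: ip|exact: ip|].
by apply: aeS fg => y h /andP[xy y1]; rewrite h// /I01/= in_itv/= y1 (le_trans x0).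
Qed.

Lemma transformB f g x : L2 f -> L2 g -> 0 <= x ->
  transform p (fun y => f y - g y) x = transform p f x - transform p g x.
Proof.
move=> hf hg x0; have := transform_lin (-1) hf hg x0; rewrite mulN1r => <-.
by congr transform; apply/funext => y; rewrite mulN1r.
Qed.

Let L2_tr f : L2 f -> L2 (transform p f).
Proof. by have [M hM] := ext_ckernel cp; move=> hf; exact/L2B/(L2_upper hM). Qed.

Lemma transform_bounded : exists2 D : R, 0 <= D &
  forall f, L2 f -> L2norm (transform p f) <= D * L2norm f.
Proof.
have [M hM] := ext_ckernel cp; have M0 := ckernel_ge0 hM.
exists (1 + M); first by rewrite addr_ge0.
move=> f hf; have hT := L2_upper hM hf.
apply: (le_trans (L2norm_triangleB hf hT)); rewrite mulrDl mul1r lerD2l.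
apply: L2norm_bound => //; first by rewrite mulr_ge0// L2norm_ge0.
by move=> x x01; exact: upper_le.
Qed.

Lemma transform_solve f : L2 f -> exists2 v, L2 v & forall x, 0 <= x <= 1 -> f x = transform p v x.
Proof.
have [M hM] := ext_ckernel cp; move=> hf.
have [v hv e] := volterra_upper_solve hM hf; exists v => // x x01.
by rewrite /transform {1}e// addrK.
Qed.

(** [v] solves the Volterra equation with datum [transform p v], so the a priori bound is the
    boundedness of the inverse of F_o. *)
Lemma transform_coercive : exists2 D : R, 0 <= D &
  forall v, L2 v -> L2norm v <= D * L2norm (transform p v).
Proof.
have [M hM] := ext_ckernel cp; have [D D0 hD] := volterra_upper_apriori hM.
exists (1 + D); first by rewrite addr_ge0.
move=> v hv; have hT := L2_tr hv.
have b x : 0 <= x <= 1 -> cabs (v x - transform p v x) <= D * L2norm (transform p v).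
  by apply: hD => // y y01; rewrite /transform subrK.
apply: (le_trans (L2norm_dist hv hT)); rewrite mulrDl mul1r lerD2l.
by apply: L2norm_bound => //; [rewrite mulr_ge0// L2norm_ge0|exact: L2B].
Qed.

Lemma transform_inj v w : L2 v -> L2 w ->
  ae01 (fun x => transform p v x = transform p w x) -> ae01 (fun x => v x = w x).
Proof.
move=> hv hw e; have [D D0 hD] := transform_coercive; have h := L2B hv hw.
suff : L2norm (fun x => v x - w x) = 0.
  by move=> /(L2norm_eq0 h); apply: aeS => x + x01 => /(_ x01)/eqP; rewrite subr_eq0 => /eqP.
apply/eqP; rewrite eq_le L2norm_ge0 andbT; apply: (le_trans (hD _ h)).
rewrite (L2norm_ae (g := fun=> 0) (L2_tr h) (L2_cst 0)); last first.
  apply: aeS e => x E x01; rewrite (transformB hv hw); first by rewrite E// subrr.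
  by move: x01; rewrite /I01/= in_itv/= => /andP[].
rewrite (_ : L2norm (fun=> 0) = 0) ?mulr0//.
apply/eqP; rewrite eq_le L2norm_ge0 andbT; apply: L2norm_bound => //; first exact: L2_cst.
by move=> x _; rewrite cabs0.
Qed.

(** The adjoint of F_o in L^2(0,1), by Fubini on the triangle. Time integrals are characterised by
    inner products, so F_o is carried through them by moving it to the test function. *)
Definition adjoint_transform f y := f y - cint (fun x => (ext p x y)^* * f x) 0 y.

Lemma L2dot_transform f g : L2 f -> L2 g ->
  L2dot (transform p f) g = L2dot f (adjoint_transform g).
Proof.
have [M hM] := ext_ckernel cp; move=> hf hg; have hgJ := L2J hg.
have hT := L2_upper hM hf.
have hS := L2_lower (ckernel_tr hM) hgJ.
rewrite /L2dot (eq_cint (g := fun x => f x * (g x)^* - (g x)^* * cint (fun y => ext p x y * f y) x 1)); last first.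
  by move=> x _; rewrite /transform; ring.
rewrite (cintB (L2Mi hf hgJ) (L2Mi hgJ hT)).
rewrite (fubini_triangle hM (lexx 0) ler01 (lexx 1) (L2_i hgJ) (L2_i hf)).
rewrite -(cintB (L2Mi hf hgJ) (L2Mi hf hS)); apply: eq_cint => y /andP[y0 y1].
have ig : cintegrable 0 y (fun x => (ext p x y)^* * g x).
  by apply: (ckernel_intl y (ckernelJ hM)); exact: cintegrableS (lexx 0) y1 (L2_i hg).
have e : cint (fun x => ext p x y * (g x)^*) 0 y = (cint (fun x => (ext p x y)^* * g x) 0 y)^*.
  by rewrite -(cintJ ig); apply: eq_cint => x _; apply: complexP; rewrite !cE; ring.
by rewrite e /adjoint_transform; apply: complexP; rewrite !cE; ring.
Qed.

Lemma adjoint_solve f : L2 f -> exists2 g, L2 g & forall y, 0 <= y <= 1 -> f y = adjoint_transform g y.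
Proof.
have [M hM] := ext_ckernel cp; move=> hf.
have [g hg e] := volterra_lower_solve (ckernelJ (ckernel_tr hM)) hf; exists g => // y y01.
by rewrite /adjoint_transform {1}e// addrK.
Qed.

Lemma L2_adjoint f : L2 f -> L2 (adjoint_transform f).
Proof.
have [M hM] := ext_ckernel cp; move=> hf.
exact: L2B hf (L2_lower (ckernelJ (ckernel_tr hM)) hf).
Qed.

Lemma L2_continuous_transform z : L2_continuous z -> L2_continuous (fun t => transform p (z t)).
Proof.
have [D D0 hD] := transform_bounded.
move=> /L2_continuousP[hz cz]; apply/L2_continuousP; split=> [t t0|t t0 a a0]; first exact/L2_tr/hz.
have k0 : 0 < D + 1 by rewrite ltr_wpDl.
have [d d0 hd] := cz t t0 _ (divr_gt0 a0 k0); exists d => // s s0 ts.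
have h := L2B (hz s s0) (hz t t0).
rewrite -(eq_L2norm (f := transform p (fun x => z s x - z t x))); last first.
  by move=> x /andP[x0 _]; rewrite (transformB (hz s s0) (hz t t0)).
apply: (le_trans (hD _ h)); apply: (@le_trans _ _ ((D + 1) * (a / (D + 1)))).
  by apply: ler_pM => //; [exact: L2norm_ge0|rewrite lerDl|exact: hd].
by rewrite [leLHS]mulrC divfK ?gt_eqF.
Qed.

Lemma L2_continuous_inverse z (v : R -> R -> C) : (forall t, 0 <= t -> L2 (v t)) ->
  (forall t x, 0 <= t -> 0 <= x <= 1 -> z t x = transform p (v t) x) ->
  L2_continuous z -> L2_continuous v.
Proof.
have [D D0 hD] := transform_coercive.
move=> hv e /L2_continuousP[hz cz]; apply/L2_continuousP; split=> // t t0 a a0.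
have k0 : 0 < D + 1 by rewrite ltr_wpDl.
have [d d0 hd] := cz t t0 _ (divr_gt0 a0 k0); exists d => // s s0 ts.
have h := L2B (hv s s0) (hv t t0).
apply: (le_trans (hD _ h)); rewrite (eq_L2norm (g := fun x => z s x - z t x)); last first.
  by move=> x /[dup] x01 /andP[x0 _]; rewrite !e// (transformB (hv s s0) (hv t t0)).
apply: (@le_trans _ _ ((D + 1) * (a / (D + 1)))).
  by apply: ler_pM => //; [exact: L2norm_ge0|rewrite lerDl|exact: hd].
by rewrite [leLHS]mulrC divfK ?gt_eqF.
Qed.

Lemma is_L2_integral_transform z t Z : (forall s, 0 <= s -> L2 (z s)) ->
  is_L2_integral z t Z -> is_L2_integral (fun s => transform p (z s)) t (transform p Z).
Proof.
move=> hz [hZ iZ]; split; first exact: L2_tr.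
move=> f hf; rewrite L2dot_transform// iZ; last exact: L2_adjoint.
by apply: eq_cint => s /andP[s0 _]; rewrite L2dot_transform//; exact: hz.
Qed.

(** The adjoint is onto, being a Volterra operator over [0, y]: every test function for [v] is the
    adjoint image of a test function for [z]. *)
Lemma is_L2_integral_inverse z (v : R -> R -> C) t Z V : (forall s, 0 <= s -> L2 (v s)) -> L2 V ->
  (forall s x, 0 <= s -> 0 <= x <= 1 -> z s x = transform p (v s) x) ->
  (forall x, 0 <= x <= 1 -> Z x = transform p V x) ->
  is_L2_integral z t Z -> is_L2_integral v t V.
Proof.
move=> hv hV ez eZ [hZ iZ]; split; first exact: hV.
move=> f hf; have [g hg e] := adjoint_solve hf.
have ef u : L2dot u f = L2dot u (adjoint_transform g) by apply: eq_cint => x x01; rewrite e.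
rewrite ef -(L2dot_transform hV hg) -(eq_L2dot g eZ) (iZ g hg).
apply: eq_cint => s /andP[s0 _]; rewrite ef -(L2dot_transform (hv s s0) hg).
by apply: eq_L2dot => x x01; exact: ez.
Qed.

End TransformOperator.

(** * Equivalence of the error system with a Neumann problem and an ODE *)

Section ErrorDecoupling.
Context {R : realType}.
Notation C := R[i].
Notation halfline := [set t : R | 0 <= t].
Implicit Types (s t x y : R).

Lemma AC_dot nd (N N1 : R -> 'cV[C]_nd) (w : 'cV[C]_nd) :
  (forall i, AC 0 1 (fun x => N x i 0) (fun x => N1 x i 0)) ->
  AC 0 1 (fun x => dot (N x) w) (fun x => dot (N1 x) w).
Proof.
move=> h; have H (r : seq 'I_nd) : AC 0 1 (fun x => \sum_(i <- r) w i 0 * N x i 0)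
    (fun x => \sum_(i <- r) w i 0 * N1 x i 0).
  elim: r => [|i r IH].
    by apply: (AC_ext _ _ (AC_cst 0 1 0)) => x _; rewrite big_nil.
  by apply: (AC_ext _ _ (ACD (ACZ (w i 0) (h i)) IH)) => x _; rewrite big_cons.
by apply: (AC_ext _ _ (H (index_enum _))) => x _; rewrite dotC dotE.
Qed.

Lemma AC_C2 (f f1 f2 : R -> C) : C2_01 f f1 f2 -> AC 0 1 f f1 /\ AC 0 1 f1 f2.
Proof.
move=> [c0 c1 c2 d]; split; apply: FTC_AC => //.
- by move=> x /d[].
- by move=> x /d[].
Qed.

Lemma L2_dot nd (N : R -> 'cV[C]_nd) (w : 'cV[C]_nd) : (forall i, L2 (fun x => N x i 0)) ->
  L2 (fun x => dot (N x) w).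
Proof.
move=> h; have := L2_sum (index_enum _) (fun i => L2Z (w i 0) (h i)).
by congr L2; apply/funext => x; rewrite dotC dotE.
Qed.

Variables (q co : R) (h : R -> C) (p px pxi pxx pxxi pxixi : R -> R -> C).
Hypothesis hh : ccontinuous I01 h.
Hypothesis hp : is_kernel q co h p px pxi pxx pxxi pxixi.
Variables (g G : R -> C).
Hypothesis hG : is_Fo_inv p g G.
Variables (nd : nat) (Sd : 'M[C]_nd) (qd1 qd2 ld : 'cV[C]_nd) (n n1 n2 : R -> 'cV[C]_nd).
Hypothesis nC2 : forall i, C2_01 (fun x => n x i 0) (fun x => n1 x i 0) (fun x => n2 x i 0).
Hypothesis n_eq : forall x, 0 <= x <= 1 ->
  'i%C *: (n2 x)^T + (n x)^T *m Sd + co%:C *: (n x)^T = G x *: qd1^T.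
Hypotheses (n_0 : (n1 0)^T = qd2^T) (n_1 : (n1 1)^T = 0).

Let cp : ccontinuous2 triangle p. Proof. by case: hp => -[[]]. Qed.
Let hGL : L2 G. Proof. by case: hG. Qed.
Let hn i : L2 (fun x => n x i 0). Proof. exact: L2_AC (AC_C2 (nC2 i)).1. Qed.
Let hn2 i : L2 (fun x => n2 x i 0). Proof. by apply: L2_ccontinuous; have [] := nC2 i. Qed.
Let An w := AC_dot w (fun i => (AC_C2 (nC2 i)).1).
Let An1 w := AC_dot w (fun i => (AC_C2 (nC2 i)).2).
Let hnw w : L2 (fun x => dot (n x) w) := L2_dot w hn.

Let Hn w : is_H2 (fun x => dot (n x) w) (fun x => dot (n1 x) w) (fun x => dot (n2 x) w).
Proof. by apply/is_H2P; split; [exact: L2_dot|exact: An1|exact: An]. Qed.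

Lemma regulator_dot w x : 0 <= x <= 1 ->
  'i%C * dot (n2 x) w + dot (n x) (Sd *m w) + co%:C * dot (n x) w = G x * dot qd1 w.
Proof.
move=> x01; have := congr1 (fun A : 'rV[C]_nd => (A *m w) 0 0) (n_eq x01).
by rewrite /= !mulmxDl -!scalemxAl -mulmxA /dot !mxE.
Qed.

Lemma n1_0 w : dot (n1 0) w = dot qd2 w. Proof. by rewrite /dot n_0. Qed.

Lemma n1_1 w : dot (n1 1) w = 0. Proof. by rewrite /dot n_1 mul0mx mxE. Qed.

Let l := gain_l p pxi n ld.

(** The right-hand side of the integrated equation of v = F_o^{-1} z: [W] is the integrated
    disturbance and [Y] the integrated output. The factor 1 matches the form of [transform_lin]. *)
Let rhs (v0 V V2 : R -> C) (W Y : C) y : C :=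
  v0 y + 1 * (- 'i%C * V2 y - co%:C * V y) + W * G y + Y * dot (n y) ld.

Let L2_rhs v0 V V2 W Y : L2 v0 -> L2 V -> L2 V2 -> L2 (rhs v0 V V2 W Y).
Proof.
move=> h0 hV h2; apply: L2_lin (hnw ld); apply: L2_lin hGL; apply: L2_lin => //.
by apply: L2B; exact: L2Z.
Qed.

(** V'(1) = 0 removes one boundary term of [transform_equation], the p_xi part of l cancels the
    other; the rest of the forcing is F_o applied to G and to n^T l_d. *)
Lemma transform_forcing (v0 V V1 V2 : R -> C) (W : C) x :
  AC 0 1 V V1 -> AC 0 1 V1 V2 -> L2 V2 -> V1 1 = 0 -> L2 v0 -> 0 < x < 1 ->
  transform p v0 x + (- 'i%C * transform2 co h p px pxx V V1 V2 x + h x * transform p V x +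
    (g x * W + l x * V 1)) = transform p (rhs v0 V V2 W (V 1)) x.
Proof.
move=> A0 A1 h2 b1 h0 /[dup] x01 /andP[x0 x1]; have hV := L2_AC A0.
have x01' : 0 <= x <= 1 by rewrite !ltW.
have hw : L2 (fun y => - 'i%C * V2 y - co%:C * V y) by apply: L2B; exact: L2Z.
have h01 := L2_lin 1 h0 hw; have h02 := L2_lin W h01 hGL.
rewrite (transform_equation hh hp A0 A1 h2 x01) b1 mulr0 subr0.
rewrite /rhs (transform_lin cp _ h02 (hnw ld) (ltW x0)) (transform_lin cp _ h01 hGL (ltW x0)).
rewrite (transform_lin cp _ h0 hw (ltW x0)) /l /gain_l !FoE//.
have [_ /(_ x x01')] := hG; rewrite FoE// => <-.
by ring.
Qed.

Let sys w z Y := schrodinger_mild q h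
  (fun t x => g x * cint (fun s => dot qd1 (w s)) 0 t + l x * Y t)
  (fun t => cint (fun s => dot qd2 (w s)) 0 t) (fun t => p 1 1 * Y t) z Y.

Let I01P x : I01 x -> 0 <= x <= 1. Proof. by rewrite /I01/= in_itv. Qed.

(** With V and W the time integrals of v and w, the function V - n^T W is the time integral of e;
    the boundary values of n' are chosen so that it satisfies Neumann conditions. *)
Lemma decouple_error (w : R -> 'cV[C]_nd) z Y : ode_mild Sd (fun t => Y t *: ld) w -> sys w z Y ->
  exists v, [/\ forall t, 0 <= t -> L2 (v t),
    forall t x, 0 <= t -> 0 <= x <= 1 -> z t x = transform p (v t) x &
    neumann_mild co (fun t x => v t x - dot (n x) (w t)) (fun t => Y t - dot (n 1) (vint w 0 t))].
Proof.
move=> [cw ew] [cz hz].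
have /choice[v hv] : forall t, exists f, 0 <= t -> L2 f /\ forall x, 0 <= x <= 1 -> z t x = transform p f x.
  move=> t; have [t0|t0] := leP 0 t; last by exists (fun=> 0).
  by have [f hf e] := transform_solve cp (cz.1 t t0); exists f.
have hvL t (tp : 0 <= t) := (hv t tp).1.
have hvE t x (tp : 0 <= t) := (hv t tp).2 x.
exists v; split => //.
have cv : L2_continuous v := L2_continuous_inverse cp hvL hvE cz.
have cd := L2_continuous_dot hn cw.
have subE (a b : R -> C) : (fun x => a x - b x) = (fun x => a x + -1 * b x).
  by apply/funext => x; rewrite mulN1r.
split.
  have -> : (fun t x => v t x - dot (n x) (w t)) = (fun t x => v t x + -1 * dot (n x) (w t)).
    by apply/funext => t; exact: subE.
  exact: L2_continuous_lin.
move=> t t0; have [Z [Z1 [Z2 [[/is_H2P[hZ2 AZ1 AZ] iZ] b0 b1 y ae]]]] := hz t t0.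
have [V hV eV] := transform_solve cp (L2_AC AZ).
have [V1 [V2 [AV AV1 hV2 eZ1 eZ2]]] := inverse_H2 hh hp hV eV AZ AZ1 hZ2.
have z0 : 0 <= (0 : R) <= 1 by rewrite lexx ler01.
have z1 : 0 <= (1 : R) <= 1 by rewrite lexx ler01.
have V1Y : V 1 = Y t by rewrite y eV// transform_at1.
(* The observer gain contributes p(1,1) Y, exactly the boundary term added by F_o. *)
have bV1 : V1 1 = 0.
  by have := eZ1 1 z1; rewrite b1 transform1_at1 V1Y => /eqP; rewrite -subr_eq0 opprD addrCA subrr addr0 oppr_eq0 => /eqP.
have bV0 : V1 0 = cint (fun s => dot qd2 (w s)) 0 t.
  by have := eZ1 0 z0; rewrite b0 (transform_bnd0 hp _ hV) -eV// => /addrI.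
set W := vint w 0 t.
exists (fun x => V x + -1 * dot (n x) W), (fun x => V1 x + -1 * dot (n1 x) W), (fun x => V2 x + -1 * dot (n2 x) W).
split.
- split.
  + by apply: is_H2_lin (Hn W); apply/is_H2P.
  + have -> : (fun t x => v t x - dot (n x) (w t)) = (fun t x => v t x + -1 * dot (n x) (w t)).
      by apply/funext => s; exact: subE.
    apply: (is_L2_integral_lin (-1) cv cd _ (is_L2_integral_dot hn cw t)).
    refine (is_L2_integral_inverse cp hvL hV hvE eV iZ).
- by rewrite n1_0 bV0 (cint_dot _ _ cw) mulN1r subrr.
- by rewrite n1_1 bV1 mulr0 addr0.
- by rewrite V1Y mulN1r.
(* Both sides have the same image under F_o away from the endpoints, and F_o is injective up to null
   sets. *)
- have key : ae01 (fun x => v t x = rhs (v 0) V V2 (dot qd1 W) (Y t) x).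
    apply: (transform_inj cp (hvL t t0) (L2_rhs _ _ (hvL 0 (lexx 0)) hV hV2)).
    apply: aeS (ae_and ae (ae_and (ae_neq 0) (ae_neq 1))) => x [E [x0 x1]] /[dup] xI /I01P /[dup] x01 /andP[x0' x1'].
    have x01s : 0 < x < 1 by rewrite !lt_neqAle eq_sym x0 x0' x1.
    rewrite -(hvE t x t0 x01) E// (hvE 0 x (lexx 0) x01) (eZ2 x x01) (eV x x01).
    by rewrite (cint_dot _ _ cw) -V1Y (transform_forcing _ AV AV1 hV2 bV1 (hvL 0 (lexx 0)) x01s).
  apply: aeS key => x E /[dup] /E -> /I01P x01.
  (* The equation for n rewrites G q_{d1}^T W - n^T S_d W as i n''^T W + c_o n^T W, which completes
     V to V - n^T W; the two terms Y n^T l_d cancel. *)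
  have /(congr1 (fun c => c - 'i%C * dot (n2 x) W - co%:C * dot (n x) W)) := regulator_dot W x01.
  rewrite (ew t t0) !dotDr dotZr /rhs -/W => r.
  apply/eqP; rewrite -subr_eq0; apply/eqP.
  apply: (@eq_trans _ _ (G x * dot qd1 W - 'i%C * dot (n2 x) W - co%:C * dot (n x) W - dot (n x) (Sd *m W))); first by ring.
  by rewrite -r; ring.
Qed.

(** The converse passage, needed for existence: here the output of the pair is the Neumann output
    plus n(1)^T W. *)
Lemma couple_error (w : R -> 'cV[C]_nd) e Ye :
  ode_mild Sd (fun t => (Ye t + dot (n 1) (vint w 0 t)) *: ld) w -> neumann_mild co e Ye ->
  sys w (fun t => transform p (fun x => e t x + dot (n x) (w t)))
    (fun t => Ye t + dot (n 1) (vint w 0 t)).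
Proof.
move=> [cw ew] [ce he].
have cd := L2_continuous_dot hn cw.
have vE : (fun t x => e t x + dot (n x) (w t)) = (fun t x => e t x + 1 * dot (n x) (w t)).
  by apply/funext => t; apply/funext => x; rewrite mul1r.
have cv : L2_continuous (fun t x => e t x + dot (n x) (w t)).
  by rewrite vE; exact: L2_continuous_lin.
split; first exact: L2_continuous_transform.
move=> t t0; have [E [E1 [E2 [[HE iE] b0 b1 y ae]]]] := he t t0.
have /is_H2P[hE2 AE1 AE] := HE.
set W := vint w 0 t.
pose V x := E x + 1 * dot (n x) W; pose V1 x := E1 x + 1 * dot (n1 x) W.
pose V2 x := E2 x + 1 * dot (n2 x) W.
have HV : is_H2 V V1 V2.
  exact: is_H2_lin HE (Hn W).
have /is_H2P[hV2 AV1 AV] := HV; have hV := L2_AC AV.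
have bV1 : V1 1 = 0 by rewrite /V1 b1 n1_1 mulr0 addr0.
have VY : V 1 = Ye t + dot (n 1) W by rewrite /V y mul1r.
have [AZ AZ1 hZ2] := transform_H2 hh hp AV AV1 hV2.
exists (transform p V), (transform1 p px V V1), (transform2 co h p px pxx V V1 V2).
split.
- split; first exact/is_H2P.
  apply: (is_L2_integral_transform cp); first by case: cv.
  by rewrite vE; exact: (is_L2_integral_lin 1 ce cd iE (is_L2_integral_dot hn cw t)).
- by rewrite (transform_bnd0 hp _ hV) /V1 b0 n1_0 mul1r add0r (cint_dot _ _ cw).
- by rewrite transform1_at1 bV1 add0r VY.
- by rewrite transform_at1 VY.
- have key : ae01 (fun x => e t x + dot (n x) (w t) =
      rhs (fun x => e 0 x + dot (n x) (w 0)) V V2 (dot qd1 W) (V 1) x).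
    apply: aeS ae => x Ex /[dup] /Ex -> /I01P x01.
    have /(congr1 (fun c => c - 'i%C * dot (n2 x) W - co%:C * dot (n x) W)) := regulator_dot W x01.
    rewrite (ew t t0) !dotDr dotZr /rhs -/W VY /V /V2 => r.
    apply/eqP; rewrite -subr_eq0; apply/eqP.
    apply: (@eq_trans _ _ (dot (n x) (Sd *m W) - (G x * dot qd1 W - 'i%C * dot (n2 x) W - co%:C * dot (n x) W))); first by ring.
    by rewrite -r; ring.
  have h0 := cv.1 0 (lexx 0).
  apply: aeS (ae_and key (ae_and (ae_neq 0) (ae_neq 1))) => x [Ex [x0 x1]] /[dup] xI /I01P /[dup] x01 /andP[x0' x1'].
  have x01s : 0 < x < 1 by rewrite !lt_neqAle eq_sym x0 x0' x1.
  rewrite (cint_dot _ _ cw) -/W -VY (transform_forcing _ AV AV1 hV2 bV1 h0 x01s).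
  by apply: (transform_ae cp (cv.1 t t0) (L2_rhs _ _ h0 hV hV2) key x0'); exact: Ex.
Qed.

End ErrorDecoupling.

(** * Stability of the error system *)

Section CorrectedState.
Context {R : realType}.
Notation C := R[i].
Notation halfline := [set t : R | 0 <= t].
Implicit Types (s t x : R).

Lemma mulmx_col_row nd (v u w : 'cV[C]_nd) : v *m u^T *m w = dot u w *: v.
Proof. by rewrite -mulmxA [u^T *m w]mx11_scalar mul_mx_scalar. Qed.

Lemma vec_bound nd (v : 'cV[C]_nd) : exists2 L : R, 0 <= L & forall i, cabs (v i 0) <= L.
Proof.
exists (\sum_i cabs (v i 0)); first by apply: sumr_ge0 => i _; exact: cabs_ge0.
move=> i; rewrite (bigD1 i)//= lerDl; apply: sumr_ge0 => j _; exact: cabs_ge0.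
Qed.

(* The conjugate of [i x^2 / 2]: pairing with it turns the trace [e(1)] that drives the
   disturbance observer into a bounded functional of [e]. *)
Definition corrector x : C := - 'i%C * (2^-1 * x ^+ 2)%:C.

Let k x : C := 'i%C * (2^-1 * x ^+ 2)%:C.

Let kJ x : (corrector x)^* = k x.
Proof. by apply: complexP; rewrite /corrector /k !cE; ring. Qed.

Let AC_k : AC 0 1 k (fun x => 'i%C * x%:C) /\ AC 0 1 (fun x => 'i%C * x%:C) (fun=> 'i%C * 1%:C).
Proof.
have cid : continuous (fun x : R => x) by move=> x; exact: cvg_id.
have Ax : AC 0 1 (fun x : R => x%:C) (fun=> 1%:C).
  by apply: AC_real => //; move=> x; exact: cvg_cst.
split; last exact: ACZ.
apply: (AC_ext _ _ (ACZ ('i%C * (2^-1)%:C) (ACM Ax Ax))) => x _.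
- by apply: complexP; rewrite /k !cE; ring.
- by apply: complexP; rewrite !cE; field.
Qed.

Lemma L2_corrector : L2 corrector.
Proof.
have := L2Z (-1) (L2_AC AC_k.1); congr L2; apply/funext => x.
by rewrite /corrector /k; ring.
Qed.

Variable co : R.
Variables (e : R -> R -> C) (Ye : R -> C).
Hypothesis he : neumann_mild co e Ye.

(** The integral of (i x^2 / 2) e(t), since [L2dot] conjugates its second argument; with [mean] it
    is all that the disturbance equation sees of e. *)
Definition moment t : C := L2dot (e t) corrector.
Definition mean t : C := L2dot (e t) (fun=> 1).

Let h1 : L2 (fun=> 1 : C) := L2_cst 1.

Lemma moment_continuous : ccontinuous halfline moment.
Proof. exact: L2dot_time_continuous he.1 L2_corrector. Qed.

Lemma mean_continuous : ccontinuous halfline mean.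
Proof. exact: L2dot_time_continuous he.1 h1. Qed.

(** Green's formula with k = i x^2 / 2: since k'(0) = 0, k'(1) = i and k'' = i, the term -i E''
    contributes -E(1) plus the integral of E, and E(1) is [Ye t]. *)
Lemma moment_eq t : 0 <= t ->
  moment t = moment 0 - Ye t + (cint mean 0 t - co%:C * cint moment 0 t).
Proof.
move=> t0; have hk := L2_corrector; have [ce /(_ t t0)] := he.
move=> [E [E1 [E2 [[/is_H2P[h2 A1 A0] [hE iE]] b0 b1 y ae]]]].
have e0 := ce.1 0 (lexx 0); have i2 := L2Z (- 'i%C) h2; have i0 := L2Z co%:C hE.
have -> : moment t = L2dot (fun x => e 0 x + (- 'i%C * E2 x - co%:C * E x)) corrector.
  apply: cint_ae; [exact: L2Mi (ce.1 t t0) (L2J hk)|exact: L2Mi (L2D e0 (L2B i2 i0)) (L2J hk)|].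
  by apply: aeS ae => x h x01; rewrite h.
rewrite (L2dotDl e0 (L2B i2 i0) hk) (L2dotBl i2 i0 hk) (L2dotZl _ h2 hk) (L2dotZl _ hE hk).
have e2 : L2dot E2 corrector = cint (fun x => E2 x * k x) 0 1 by apply: eq_cint => x _; rewrite kJ.
have [Ak Ak1] := AC_k.
have by_parts := AC_by_parts2 ler01 A0 A1 Ak Ak1.
rewrite -(iE _ hk) -(iE _ h1) e2 by_parts b0 b1 -y.
have -> : cint (fun x => E x * ('i%C * 1%:C)) 0 1 = 'i%C * L2dot E (fun=> 1).
  by rewrite -(cintZ 'i%C (L2Mi hE (L2J h1))); apply: eq_cint => x _; rewrite conjC1; ring.
rewrite -/(moment 0).
have ii : 'i%C * 'i%C = -1 :> C by rewrite -expr2 sqr_i.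
set m := L2dot E _; set c := L2dot E _.
apply: (@eq_trans _ _ (moment 0 + ('i%C * 'i%C * Ye t - 'i%C * 'i%C * m - co%:C * c))); first by ring.
by rewrite ii; ring.
Qed.

Variables (nd : nat) (Sd : 'M[C]_nd) (ld nu : 'cV[C]_nd).

Let A := Sd + ld *m nu^T.

(** The forcing in theta' = A theta + residual for theta = w + moment l_d: the trace cancels against
    the derivative of the moment, and the last summand pays for writing A theta instead of A w. *)
Definition residual s : 'cV[C]_nd :=
  (mean s - co%:C * moment s) *: ld + (- moment s) *: (A *m ld).

Let cb1 : ccontinuous halfline (fun s => mean s - co%:C * moment s).
Proof.
have -> : (fun s => mean s - co%:C * moment s) = (fun s => mean s + - co%:C * moment s).
  by apply/funext => s; rewrite mulNr.
exact: ccontinuousD mean_continuous (ccontinuousZ _ moment_continuous).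
Qed.

Let cb2 : ccontinuous halfline (fun s => - moment s).
Proof.
have -> : (fun s => - moment s) = (fun s => -1 * moment s) by apply/funext => s; rewrite mulN1r.
exact: ccontinuousZ _ moment_continuous.
Qed.

Lemma residual_continuous : vcontinuous halfline residual.
Proof. exact: vcontinuousD (vcontinuous_scale ld cb1) (vcontinuous_scale (A *m ld) cb2). Qed.

(** By [moment_eq] the defects of the two integrated equations are the same vector. One direction
    serves the decay estimate, the other the construction of solutions. *)
Lemma corrected_ode (w : R -> 'cV[C]_nd) : vcontinuous halfline w ->
  (forall t, 0 <= t -> w t + moment t *: ld = w 0 + moment 0 *: ld +
     A *m vint (fun s => w s + moment s *: ld) 0 t + vint residual 0 t) <->
  (forall t, 0 <= t -> w t = w 0 + Sd *m vint w 0 t + (Ye t + dot nu (vint w 0 t)) *: ld).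
Proof.
move=> cw; have cm := vcontinuous_scale ld moment_continuous.
have im t := halfline_integrable t moment_continuous.
have ime t := halfline_integrable t mean_continuous.
have key t : 0 <= t -> w t + moment t *: ld - (w 0 + moment 0 *: ld +
     A *m vint (fun s => w s + moment s *: ld) 0 t + vint residual 0 t) =
   w t - (w 0 + Sd *m vint w 0 t + (Ye t + dot nu (vint w 0 t)) *: ld).
  move=> t0; rewrite (vintD t cw cm) (vint_scale ld (im t)).
  have -> : vint residual 0 t = (cint mean 0 t - co%:C * cint moment 0 t) *: ld +
      (- cint moment 0 t) *: (A *m ld).
    have i1 := cintegrableB (ime t) (cintegrableZ co%:C (im t)).
    rewrite (vintD t (vcontinuous_scale ld cb1) (vcontinuous_scale (A *m ld) cb2)).
    by rewrite (vint_scale _ i1) (vint_scale _ (cintegrableN (im t)))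
        (cintB (ime t) (cintegrableZ co%:C (im t))) (cintZ _ (im t)) (cintN (im t)).
  rewrite (moment_eq t0) mulmxDr -scalemxAr [in A *m vint w 0 t]/A mulmxDl mulmx_col_row.
  move: (A *m ld) (Sd *m vint w 0 t) (dot nu _) (cint mean 0 t) (cint moment 0 t) => a b c d f.
  by apply/matrixP => i j; rewrite !mxE; ring.
split=> h t t0; apply/eqP; rewrite -subr_eq0.
- by rewrite -key// h// subrr.
- by rewrite key// {1}h// subrr.
Qed.

Let K1 := L2norm corrector.
Let K2 := L2norm (fun=> 1 : C).

Lemma moment_le t : 0 <= t -> cabs (moment t) <= K1 * (L2norm (e 0) * expR (- co * t)).
Proof.
move=> t0; have [hL _] := he.1; apply: (le_trans (Cauchy_Schwarz (hL t t0) L2_corrector)).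
rewrite mulrC; apply: ler_wpM2l; first exact: L2norm_ge0.
by rewrite mulrC; exact: neumann_decay he t0.
Qed.

Lemma mean_le t : 0 <= t -> cabs (mean t) <= K2 * (L2norm (e 0) * expR (- co * t)).
Proof.
move=> t0; have [hL _] := he.1; apply: (le_trans (Cauchy_Schwarz (hL t t0) h1)).
rewrite mulrC; apply: ler_wpM2l; first exact: L2norm_ge0.
by rewrite mulrC; exact: neumann_decay he t0.
Qed.

End CorrectedState.

(** * Decay estimate and existence for the error system *)

Section Stability.
Context {R : realType}.
Notation C := R[i].
Notation halfline := [set t : R | 0 <= t].
Implicit Types (s t x : R).

(** The root of a sum of N squares, each at most B^2, is at most N B. *)
Lemma state_norm_le nd nr (X : @state R nd nr) (B : R) : 0 <= B ->
  (forall i, cabs (st_d X i 0) <= B) -> (forall i, cabs (st_r X i 0) <= B) ->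
  L2norm (st_z X) <= B -> state_norm X <= (nd + nr + 1)%:R * B.
Proof.
move=> B0 hd hr hz; rewrite /state_norm.
have v2 k (v : 'cV[C]_k) : (forall i, cabs (v i 0) <= B) -> vabs2 v <= k%:R * B ^+ 2.
  move=> hv; rewrite mulr_natl -[X in _ *+ X]card_ord -sumr_const; apply: ler_sum => i _.
  by rewrite lerXn2r// nnegrE cabs_ge0.
have k1 : 1 <= (nd + nr + 1)%:R :> R by rewrite addn1 ler1n.
have h1 := v2 _ _ hd; have h2 := v2 _ _ hr.
have h3 : L2norm (st_z X) ^+ 2 <= B ^+ 2 by rewrite lerXn2r// nnegrE L2norm_ge0.
have c0 : 0 <= (nd + nr + 1)%:R * B by rewrite mulr_ge0.
rewrite -[leRHS]ger0_norm// -sqrtr_sqr; apply: ler_wsqrtr.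
apply: (le_trans (lerD (lerD h1 h2) h3)).
rewrite -[X in _ + X]mul1r -!mulrDl -natrD -(natrD _ _ 1) exprMn; apply: ler_wpM2r; first exact: sqr_ge0.
by rewrite expr2 ler_peMr//; lra.
Qed.

Lemma vabs2_ge0 k (v : 'cV[C]_k) : 0 <= vabs2 v.
Proof. by apply: sumr_ge0 => i _; exact: sqr_ge0. Qed.

Lemma vabs2_coord k (v : 'cV[C]_k) i : cabs (v i 0) ^+ 2 <= vabs2 v.
Proof. by rewrite /vabs2 (bigD1 i)//= lerDl; apply: sumr_ge0 => j _; exact: sqr_ge0. Qed.

Lemma le_state_norm nd nr (X : @state R nd nr) : [/\ forall i, cabs (st_d X i 0) <= state_norm X,
  forall i, cabs (st_r X i 0) <= state_norm X & L2norm (st_z X) <= state_norm X].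
Proof.
have sq (a b : R) : 0 <= a -> a ^+ 2 <= b -> a <= Num.sqrt b.
  by move=> a0 ab; rewrite -[a]ger0_norm// -sqrtr_sqr ler_wsqrtr.
have hd := vabs2_ge0 (st_d X); have hr := vabs2_ge0 (st_r X); have hz := sqr_ge0 (L2norm (st_z X)).
split=> [i|i|]; apply: sq; rewrite ?cabs_ge0 ?L2norm_ge0//.
- by have := vabs2_coord (st_d X) i; lra.
- by have := vabs2_coord (st_r X) i; lra.
- by lra.
Qed.

Lemma state_norm_ge0 nd nr (X : @state R nd nr) : 0 <= state_norm X.
Proof. exact: sqrtr_ge0. Qed.

Lemma dot_bounded nd (N : R -> 'cV[C]_nd) : (forall i, L2 (fun x => N x i 0)) ->
  exists2 c : R, 0 <= c & forall (w : 'cV[C]_nd) B, 0 <= B -> (forall i, cabs (w i 0) <= B) ->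
    L2norm (fun x => dot (N x) w) <= c * B.
Proof.
move=> hN; exists (\sum_i L2norm (fun x => N x i 0)); first by apply: sumr_ge0 => i _; exact: L2norm_ge0.
move=> w B B0 hw.
have H (r : seq 'I_nd) : L2norm (fun x => \sum_(i <- r) w i 0 * N x i 0) <=
    (\sum_(i <- r) L2norm (fun x => N x i 0)) * B.
  elim: r => [|i r IH].
    rewrite big_nil mul0r (eq_L2norm (g := fun=> 0)); last by move=> x _; rewrite big_nil.
    by apply: L2norm_bound => //; [exact: L2_cst|move=> x _; rewrite cabs0].
  rewrite big_cons mulrDl (eq_L2norm (g := fun x => w i 0 * N x i 0 + \sum_(j <- r) w j 0 * N x j 0)); last first.
    by move=> x _; rewrite big_cons.
  apply: (le_trans (L2norm_triangle (L2Z _ (hN i)) (L2_sum r (fun j => L2Z (w j 0) (hN j))))).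
  apply: lerD IH; rewrite (L2normZ _ (hN i)) mulrC.
  by apply: ler_wpM2l; [exact: L2norm_ge0|exact: hw].
by apply: (le_trans _ (H (index_enum _))); rewrite le_eqVlt; apply/orP; left; apply/eqP;
  apply: eq_L2norm => x _; rewrite dotC dotE.
Qed.

Lemma vint0 k t : vint (fun=> 0 : 'cV[C]_k) 0 t = 0.
Proof. by apply/matrixP => i j; rewrite [LHS]mxE [RHS]mxE -[RHS](cint0 0 t); apply: eq_cint => s _; rewrite mxE. Qed.

Lemma entryD k (a b : 'cV[C]_k) i : (a + b) i 0 = a i 0 + b i 0. Proof. by rewrite mxE. Qed.

Lemma entryZ k (c : C) (a : 'cV[C]_k) i : (c *: a) i 0 = c * a i 0. Proof. by rewrite mxE. Qed.

Variables (nd nr : nat) (q co : R) (h : R -> C) (p px pxi pxx pxxi pxixi : R -> R -> C).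
Hypothesis co0 : 0 < co.
Hypothesis hh : ccontinuous I01 h.
Hypothesis hp : is_kernel q co h p px pxi pxx pxxi pxixi.
Variables (g G : R -> C).
Hypothesis hG : is_Fo_inv p g G.
Variables (Sd : 'M[C]_nd) (Sr : 'M[C]_nr) (qd1 qd2 ld : 'cV[C]_nd) (qr lr : 'cV[C]_nr).
Variable n : R -> 'cV[C]_nd.
Hypothesis hn : is_regulator_sol co Sd qd1 qd2 G n.
Hypothesis hlr : hurwitz (Sr + lr *m qr^T).
Hypothesis hld : hurwitz (Sd + ld *m (n 1)^T).
Variables (lamr : 'I_nr -> C) (lamd : 'I_nd -> C).
Hypothesis hlamr : simple_spectrum (Sr + lr *m qr^T) lamr.
Hypothesis hlamd : simple_spectrum (Sd + ld *m (n 1)^T) lamd.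

Let err := error_system q h g Sd Sr qd1 qd2 qr ld lr (gain_l p pxi n ld) (p 1 1).

Let cp : ccontinuous2 triangle p. Proof. by case: hp => -[[]]. Qed.

Let hnL i : L2 (fun x => n x i 0).
Proof. by have [n1 [n2 [c _ _ _]]] := hn; exact: L2_AC (AC_C2 (c i)).1. Qed.

Lemma error_estimate : exists M m : R, [/\ 1 <= M, 0 < m &
  forall X, err X -> forall t, 0 <= t -> state_norm (X t) <= M * expR (- m * t) * state_norm (X 0)].
Proof.
have [n1 [n2 [nC2 neq n10 n11]]] := hn.
have [Db Db0 hDb] := transform_bounded cp; have [Dc Dc0 hDc] := transform_coercive cp.
have [cn cn0 hcn] := dot_bounded hnL; have [L L0 hL] := vec_bound ld.
have [La La0 hLa] := vec_bound ((Sd + ld *m (n 1)^T) *m ld).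
have [Md [md [Md0 md0 hMd]]] := ode_decay hlamd hld co0.
have [Mr [mr [Mr0 mr0 hMr]]] := ode_decay hlamr hlr co0.
pose K1 := L2norm (@corrector R); pose K2 := L2norm (fun=> 1 : C).
have K10 : 0 <= K1 := L2norm_ge0 _; have K20 : 0 <= K2 := L2norm_ge0 _.
(* Bounds e(0): [Dc] for the inverse of F_o, [cn] for the product n^T w(0). *)
pose c1 := Dc + cn; have c10 : 0 <= c1 by rewrite addr_ge0.
(* Bounds the forcing [residual] in terms of the norm of e. *)
pose Lb := (K2 + co * K1) * L + K1 * La.
have Lb0 : 0 <= Lb := addr_ge0 (mulr_ge0 (addr_ge0 K20 (mulr_ge0 (ltW co0) K10)) L0) (mulr_ge0 K10 La0).
(* The common bound that [ode_decay] requires: 1 + K1 c1 L for the initial corrected state, Lb c1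
   for the forcing. *)
pose c2 := 1 + K1 * c1 * L + Lb * c1.
have c20 : 0 <= c2 by rewrite !addr_ge0 ?mulr_ge0.
(* Undoing the correction by the moment costs another K1 c1 L. *)
pose c3 := Md * c2 + K1 * c1 * L.
have c30 : 0 <= c3 by rewrite addr_ge0 ?mulr_ge0.
(* From z = F_o (e + n^T w). *)
pose c4 := Db * (c1 + cn * c3).
have c40 : 0 <= c4 by rewrite mulr_ge0// addr_ge0// mulr_ge0.
pose c := c3 + Mr + c4; have c0 : 0 <= c := addr_ge0 (addr_ge0 c30 Mr0) c40.
pose m := Num.min (Num.min md mr) co.
have m0 : 0 < m by rewrite !lt_min md0 mr0.
have [mmd [mmr mco]] : m <= md /\ m <= mr /\ m <= co by rewrite /m !ge_min !lexx !orbT.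
(* The summand 1 ensures M >= 1. *)
exists (1 + (nd + nr + 1)%:R * c), m; split => //; first by rewrite lerDl mulr_ge0.
move=> X [Y [er ed ez]] t t0.
have [v [hvL hvE he]] := decouple_error hh hp hG nC2 neq n10 n11 ed ez.
set w := fun t => st_d (X t); set e := fun t x => v t x - dot (n x) (w t).
have {}he : neumann_mild co e (fun t => Y t - dot (n 1) (vint w 0 t)) := he.
set N0 := state_norm (X 0); have N00 : 0 <= N0 := state_norm_ge0 _.
have [bd br bz] := le_state_norm (X 0); rewrite -/N0 in bd br bz.
have E m' s : m <= m' -> 0 <= s -> expR (- m' * s) <= expR (- m * s).
  by move=> mm s0; rewrite ler_expR ler_wpM2r// lerN2.
have e0 : L2norm (e 0) <= c1 * N0.
  have hv0 := hvL 0 (lexx 0); have hd0 := L2_dot (w 0) hnL.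
  apply: (le_trans (L2norm_triangleB hv0 hd0)); rewrite mulrDl; apply: lerD; last exact: hcn.
  apply: (le_trans (hDc _ hv0)); apply: ler_wpM2l => //.
  by rewrite -(eq_L2norm (f := st_z (X 0))) => // x x01; exact: hvE.
have ee s : 0 <= s -> L2norm (e 0) * expR (- co * s) <= c1 * N0 * expR (- co * s).
  by move=> s0; apply: ler_wpM2r => //; exact: expR_ge0.
have km s : 0 <= s -> cabs (moment e s) <= K1 * (c1 * N0 * expR (- co * s)).
  by move=> s0; apply: (le_trans (moment_le he s0)); apply: ler_wpM2l => //; exact: ee.
have kme s : 0 <= s -> cabs (mean e s) <= K2 * (c1 * N0 * expR (- co * s)).
  by move=> s0; apply: (le_trans (mean_le he s0)); apply: ler_wpM2l => //; exact: ee.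
have cw : vcontinuous halfline w by case: ed.
pose th s := w s + moment e s *: ld.
have hth : ode_mild (Sd + ld *m (n 1)^T) (fun t => vint (residual co e Sd ld (n 1)) 0 t) th.
  split; first exact: vcontinuousD cw (vcontinuous_scale ld (moment_continuous he)).
  apply/(corrected_ode he Sd ld (n 1) cw) => s s0.
  by rewrite subrK; case: ed => _; exact.
have thb i s : 0 <= s -> cabs (th s i 0) <= Md * (c2 * N0) * expR (- md * s).
  apply: (hMd _ _ _ (residual_continuous he Sd ld (n 1)) hth).
  - exact: mulr_ge0.
  - move=> j; rewrite /th entryD entryZ; apply: (le_trans (cabsD _ _)); rewrite cabsM.
    have k0 := km 0 (lexx 0); rewrite mulr0 expR0 mulr1 in k0.
    apply: (@le_trans _ _ (N0 + K1 * (c1 * N0) * L)).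
      by apply: lerD => //; apply: ler_pM => //; exact: cabs_ge0.
    rewrite [leRHS](_ : _ = N0 + K1 * (c1 * N0) * L + Lb * (c1 * N0)); last by rewrite /c2; ring.
    by rewrite lerDl; exact: mulr_ge0 Lb0 (mulr_ge0 c10 N00).
  - move=> r j r0; set ex := expR (- co * r); have ex0 : 0 <= ex := expR_ge0 _.
    have F0 : 0 <= c1 * N0 * ex by rewrite !mulr_ge0.
    have k1 := km r r0; have k2 := kme r r0; rewrite -/ex in k1 k2.
    rewrite /residual entryD !entryZ; apply: (le_trans (cabsD _ _)); rewrite !cabsM cabsN.
    have k3 : cabs (mean e r - co%:C * moment e r) <= (K2 + co * K1) * (c1 * N0 * ex).
      apply: (le_trans (cabsB _ _)); rewrite cabsM cabs_real (gtr0_norm co0) mulrDl -(mulrA co).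
      exact: lerD k2 (ler_wpM2l (ltW co0) k1).
    have k4 := ler_pM (cabs_ge0 _) (cabs_ge0 _) k3 (hL j).
    have k5 := ler_pM (cabs_ge0 _) (cabs_ge0 _) k1 (hLa j).
    apply: (le_trans (lerD k4 k5)).
    rewrite [leRHS](_ : _ = (K2 + co * K1) * (c1 * N0 * ex) * L + K1 * (c1 * N0 * ex) * La +
      (1 + K1 * c1 * L) * (N0 * ex)); last by rewrite /c2 /Lb; ring.
    by rewrite lerDl; exact: mulr_ge0 (addr_ge0 ler01 (mulr_ge0 (mulr_ge0 K10 c10) L0)) (mulr_ge0 N00 ex0).
have Ex0 : 0 <= expR (- m * t) := expR_ge0 _.
set ex := expR (- m * t) in Ex0 *.
have wb i : cabs (w t i 0) <= c3 * N0 * ex.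
  have -> : w t i 0 = th t i 0 - moment e t * ld i 0.
    by rewrite /th entryD entryZ addrK.
  apply: (le_trans (cabsB _ _)); rewrite cabsM /c3 mulrDl mulrDl; apply: lerD.
    apply: (le_trans (thb i t t0)); rewrite -!mulrA; do 3 (apply: ler_wpM2l => //).
    exact: E.
  apply: (le_trans (ler_pM (cabs_ge0 _) (cabs_ge0 _) (km t t0) (hL i))).
  rewrite (_ : K1 * c1 * L * N0 * ex = K1 * (c1 * N0 * ex) * L); last by ring.
  apply: ler_wpM2r => //; apply: ler_wpM2l => //; apply: ler_wpM2l; first exact: mulr_ge0.
  exact: E.
have rb i : cabs (st_r (X t) i 0) <= Mr * N0 * ex.
  have c00 : vcontinuous halfline (fun=> 0 : 'cV[C]_nr) by move=> j; exact: ccontinuous_cst.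
  have er' : ode_mild (Sr + lr *m qr^T) (fun t => vint (fun=> 0) 0 t) (fun t => st_r (X t)).
    by apply: ode_ext er => s _; rewrite vint0.
  apply: (le_trans (hMr _ _ _ c00 er' N00 br _ t i t0)).
    by move=> s j _; rewrite mxE cabs0 mulr_ge0// expR_ge0.
  by apply: ler_wpM2l; [exact: mulr_ge0|exact: E].
have zb : L2norm (st_z (X t)) <= c4 * N0 * ex.
  have hvt := hvL t t0; have hdt := L2_dot (w t) hnL.
  have et : L2norm (e t) <= c1 * N0 * ex.
    apply: (le_trans (neumann_decay he t0)); rewrite mulrC.
    apply: (le_trans (ee t t0)); apply: ler_wpM2l; [exact: mulr_ge0|exact: E].
  have b0 : 0 <= c3 * N0 * ex by rewrite !mulr_ge0.
  rewrite (eq_L2norm (g := transform p (v t))); last by move=> x; exact: hvE.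
  apply: (le_trans (hDb _ hvt)); rewrite /c4 -!mulrA; apply: ler_wpM2l => //.
  rewrite (eq_L2norm (g := fun x => e t x + dot (n x) (w t))); last by move=> x _; rewrite /e subrK.
  apply: (le_trans (L2norm_triangle (L2B hvt hdt) hdt)).
  rewrite mulrDl -!mulrA; apply: lerD; first by rewrite mulrA.
  by rewrite !mulrA -(mulrA cn) -(mulrA cn); exact: hcn.
apply: (@le_trans _ _ ((nd + nr + 1)%:R * (c * N0 * ex))).
  have pos b : 0 <= b -> 0 <= b * N0 * ex by move=> b0; exact: mulr_ge0 (mulr_ge0 b0 N00) Ex0.
  have [a1 a2 a3] := And3 (pos _ c30) (pos _ Mr0) (pos _ c40).
  have cE : c * N0 * ex = c3 * N0 * ex + Mr * N0 * ex + c4 * N0 * ex by rewrite /c; ring.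
  apply: state_norm_le; first exact: pos.
  - by move=> i; apply: (le_trans (wb i)); rewrite cE; lra.
  - by move=> i; apply: (le_trans (rb i)); rewrite cE; lra.
  - by apply: (le_trans zb); rewrite cE; lra.
rewrite [leRHS](_ : _ = ex * N0 + (nd + nr + 1)%:R * (c * N0 * ex)); last by ring.
by rewrite lerDr; exact: mulr_ge0 Ex0 N00.
Qed.

(** The decoupling is run backwards: e starts from F_o^{-1} z(0) - n^T w(0), the corrected ODE is
    solved from w(0) + moment(0) l_d, the correction is subtracted, and F_o is applied to e + n^T
    w. *)
Lemma error_exists X0 : L2 (st_z X0) -> exists2 X, err X & state_eq (X 0) X0.
Proof.
move=> hX0; have [n1 [n2 [nC2 neq n10 n11]]] := hn.
have [v0 hv0 ev0] := transform_solve cp hX0.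
have hd0 := L2_dot (st_d X0) hnL.
have [e [Ye he ee]] := neumann_solve co0 (L2B hv0 hd0).
have [th [cth eth] th0] := ode_solve hlamd (st_d X0 + moment e 0 *: ld) (residual_continuous he Sd ld (n 1)).
pose w t := th t - moment e t *: ld.
have cw : vcontinuous halfline w.
  have := vcontinuousD cth (vcontinuousZ (-1) (vcontinuous_scale ld (moment_continuous he))).
  by congr vcontinuous; apply/funext => t; rewrite scaleN1r.
have w0 : w 0 = st_d X0 by rewrite /w th0 addrK.
have ode : ode_mild Sd (fun t => (Ye t + dot (n 1) (vint w 0 t)) *: ld) w.
  split=> //; apply/(corrected_ode he Sd ld (n 1) cw) => t t0.
  have wE s : w s + moment e s *: ld = th s by rewrite /w subrK.
  have -> : (fun s => w s + moment e s *: ld) = th by apply/funext.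
  by rewrite (wE t) (wE 0); exact: eth.
have c00 : vcontinuous halfline (fun=> 0 : 'cV[C]_nr) by move=> j; exact: ccontinuous_cst.
have [r hr r0] := ode_solve hlamr (st_r X0) c00.
have sz := couple_error hh hp hG nC2 neq n10 n11 ode he.
exists (fun t => State (w t) (r t) (transform p (fun x => e t x + dot (n x) (w t)))).
  exists (fun t => Ye t + dot (n 1) (vint w 0 t)); split => //.
  by apply: ode_ext hr => t _; rewrite vint0.
split=> //=.
have h0 : L2 (fun x => e 0 x + dot (n x) (w 0)) by apply: L2D (L2_dot _ hnL); case: he => -[hL _] _; exact: hL.
(* The Neumann solution takes its initial value only up to a null set, so the initial state is
   recovered in the sense of [state_eq]. *)
have key : ae01 (fun x => e 0 x + dot (n x) (w 0) = v0 x).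
  by apply: aeS ee => x E x01; rewrite E// w0 subrK.
apply: aeS key => x E x01; have [x0 x1] : 0 <= x /\ x <= 1 by move: x01; rewrite /I01/= in_itv => /andP.
rewrite ev0 ?x0//; apply: (transform_ae cp h0 hv0 _ x0); last exact: E.
by apply: aeS ee => y Ey y01; rewrite Ey// w0 subrK.
Qed.

End Stability.

(** * The spectrum and the observer *)

Section Spectrum.
Context {R : realType}.
Notation C := R[i].

(** If [a] were none of the listed values, Green's formula would make all cosine coefficients of an
    eigenfunction vanish; conversely each cosine is an eigenfunction. *)
Lemma sigma_oE (co : R) : sigma_o co =
  [set a : C | exists j : nat, a = 'i%C * (j%:R ^+ 2 * pi ^+ 2)%:C - co%:C].
Proof.
have fE j : freq j = j%:R ^+ 2 * pi ^+ 2 :> R by rewrite /freq exprMn.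
apply/seteqP; split=> a /=.
- move=> [f [f1 [f2 [/is_H2P[h2 A1 A0] [b0 b1] [x x01 fx] ae]]]].
  apply: contrapT => /forallNP na; have hf := L2_AC A0.
  have c0 j : coef f j = 0.
    have : coef (fun x => - 'i%C * f2 x - co%:C * f x) j = coef (fun x => a * f x) j.
      rewrite !coefE; apply: cint_ae; [exact: L2Mi (L2B (L2Z _ h2) (L2Z _ hf)) (L2_phi j)|exact: L2Mi (L2Z _ hf) (L2_phi j)|].
      by apply: aeS ae => y E y01; rewrite E.
    rewrite (coefB j (L2Z _ h2) (L2Z _ hf)) !coefZ// (coef_second_derivative j A0 A1) b0 b1.
    rewrite !mul0r subrr sub0r => /eqP; rewrite -subr_eq0 => /eqP e.
    have /eqP : ('i%C * (freq j)%:C - co%:C - a) * coef f j = 0 by rewrite -[RHS]e; ring.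
    by rewrite mulf_eq0 subr_eq0 => /orP[/eqP ej|/eqP//]; case: (na j); rewrite -ej fE.
  have f0 := coef_uniqueness hf c0.
  (* An eigenfunction is nonzero at some point, so vanishing almost everywhere must be improved: f''
     = 0 almost everywhere and f'(0) = 0 make f constant, and its mean is zero. *)
  have f20 : ae01 (fun y => f2 y = 0).
    apply: aeS (ae_and f0 ae) => y [F E] y01; have := E y01; rewrite F// !mulr0 subr0 => /eqP.
    by rewrite mulf_eq0 oppr_eq0 => /orP[/eqP i0|/eqP//]; have := @sqr_i R; rewrite i0 expr0n/= => /eqP; rewrite eq_sym oppr_eq0 oner_eq0.
  have f10 y : 0 <= y <= 1 -> f1 y = 0.
    move=> /andP[y0 y1]; have [_ ->] := A1; last by rewrite y0.
    rewrite b0 add0r -(cint0 0 y); apply: cint_ae.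
    - exact: cintegrableS (lexx 0) y1 (L2_i h2).
    - exact: cintegrable_cst.
    - by apply: aeS f20 => z E /andP[z0 zy]; apply: E; rewrite /I01/= in_itv/= z0 (le_trans zy y1).
  have fc y : 0 <= y <= 1 -> f y = f 0.
    move=> /andP[y0 y1]; have [_ ->] := A0; last by rewrite y0.
    rewrite (eq_cint (g := fun=> 0)) ?cint0 ?addr0// => z /andP[z0 zy].
    by apply: f10; rewrite z0 (le_trans zy y1).
  have := c0 0%N; rewrite coef0E (eq_cint fc) (cint_cst _ ler01) subr0 mulr1 => f00.
  by move: fx; rewrite fc// f00 eqxx.
- move=> [j ->]; exists (phi j), (phi1 j), (fun x => - (freq j)%:C * phi j x); split.
  + by apply/is_H2P; split; [exact: L2Z (L2_phi j)|exact: AC_phi1|exact: AC_phi].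
  + by rewrite phi1_0 phi1_1.
  + exists 0; first by rewrite lexx ler01.
    rewrite /phi /cosn !mulr0 cos0 mulr1 eq_complex/= eqxx andbT.
    by rewrite gt_eqF// wcos_gt0.
  + by apply: ae_all => x _; rewrite -fE; ring.
Qed.

End Spectrum.

(** * Observer trajectories as translates of error trajectories *)

Section ObserverDynamics.
Context {R : realType}.
Notation C := R[i].
Notation halfline := [set t : R | 0 <= t].
Implicit Types (s t x : R).

Section states.
Context {nd nr : nat}.
Local Notation state := (@state R nd nr).
Implicit Types X : state.

Definition state_lin (c : C) X X' : state :=
  State (st_d X + c *: st_d X') (st_r X + c *: st_r X') (fun x => st_z X x + c * st_z X' x).

Lemma state_subE X X' : state_sub X X' = state_lin (-1) X X'.
Proof.
rewrite /state_sub /state_lin !scaleN1r; congr State.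
by apply/funext => x; rewrite mulN1r.
Qed.

Lemma state_eq_norm X X' : L2 (st_z X) -> L2 (st_z X') -> state_eq X X' ->
  state_norm (state_lin (-1) X X') = 0.
Proof.
move=> h h' [ed er ez]; rewrite /state_norm/= ed er !scaleN1r !subrr.
have v0 k : vabs2 (0 : 'cV[C]_k) = 0 by rewrite /vabs2 big1// => i _; rewrite mxE cabs0 expr0n.
have z0 : L2norm (fun=> 0 : C) = 0.
  apply/eqP; rewrite eq_le L2norm_ge0 andbT.
  by apply: L2norm_bound => //; [exact: L2_cst|move=> x _; rewrite cabs0].
rewrite !v0 (L2norm_ae (L2_lin (-1) h h') (L2_cst 0)) ?z0 ?expr0n ?addr0 ?sqrtr0//.
by apply: aeS ez => x E x01; rewrite E// mulN1r subrr.
Qed.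

Lemma state_norm_eq X X' : L2 (st_z X) -> L2 (st_z X') ->
  state_norm (state_lin (-1) X X') <= 0 -> state_eq X X'.
Proof.
move=> h h' n0; have [hd hr hz] := le_state_norm (state_lin (-1) X X'); split.
- apply/matrixP => i j; rewrite ord1; apply/eqP; rewrite -subr_eq0; apply/eqP; apply: cabs_eq0.
  apply/eqP; rewrite eq_le cabs_ge0 andbT; apply: (le_trans _ (le_trans (hd i) n0)).
  by rewrite /= entryD entryZ mulN1r.
- apply/matrixP => i j; rewrite ord1; apply/eqP; rewrite -subr_eq0; apply/eqP; apply: cabs_eq0.
  apply/eqP; rewrite eq_le cabs_ge0 andbT; apply: (le_trans _ (le_trans (hr i) n0)).
  by rewrite /= entryD entryZ mulN1r.
- have hL := L2_lin (-1) h h'.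
  have : L2norm (fun x => st_z X x + -1 * st_z X' x) = 0.
    by apply/eqP; rewrite eq_le L2norm_ge0 andbT; exact: (le_trans hz n0).
  move=> /(L2norm_eq0 hL); apply: aeS => x E /E /eqP; rewrite mulN1r subr_eq0 => /eqP.
  by [].
Qed.
End states.

Lemma ode_block nd nr (Sd : 'M[C]_nd) (Sr : 'M[C]_nr) (d : R -> 'cV[C]_nd) (r : R -> 'cV[C]_nr) :
  ode_mild (block_mx Sd 0 0 Sr) (fun=> 0) (fun t => col_mx (d t) (r t)) ->
  ode_mild Sd (fun=> 0) d /\ ode_mild Sr (fun=> 0) r.
Proof.
move=> [c e].
have cd : vcontinuous halfline d.
  move=> i; have -> : (fun t => d t i 0) = (fun t => col_mx (d t) (r t) (lshift _ i) 0) by apply/funext => t; rewrite col_mxEu.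
  exact: c.
have cr : vcontinuous halfline r.
  move=> i; have -> : (fun t => r t i 0) = (fun t => col_mx (d t) (r t) (rshift _ i) 0) by apply/funext => t; rewrite col_mxEd.
  exact: c.
have vE t : vint (fun s => col_mx (d s) (r s)) 0 t = col_mx (vint d 0 t) (vint r 0 t).
  apply/matrixP => i j; rewrite ord1 mxE; case: (split_ordP i) => k ->.
  - by rewrite col_mxEu [RHS]mxE; apply: eq_cint => s _; rewrite col_mxEu.
  - by rewrite col_mxEd [RHS]mxE; apply: eq_cint => s _; rewrite col_mxEd.
by split; split=> // t t0; have := e t t0;
  rewrite vE mul_block_col !mul0mx !addr0 add0r add_col_mx => /eq_col_mx[].
Qed.

Lemma ode_feedback nr (Sr : 'M[C]_nr) (lr qr : 'cV[C]_nr) (r : R -> 'cV[C]_nr) :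
  ode_mild (Sr + lr *m qr^T) (fun=> 0) r <->
  ode_mild Sr (fun t => cint (fun s => dot qr (r s)) 0 t *: lr) r.
Proof.
split=> -[c e]; split=> // t t0; rewrite {1}(e t t0) (cint_dot _ _ c) mulmxDl mulmx_col_row.
- by rewrite addr0 addrA.
- by rewrite addr0 addrA.
Qed.

Lemma cint_dot_lin k (a : 'cV[C]_k) c (w w' : R -> 'cV[C]_k) t : vcontinuous halfline w ->
  vcontinuous halfline w' ->
  cint (fun s => dot a (w s + c *: w' s)) 0 t =
  cint (fun s => dot a (w s)) 0 t + c * cint (fun s => dot a (w' s)) 0 t.
Proof.
move=> cw cw'; have i1 := halfline_integrable t (ccontinuous_dot a cw).
have i2 := halfline_integrable t (ccontinuous_dot a cw').
rewrite -(cintZ c i2) -(cintD i1 (cintegrableZ c i2)).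
by apply: eq_cint => s _; rewrite dotDr dotZr.
Qed.

Variables (nd nr : nat) (q : R) (h g : R -> C) (Sd : 'M[C]_nd) (Sr : 'M[C]_nr).
Variables (qd1 qd2 ld : 'cV[C]_nd) (qr lr : 'cV[C]_nr) (l : R -> C) (l0 : C).
Local Notation state := (@state R nd nr).
Let err := error_system q h g Sd Sr qd1 qd2 qr ld lr l l0.

Lemma error_lin c (X X' : R -> state) : err X -> err X' ->
  err (fun t => state_lin c (X t) (X' t)).
Proof.
move=> [Y [r d z]] [Y' [r' d' z']]; exists (fun t => Y t + c * Y' t).
have [[cd _] [cd' _]] := (d, d'); split.
- by apply: ode_ext (ode_lin c r r') => t _; rewrite scaler0 addr0.
- by apply: ode_ext (ode_lin c d d') => t _; rewrite scalerA -scalerDl.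
- apply: schrodinger_ext (schrodinger_lin c z z') => //= t.
  + by move=> x _; rewrite (cint_dot_lin _ _ _ cd cd'); ring.
  + by move=> _; rewrite (cint_dot_lin _ _ _ cd cd').
  + by move=> _; ring.
Qed.

Variables (u : R -> C) (X : R -> state) (Ym : R -> C).
Hypothesis plantX : plant_system q h g Sd Sr qd1 qd2 u X Ym.
Let obs := observer_system q h g Sd Sr qd1 qd2 qr ld lr l l0 (reference qr X) u Ym.

(** Control and plant data are common to both systems and cancel in the difference by linearity; the
    output of the error is the observer output minus the measurement. *)
Lemma observer_error Xhat : obs Xhat -> err (fun t => state_lin (-1) (Xhat t) (X t)).
Proof.
have [/ode_block[d r] z] := plantX; have [[cd _] [cr _]] := (d, r).
move=> [Y [rh dh zh]]; have [[cdh _] [crh _]] := (dh, rh).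
exists (fun t => Y t + -1 * Ym t); split.
- apply/ode_feedback; apply: ode_ext (ode_lin (-1) rh r) => t _; rewrite scaler0 addr0; congr (_ *: _).
  by apply: eq_cint => s _; rewrite dotDr dotZr mulN1r.
- by apply: ode_ext (ode_lin (-1) dh d) => t _; rewrite scaler0 addr0 mulN1r.
- apply: schrodinger_ext (schrodinger_lin (-1) zh z) => //= t.
  + by move=> x _; rewrite (cint_dot_lin _ _ _ cdh cd); ring.
  + by move=> _; rewrite (cint_dot_lin _ _ _ cdh cd).
  + by move=> _; ring.
Qed.

(** Adding the plant trajectory to an error trajectory restores control and measurement; existence
    for the observer is thereby inherited from the error system. *)
Lemma error_observer E : err E -> obs (fun t => state_lin 1 (E t) (X t)).
Proof.
have [/ode_block[d r] z] := plantX; have [[cd _] [cr _]] := (d, r).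
move=> [Y [re de ze]]; have [[cde _] [cre _]] := (de, re).
exists (fun t => Y t + 1 * Ym t); split.
- move: re => /ode_feedback re; apply: ode_ext (ode_lin 1 re r) => t _; rewrite scaler0 addr0; congr (_ *: _).
  by apply: eq_cint => s _; rewrite dotDr dotZr mul1r addrK.
- by apply: ode_ext (ode_lin 1 de d) => t _; rewrite scaler0 addr0 mul1r addrK.
- apply: schrodinger_ext (schrodinger_lin 1 ze z) => //= t.
  + by move=> x _; rewrite (cint_dot_lin _ _ _ cde cd); ring.
  + by move=> _; rewrite (cint_dot_lin _ _ _ cde cd).
  + by move=> _; ring.
Qed.

End ObserverDynamics.

(** * Uniqueness of error trajectories and the observer property *)

Lemma cvg_exp_decay (R : realType) (M m N : R) : 0 < m ->
  M * expR (- m * t) * N @[t --> +oo] --> (0 : R).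
Proof.
move=> m0; rewrite -[X in _ --> X](mul0r N) -[X in _ --> X * N](mulr0 M).
apply: cvgM; last exact: cvg_cst; apply: cvgM; first exact: cvg_cst.
under eq_fun do rewrite mulNr.
apply: (@cvg_comp _ _ _ (fun t => m * t) (fun x => expR (- x)) _ _ _ _ (@cvgr_expR R)).
exact: gt0_cvgMry m0 cvg_id.
Qed.

(** The difference of two solutions is a solution with initial norm zero, and the decay estimate
    keeps it at zero. *)
Lemma error_unique (R : realType) nd nr (err : (R -> @state R nd nr) -> Prop) (M m : R) :
  (forall X, err X -> forall t, 0 <= t -> L2 (st_z (X t))) ->
  (forall X X', err X -> err X' -> err (fun t => state_lin (-1) (X t) (X' t))) ->
  (forall X, err X -> forall t, 0 <= t ->
    state_norm (X t) <= M * expR (- m * t) * state_norm (X 0)) ->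
  forall X X', err X -> err X' -> state_eq (X 0) (X' 0) ->
    forall t, 0 <= t -> state_eq (X t) (X' t).
Proof.
move=> eL elin est X X' eX eX' e0 t t0; apply: state_norm_eq; [exact: eL|exact: eL|].
have := est _ (elin _ _ eX eX') t t0.
by rewrite (state_eq_norm (eL _ eX 0 (lexx 0)) (eL _ eX' 0 (lexx 0)) e0) mulr0.
Qed.

Theorem theorem5p2 (R : realType) (nd nr : nat)
  (q : R) (hq : 0 < q)
  (h g : R -> R[i])
  (hh : ccontinuous I01 h)
  (hg : ccontinuous I01 g)
  (Sd : 'M[R[i]]_nd) (Sr : 'M[R[i]]_nr)
  (qd1 qd2 : 'cV[R[i]]_nd) (qr : 'cV[R[i]]_nr)
  (hSdiag : diagonalizable (block_mx Sd 0 0 Sr))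
  (hSimag : imaginary_spectrum (block_mx Sd 0 0 Sr))
  (hSd : exists lam, simple_spectrum Sd lam)
  (hobs : observable qr Sr)
  (cs co : R) (hcs : 0 < cs) (hco : 0 < co)
  (p px pxi pxx pxxi pxixi : R -> R -> R[i])
  (hp : is_kernel q co h p px pxi pxx pxxi pxixi)
  (hsigma : forall a, a \in sigma_o co -> ~~ eigenvalue Sd a)
  (G : R -> R[i]) (hG : is_Fo_inv p g G)
  (n : R -> 'cV[R[i]]_nd) (hn : is_regulator_sol co Sd qd1 qd2 G n)
  (ld : 'cV[R[i]]_nd) (lr : 'cV[R[i]]_nr)
  (hlr : hurwitz (Sr + lr *m qr^T))
  (hld : hurwitz (Sd + ld *m (n 1)^T))
  (lamr : 'I_nr -> R[i]) (hlamr : simple_spectrum (Sr + lr *m qr^T) lamr)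
  (lamd : 'I_nd -> R[i]) (hlamd : simple_spectrum (Sd + ld *m (n 1)^T) lamd)
  (hlam : forall j1 j2, lamr j1 != lamd j2) :
  let l := gain_l p pxi n ld in
  let l0 := p 1 1 in
  [/\ sigma_o co =
        [set a | exists j : nat, a = 'i%C * (j%:R ^+ 2 * pi ^+ 2)%:C - co%:C],
      is_observer q h g Sd Sr qd1 qd2 qr ld lr l l0,
      has_error_dynamics q h g Sd Sr qd1 qd2 qr ld lr l l0 &
      exponentially_stable (error_system q h g Sd Sr qd1 qd2 qr ld lr l l0)].
Proof.
move=> l l0; pose err := @error_system R nd nr q h g Sd Sr qd1 qd2 qr ld lr l l0.
have [M [m [M1 m0 est]]] := error_estimate hco hh hp hG hn hlr hld hlamr hlamd.
have ex := error_exists hco hh hp hG hn hlamr hlamd.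
have eL X : err X -> forall t, 0 <= t -> L2 (st_z (X t)).
  by move=> [Y [_ _ [[hL _] _]]] t t0; exact: hL.
have elin X X' : err X -> err X' -> err (fun t => state_lin (-1) (X t) (X' t)).
  exact: error_lin.
have uniq := error_unique eL elin est.
have eqT (X X0 X' : @state R nd nr) : state_eq X X0 -> state_eq X' X0 -> state_eq X X'.
  move=> [a b c] [a' b' c']; split; rewrite ?a ?b//.
  by apply: aeS (ae_and c c') => x [E E'] x01; rewrite E// E'.
have dyn u X Ym Xhat : plant_system q h g Sd Sr qd1 qd2 u X Ym ->
    observer_system q h g Sd Sr qd1 qd2 qr ld lr l l0 (reference qr X) u Ym Xhat ->
    err (fun t => state_sub (Xhat t) (X t)).
  move=> pX oX; have := observer_error pX oX; congr err.
  by apply/funext => t; rewrite state_subE.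
split.
- exact: sigma_oE.
- move=> u X Ym _ pX; have [_ [[XL _] _]] := pX; split; last first.
    move=> Xhat oX; have eX := dyn _ _ _ _ pX oX.
    apply: (@squeeze_cvgr _ _ _ _ (fun=> 0) (fun t => M * expR (- m * t) * state_norm (state_sub (Xhat 0) (X 0)))).
    + near=> t; rewrite state_norm_ge0/=; apply: (est _ eX t).
      by near: t; exact: nbhs_pinfty_ge.
    + exact: cvg_cst.
    + exact: cvg_exp_decay.
  move=> X0 hX0; split.
    (* The observer started at [X0] is the plant trajectory plus the error started at X0 - X(0). *)
    have [|E eE E0] := ex (state_lin (-1) X0 (X 0)); first exact: L2_lin hX0 (XL 0 (lexx 0)).
    exists (fun t => state_lin 1 (E t) (X t)); first exact: error_observer.
    move: E0 => [a b c]; split=> /=.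
    + by rewrite a/= scale1r scaleN1r subrK.
    + by rewrite b/= scale1r scaleN1r subrK.
    + by apply: aeS c => x Ex x01; rewrite Ex//= mulN1r mul1r subrK.
  move=> Xa Xb oa ob a0 b0 t t0.
  (* Two observer trajectories with equal initial states have errors with equal initial states;
     subtracting the same plant trajectory loses nothing. *)
  have ea := dyn _ _ _ _ pX oa; have eb := dyn _ _ _ _ pX ob.
  have [|a b c] := uniq _ _ ea eb _ t t0.
    have [a b c] := eqT _ _ _ a0 b0; split; rewrite /= ?a ?b//.
    by apply: aeS c => x E x01; rewrite E.
  split; [exact: addIr a|exact: addIr b|].
  by apply: aeS c => x E /E /addIr.
- by move=> u X Ym Xhat _ pX oX; exact: dyn pX oX.
- split; last by exists M, m.
  move=> X0 hX0; split; first exact: ex.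
  move=> X X' eX eX' h0 h0'; apply: uniq => //.
  exact: eqT h0 h0'.
Unshelve. all: by end_near.
Qed.
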